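(* Let $d\ge 3$ and let $\mathbb{B}=\{x\in\mathbb{R}^d:|x|<1\}$. Let $\Lambda$ be a sequence of points in $\mathbb{B}$ and let $\mathcal{B}=\bigcup_{\lambda\in\Lambda}B(\lambda,r_\lambda)$ be a regularly spaced collection of closed spherical obstacles, where $r_\lambda=\phi(|\lambda|)$ for a decreasing function $\phi:[0,1)\to[0,1)$; the obstacles $B(\lambda,r_\lambda)$ are pairwise disjoint, lie inside $\mathbb{B}$, and $0\notin\mathcal{B}$. Then $\mathcal{B}$ is avoidable if and only if $$\int_0^1\frac{\phi(t)^{d-2}}{(1-t)^{d-1}}\,dt<\infty .$$
   Context: For $x\in\mathbb{R}^d$ and $r\geq 0$, $B(x,r)=\{y\in\mathbb{R}^d:|x-y|\le r\}$ denotes the closed ball. Regularly spaced: the collection $\mathcal{B}=\bigcup_{\lambda\in\Lambda}B(\lambda,r_\lambda)$ is regularly spaced if (1) (separated) there exists $\epsilon>0$ such that for any two distinct $\lambda,\lambda'\in\Lambda$ with $|\lambda|\ge|\lambda'|$ one has $|\lambda-\lambda'|>\epsilon(1-|\lambda|)$; (2) (uniformly dense) there exists $R$ with $0<R<1$ such that for every $x\in\mathbb{B}$ the ball $B(x,R(1-|x|))$ contains at least one $\lambda\in\Lambda$; (3) $r_\lambda=\phi(|\lambda|)$ for every $\lambda\in\Lambda$, where $\phi:[0,1)\to[0,1)$ is a decreasing function. Avoidable: $\mathcal{B}$ is avoidable if there is positive probability that Brownian motion started at the origin hits $\partial\mathbb{B}$ before hitting any of the obstacles $B(\lambda,r_\lambda)$.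 Equivalently, with $\Omega=\mathbb{B}\setminus\mathcal{B}$, the harmonic measure $\omega(0,\partial\mathbb{B};\Omega)$ of $\partial\mathbb{B}$ at $0$ with respect to $\Omega$ is positive. *)

(* Defs.v *)
From HB Require Import structures.
From mathcomp Require Import all_boot all_order all_algebra.
From mathcomp Require Import all_classical all_reals all_analysis.

Set Implicit Arguments.
Unset Strict Implicit.
Unset Printing Implicit Defensive.
Import Order.TTheory GRing.Theory Num.Theory.
Import numFieldNormedType.Exports.
Local Open Scope classical_set_scope.
Local Open Scope ring_scope.

(* The library norm `|x| and ball on 'rV[R]_d are those of the sup norm, hence
   the Euclidean versions below; both norms induce the library topology. *)
Definition enorm (R : realType) (d : nat) (x : 'rV[R]_d) : R :=
  Num.sqrt (\sum_(i < d) x 0 i ^+ 2).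

Definition open_eball (R : realType) (d : nat) (x : 'rV[R]_d) (r : R)
  : set 'rV[R]_d := [set y | enorm (x - y) < r].

Definition closed_eball (R : realType) (d : nat) (x : 'rV[R]_d) (r : R)
  : set 'rV[R]_d := [set y | enorm (x - y) <= r].

Definition esphere (R : realType) (d : nat) (x : 'rV[R]_d) (r : R)
  : set 'rV[R]_d := [set y | enorm (x - y) = r].

Definition frontier (T : topologicalType) (A : set T) : set T :=
  closure A `\` A°.

Definition partial (R : realType) (d : nat) (i : 'I_d) (f : 'rV[R]_d -> R)
  : 'rV[R]_d -> R := fun x => 'D_(delta_mx 0 i) f x.

(* For U open; continuity of the second-order partial derivatives forces that
   of the first-order ones and of f. *)
Definition C2_on (R : realType) (d : nat) (U : set 'rV[R]_d)
    (f : 'rV[R]_d -> R) : Prop :=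
  forall x, U x -> forall i : 'I_d,
    derivable f x (delta_mx 0 i) /\
    forall j : 'I_d, derivable (partial i f) x (delta_mx 0 j) /\
      {for x, continuous (partial j (partial i f))}.

Definition laplacian (R : realType) (d : nat) (f : 'rV[R]_d -> R)
  : 'rV[R]_d -> R := fun x => \sum_(i < d) partial i (partial i f) x.

Definition harmonic_on (R : realType) (d : nat) (U : set 'rV[R]_d)
    (f : 'rV[R]_d -> R) : Prop :=
  C2_on U f /\ forall x, U x -> laplacian f x = 0.

(* F. Riesz's definition: u is upper semicontinuous on Om with values in
   [-oo, +oo[, and it lies below every harmonic function that dominates it on
   the boundary of a closed ball contained in Om. *)
Definition subharmonic_on (R : realType) (d : nat) (Om : set 'rV[R]_d)
    (u : 'rV[R]_d -> \bar R) : Prop :=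
  [/\ forall x, Om x -> (u x < +oo)%E,
      forall x (a : R), Om x -> (u x < a%:E)%E ->
        \forall y \near within Om (nbhs x), (u y < a%:E)%E
    & forall (x : 'rV[R]_d) (r : R) (h : 'rV[R]_d -> R),
        0 < r -> closed_eball x r `<=` Om ->
        {within closed_eball x r, continuous h} ->
        harmonic_on (open_eball x r) h ->
        (forall y, esphere x r y -> (u y <= (h y)%:E)%E) ->
        forall y, closed_eball x r y -> (u y <= (h y)%:E)%E].

(* Perron's method for a bounded open set Om and a bounded boundary function
   f; u ranges over the lower class of f. *)
Definition perron (R : realType) (d : nat) (Om : set 'rV[R]_d)
    (f : 'rV[R]_d -> R) (x : 'rV[R]_d) : \bar R :=
  ereal_sup [set u x | u in [set u : 'rV[R]_d -> \bar R |
    subharmonic_on Om u /\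
    forall y, frontier Om y ->
      (limf_esup u (within Om (nbhs y)) <= (f y)%:E)%E]].

(* omega(x, E; Om): the Perron solution with boundary values the indicator
   of E. *)
Definition harmonic_measure (R : realType) (d : nat) (x : 'rV[R]_d)
    (E Om : set 'rV[R]_d) : \bar R :=
  perron Om (\1_E) x.

Definition obstacles (R : realType) (d : nat) (Lam : set 'rV[R]_d)
    (rad : 'rV[R]_d -> R) : set 'rV[R]_d :=
  \bigcup_(l in Lam) closed_eball l (rad l).

Definition separated_centers (R : realType) (d : nat) (Lam : set 'rV[R]_d)
  : Prop :=
  exists2 eps : R, 0 < eps & forall l l', Lam l -> Lam l' -> l <> l' ->
    enorm l' <= enorm l -> eps * (1 - enorm l) < enorm (l - l').

Definition uniformly_dense (R : realType) (d : nat) (Lam : set 'rV[R]_d)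
  : Prop :=
  exists2 rho : R, 0 < rho < 1 & forall x, open_eball 0 1 x ->
    exists2 l, Lam l & closed_eball x (rho * (1 - enorm x)) l.

(* "Decreasing" is not strict: constant profiles are allowed. *)
Definition decreasing_profile (R : realType) (phi : R -> R) : Prop :=
  (forall t, 0 <= t < 1 -> 0 <= phi t < 1) /\
  (forall s t, 0 <= s -> s <= t -> t < 1 -> phi t <= phi s).

Definition regularly_spaced (R : realType) (d : nat) (Lam : set 'rV[R]_d)
    (rad : 'rV[R]_d -> R) (phi : R -> R) : Prop :=
  [/\ separated_centers Lam, uniformly_dense Lam, decreasing_profile phi
    & forall l, Lam l -> rad l = phi (enorm l)].

(* The harmonic measure at 0 of the unit sphere is the probability that Brownian
   motion started at 0 reaches that sphere before hitting Bs. *)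
Definition avoidable (R : realType) (d : nat) (Bs : set 'rV[R]_d) : Prop :=
  (0 < harmonic_measure 0 (esphere 0 1) (open_eball 0 1 `\` Bs))%E.

(* Main.v *)
(* Harmonic measure is the supremum of Perron's lower class.  The comparison
   principle behind everything is elementary: if [u] is sub-mean-value and [h] is
   harmonic, then [u - h + e |x|^2] has no interior maximum, because [|x|^2] is
   affine on every small sphere.

   Necessity.  If [u <= M] on [|x| < s'], then comparing [u] with
   [M (1 - rad l ^ (d-2) G_s'(x, l))] for a centre [l] close to a point of the
   smaller sphere [|x| = s] gives [u <= M / (1 + c (phi s' / (1 - s)) ^ (d-2))]
   there, hence for [|x| < s].  Iterating along the radii [1 - q^k] yields
   [u 0 <= 1 / (1 + c sum_k (phi (1 - q^(k+1)) / q^k) ^ (d-2))], and since [phi] is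
   decreasing this sum is comparable to the integral.

   Sufficiency.  Choose weights [w l] such that [w l G(x, l) >= 1] on the obstacle
   at [l].  Separation bounds the number of centres in a dyadic shell, so the
   integral condition gives [sum_l w l (1 - |l|) < oo].  The infimum [u] over finite
   [F] of [1 - sum_(l in F) w l G(x, l)] then lies in the lower class.  If [u] were
   nowhere positive, compactness and the minimum principle on a sphere near the
   boundary would force a tail of the potential to be at least [1/4] at the origin,
   contradicting summability.  So some lower function is positive near one point of
   the domain, and gluing with Newtonian kernels spreads this to the origin, as the
   domain is connected in dimension at least [3]. *)
Require Import Defs.
From HB Require Import structures.
From mathcomp Require Import all_boot all_order all_algebra.
From mathcomp Require Import all_classical all_reals all_analysis.
From mathcomp Require Import finmap lra ring zify measurable_realfun.

Set Implicit Arguments.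
Unset Strict Implicit.
Unset Printing Implicit Defensive.
Import Order.TTheory GRing.Theory Num.Theory.
Import numFieldNormedType.Exports.
Local Open Scope classical_set_scope.
Local Open Scope ring_scope.

(** * Euclidean norm and quadratic functions *)

(** No Poisson integral and no spherical mean occurs: every comparison is made with an explicit
    kernel. The members of [quad] include the affine functions, |x|^2 and the squared distances to a
    pole and, up to a factor, to its Kelvin image, so that one computation of derivatives yields
    every harmonic function in use. In the sufficiency part the origin cannot be treated directly.
    The first obstacles may carry weights that the integral does not control, and the potential may
    exceed 1 at the origin. Only the tail of the potential is small there, whereas the potential of
    a finite set is small near the unit sphere. Combining the two facts yields a positive value at
    an unknown point, which explains the transport to the origin. The way there is blocked by
    obstacles, and each is bypassed inside a thin collar. Zero radii are allowed. Such an obstacle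
    is a single point but still belongs to the frontier, where a lower function must have upper
    limit at most 0; therefore every centre has to carry a pole of positive weight. *)

Section Euclidean.
Context {R : realType} {d : nat}.
Implicit Types (x y z l v : 'rV[R]_d) (r a b s t : R).

Definition dot x y : R := \sum_(i < d) x 0 i * y 0 i.

Lemma dotC x y : dot x y = dot y x.
Proof. by apply: eq_bigr => i _; rewrite mulrC. Qed.

Lemma dotDl x y z : dot (x + y) z = dot x z + dot y z.
Proof.
by rewrite -big_split; apply: eq_bigr => i _; rewrite mxE mulrDl.
Qed.

Lemma dotZl a x y : dot (a *: x) y = a * dot x y.
Proof. by rewrite mulr_sumr; apply: eq_bigr => i _; rewrite mxE mulrA. Qed.

Lemma dotNl x y : dot (- x) y = - dot x y.
Proof. by rewrite -scaleN1r dotZl mulN1r. Qed.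

Lemma dotBl x y z : dot (x - y) z = dot x z - dot y z.
Proof. by rewrite dotDl dotNl. Qed.

Lemma dotDr x y z : dot z (x + y) = dot z x + dot z y.
Proof. by rewrite dotC dotDl !(dotC z). Qed.

Lemma dotZr a x y : dot x (a *: y) = a * dot x y.
Proof. by rewrite dotC dotZl dotC. Qed.

Lemma dotBr x y z : dot z (x - y) = dot z x - dot z y.
Proof. by rewrite dotC dotBl !(dotC z). Qed.

Lemma dot0l x : dot 0 x = 0.
Proof. by rewrite -(scale0r 0) dotZl mul0r. Qed.

Lemma dot_ge0 x : 0 <= dot x x.
Proof. by apply: sumr_ge0 => i _; rewrite -expr2 sqr_ge0. Qed.

Lemma enormE x : enorm x = Num.sqrt (dot x x).
Proof. by congr Num.sqrt; apply: eq_bigr => i _; rewrite expr2. Qed.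

Lemma enorm_ge0 x : 0 <= enorm x. Proof. exact: sqrtr_ge0. Qed.

Lemma sqr_enorm x : enorm x ^+ 2 = dot x x.
Proof. by rewrite enormE sqr_sqrtr// dot_ge0. Qed.

Lemma enorm0 : enorm (0 : 'rV[R]_d) = 0.
Proof. by rewrite enormE dot0l sqrtr0. Qed.

Lemma enormZ a x : enorm (a *: x) = `|a| * enorm x.
Proof.
by rewrite !enormE dotZl dotZr mulrA -expr2 sqrtrM ?sqr_ge0// sqrtr_sqr.
Qed.

Lemma enormN x : enorm (- x) = enorm x.
Proof. by rewrite -scaleN1r enormZ normrN1 mul1r. Qed.

Lemma enormBC x y : enorm (x - y) = enorm (y - x).
Proof. by rewrite -opprB enormN. Qed.

Lemma coord_le_enorm x i : `|x 0 i| <= enorm x.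
Proof.
rewrite -(@ler_pXn2r _ 2%N)// ?nnegrE ?enorm_ge0// sqr_enorm real_normK ?num_real//.
by rewrite /dot (bigD1 i)//= -expr2 lerDl sumr_ge0// => j _; rewrite -expr2 sqr_ge0.
Qed.

Lemma enorm_eq0 x : enorm x = 0 -> x = 0.
Proof.
move=> x0; apply/rowP => i; rewrite mxE; apply/eqP.
by rewrite -normr_le0 -x0 coord_le_enorm.
Qed.

Lemma enorm_gt0 x : x != 0 -> 0 < enorm x.
Proof.
move=> x0; rewrite lt_neqAle enorm_ge0 andbT eq_sym.
by apply: contra x0 => /eqP/enorm_eq0/eqP.
Qed.

Lemma sub_neq0_enorm x y : x <> y -> 0 < enorm (x - y).
Proof. by move=> xy; apply: enorm_gt0; rewrite subr_eq0; apply/eqP. Qed.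

Lemma cauchy_schwarz x y : dot x y <= enorm x * enorm y.
Proof.
have [->|y0] := eqVneq y 0; first by rewrite enorm0 mulr0 dotC dot0l.
have ny : 0 < enorm y by exact: enorm_gt0.
(* The square of this vector is 2 |x| |y| (|x| |y| - <x, y>). *)
have := dot_ge0 (enorm y *: x - enorm x *: y).
rewrite dotBl !dotBr !dotZl !dotZr (dotC y x) -!sqr_enorm => H.
have [->|x0] := eqVneq x 0; first by rewrite enorm0 mul0r dot0l.
have nx : 0 < enorm x by exact: enorm_gt0.
rewrite -subr_ge0 -(pmulr_rge0 _ (mulr_gt0 nx ny)).
by nra.
Qed.

Lemma enormD x y : enorm (x + y) <= enorm x + enorm y.
Proof.
rewrite -(@ler_pXn2r _ 2%N)// ?nnegrE ?addr_ge0 ?enorm_ge0//.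
rewrite sqr_enorm dotDl !dotDr (dotC y x) -!sqr_enorm.
have := cauchy_schwarz x y; lra.
Qed.

Lemma enorm_tri x y z : enorm (x - z) <= enorm (x - y) + enorm (y - z).
Proof. by rewrite -(subrKA y) enormD. Qed.

Lemma enormB_ge x y : enorm x - enorm y <= enorm (x - y).
Proof. by rewrite lerBlDr -{1}(subrK y x) enormD. Qed.

Lemma enorm_normr x : `|x| <= enorm x.
Proof.
rewrite [leLHS]mx_normE; elim/big_ind: _ => [|a b Ha Hb|[i j] _]; first exact: enorm_ge0.
  by rewrite /Order.max; case: ifP.
by rewrite ord1 coord_le_enorm.
Qed.

Lemma enorm_coord_le x r : 0 <= r -> (forall i, `|x 0 i| <= r) ->
  enorm x <= Num.sqrt d%:R * r.
Proof.
move=> r0 xr; rewrite -(@ler_pXn2r _ 2%N) ?nnegrE ?mulr_ge0 ?sqrtr_ge0 ?enorm_ge0//.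
rewrite sqr_enorm exprMn sqr_sqrtr ?ler0n// mulrC mulr_natr.
rewrite -[X in _ *+ X]card_ord -sumr_const; apply: ler_sum => i _.
rewrite -expr2 -real_normK ?num_real//.
by rewrite ler_pXn2r ?nnegrE.
Qed.

Lemma nbhs_enorm x (A : set 'rV[R]_d) :
  nbhs x A <-> exists2 e, 0 < e & forall z, enorm (z - x) < e -> A z.
Proof.
split=> [/nbhs_normP[e /= e0 eA]|[e e0 eA]].
  exists e => // z ze; apply: eA; rewrite /= -normrN opprB.
  exact: le_lt_trans (enorm_normr _) ze.
(* Passing from the sup norm costs a factor sqrt d; the added 1 keeps the denominator positive when
   d = 0. *)
apply/(nbhs_normP x (fun z => A z)); exists (e / (Num.sqrt d%:R + 1)).
  by rewrite /= divr_gt0// ltr_wpDl ?sqrtr_ge0.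
move=> z /= zx; apply: eA; rewrite enormBC.
have s1 : 0 < Num.sqrt d%:R + 1 :> R by rewrite ltr_wpDl ?sqrtr_ge0.
have : Num.sqrt d%:R * `|x - z| < e.
  rewrite ltr_pdivlMr// in zx; apply: le_lt_trans zx.
  by rewrite mulrC ler_wpM2l// lerDl.
apply: le_lt_trans; apply: enorm_coord_le => // i.
rewrite [leRHS]mx_normrE.
exact: (@le_bigmax _ _ _ 0 (fun k : 'I_1 * 'I_d => `|(x - z) k.1 k.2|) (0, i)).
Qed.

Lemma near_enorm x r : 0 < r -> \forall z \near x, enorm (z - x) < r.
Proof. by move=> r0; apply/nbhs_enorm; exists r. Qed.

Lemma dotr_continuous l : continuous (fun x => dot x l).
Proof.
move=> x; have FF : Filter (nbhs x) by exact: nbhs_filter.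
rewrite /continuous_at /dot; apply: cvg_big => [|i _]; first exact: add_continuous.
by apply: continuousM; [exact: coord_continuous|exact: cvg_cst].
Qed.

Lemma enorm_continuous l : continuous (fun x => enorm (x - l)).
Proof.
move=> x; apply/(@cvgrPdist_lt _ _ _ (nbhs x)) => e e0; near=> z.
have : enorm (z - x) < e by near: z; exact: near_enorm.
apply: le_lt_trans; rewrite ler_norml.
have := enorm_tri x z l; have := enorm_tri z x l; rewrite (enormBC x z); lra.
Unshelve. all: by end_near. Qed.

Lemma open_eball_open x r : open (open_eball x r).
Proof.
have -> : open_eball x r = (fun y => enorm (y - x)) @^-1` [set t | t < r].
  by apply/seteqP; split => y /=; rewrite /open_eball /= enormBC.
by apply: open_comp; [move=> ? _; exact: enorm_continuous|exact: open_lt].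
Qed.

Lemma closed_eball_closed x r : closed (closed_eball x r).
Proof.
have -> : closed_eball x r = (fun y => enorm (y - x)) @^-1` [set t | t <= r].
  by apply/seteqP; split => y /=; rewrite /closed_eball /= enormBC.
by apply: preimage_closed; [move=> ? _; exact: enorm_continuous|exact: closed_le].
Qed.

Lemma esphere_closed x r : closed (esphere x r).
Proof.
have -> : esphere x r = (fun y => enorm (y - x)) @^-1` [set t | t = r].
  by apply/seteqP; split => y /=; rewrite /esphere /= enormBC.
by apply: preimage_closed; [move=> ? _; exact: enorm_continuous|exact: closed_eq].
Qed.

Lemma closed_eball_compact x r : compact (closed_eball x r).
Proof.
apply: bounded_closed_compact; last exact: closed_eball_closed.
exists (enorm x + r); split; first exact: num_real.
move=> M /ltW rM y xy; apply: le_trans (enorm_normr _) (le_trans _ rM).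
by rewrite -[y](subKr x); apply: le_trans (enormD _ _) _; rewrite enormN lerD2l.
Qed.

Lemma esphere_compact x r : compact (esphere x r).
Proof.
apply: (subclosed_compact (@esphere_closed x r) (@closed_eball_compact x r)).
by move=> y; rewrite /esphere /closed_eball /= => ->.
Qed.

(** One family that contains the affine functions (a = 0), |x|^2 and |x - l|^2 and is closed under
    directional derivatives; all kernels below are powers of its members. *)
Definition quad a l b x : R := a * dot x x - 2 * dot x l + b.

Lemma quad_continuous a l b : continuous (quad a l b).
Proof.
have E : quad a l b = (fun y => a * (enorm (y - 0) * enorm (y - 0)) + - 2 * dot y l + b).
  by apply/funext => y; rewrite subr0 -expr2 sqr_enorm mulNr.
rewrite E => x; have FF : Filter (nbhs x) by exact: nbhs_filter.
rewrite /continuous_at; apply: cvgD; last exact: cvg_cst.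
apply: cvgD; (apply: cvgM; first exact: cvg_cst).
  by apply: cvgM; exact: enorm_continuous.
exact: dotr_continuous.
Qed.

(** Both difference quotients are the same function of the increment, so calculus on the line
    applies to directional derivatives. *)
Lemma is_derive_line (f : 'rV[R]_d -> R) x v t df :
  is_derive (t *: v + x) v f df <-> is_derive t 1 (fun h => f (h *: v + x)) df.
Proof.
have E : (fun h : R => h^-1 *: ((f \o shift (t *: v + x)) (h *: v) - f (t *: v + x))) =
  (fun h : R => h^-1 *: (((fun h => f (h *: v + x)) \o shift t) (h *: 1) - f (t *: v + x))).
  by apply/funext => h /=; rewrite [h *: 1]mulr1 scalerDl addrA.
by split=> -[]; rewrite /derivable /derive => ? ?; split; rewrite /derivable /derive ?E// -?E.
Qed.

Lemma is_derive_quad a l b x v :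
  is_derive x v (quad a l b) (quad 0 (- a *: v) (- 2 * dot v l) x).
Proof.
rewrite -[x in is_derive x](add0r x) -(scale0r v); apply/is_derive_line.
have -> : (fun h : R => quad a l b (h *: v + x)) =
    (fun h : R => (a * dot v v) * h ^+ 2 + (2 * a * dot x v - 2 * dot v l) * h + quad a l b x).
  apply/funext => h; rewrite /quad !dotDl !dotDr !dotZl !dotZr (dotC v x); ring.
apply: is_derive_eq.
rewrite /quad /= dotZr; set A := dot v v; set B := dot x v; set C := dot v l.
by rewrite /GRing.scale /=; ring.
Qed.

End Euclidean.

(** * Harmonic functions *)

Section Harmonic.
Context {R : realType} {d : nat}.
Implicit Types (x y z l v : 'rV[R]_d) (r a b s t : R) (U V : set 'rV[R]_d) (f g h : 'rV[R]_d -> R).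

Local Notation e_ i := (delta_mx 0 i : 'rV[R]_d).

Lemma dot_delta x i : dot x (e_ i) = x 0 i.
Proof.
rewrite /dot (bigD1 i)//= mxE !eqxx mulr1 big1 ?addr0// => j ji.
by rewrite mxE (negPf ji) andbF mulr0.
Qed.

Lemma open_near U x : open U -> U x -> \forall z \near x, U z.
Proof. by move=> oU Ux; apply: open_nbhs_nbhs. Qed.

Lemma near_eq_continuous f g x :
  (\forall z \near x, f z = g z) -> {for x, continuous f} -> {for x, continuous g}.
Proof.
move=> fg fc; have FF : Filter (nbhs x) by exact: nbhs_filter.
rewrite /prop_for /continuous_at -(nbhs_singleton fg).
exact: cvg_trans (near_eq_cvg fg) fc.
Qed.

(** The candidates [df] and [ddf] agree with the partial derivatives only on [U]. Openness makes
    this agreement hold near each point, as second derivatives and continuity require. *)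
Lemma C2_intro U f (df : 'I_d -> 'rV[R]_d -> R) (ddf : 'I_d -> 'I_d -> 'rV[R]_d -> R) :
  open U ->
  (forall x i, U x -> is_derive x (e_ i) f (df i x)) ->
  (forall x i j, U x -> is_derive x (e_ j) (df i) (ddf i j x)) ->
  (forall x i j, U x -> {for x, continuous (ddf i j)}) ->
  C2_on U f /\ forall x, U x -> laplacian f x = \sum_(i < d) ddf i i x.
Proof.
move=> oU Df Ddf cddf.
have E1 x i : U x -> partial i f x = df i x.
  by move=> Ux; rewrite /partial; exact: (derive_val (is_derive := Df x i Ux)).
have E1n x i : U x -> \forall z \near x, df i z = partial i f z.
  by move=> Ux; apply: filterS (open_near oU Ux) => z Uz; rewrite E1.
have E2 x i j : U x -> is_derive x (e_ j) (partial i f) (ddf i j x).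
  by move=> Ux; apply: near_eq_is_derive (E1n x i Ux) (Ddf x i j Ux).
have E2v x i j : U x -> partial j (partial i f) x = ddf i j x.
  by move=> Ux; rewrite /partial; exact: (derive_val (is_derive := E2 x i j Ux)).
split; last by move=> x Ux; apply: eq_bigr => i _; rewrite E2v.
move=> x Ux i; split; first exact: (ex_derive (is_derive := Df x i Ux)).
move=> j; split; first exact: (ex_derive (is_derive := E2 x i j Ux)).
apply: near_eq_continuous (cddf x i j Ux).
by apply: filterS (open_near oU Ux) => z Uz; rewrite E2v.
Qed.

Lemma C2_is_derive U f x i : C2_on U f -> U x -> is_derive x (e_ i) f (partial i f x).
Proof. by move=> Cf Ux; apply: DeriveDef => //; exact: (Cf x Ux i).1. Qed.

Lemma C2_is_derive2 U f x i j : C2_on U f -> U x ->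
  is_derive x (e_ j) (partial i f) (partial j (partial i f) x).
Proof. by move=> Cf Ux; apply: DeriveDef => //; exact: ((Cf x Ux i).2 j).1. Qed.

Lemma continuous_lin (a b : R) f g x : {for x, continuous f} -> {for x, continuous g} ->
  {for x, continuous (fun y => a * f y + b * g y)}.
Proof.
move=> cf cg; have FF : Filter (nbhs x) by exact: nbhs_filter.
by rewrite /prop_for /continuous_at; apply: cvgD; apply: cvgM => //; exact: cvg_cst.
Qed.

Lemma is_derive_lin (a b : R) f g x v df dg : is_derive x v f df -> is_derive x v g dg ->
  is_derive x v (fun y => a * f y + b * g y) (a * df + b * dg).
Proof. by move=> Hf Hg; exact: (is_deriveD (is_deriveZ a Hf) (is_deriveZ b Hg)). Qed.

Lemma C2_lin U (a b : R) f g : open U -> C2_on U f -> C2_on U g ->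
  C2_on U (fun x => a * f x + b * g x) /\
  forall x, U x -> laplacian (fun x => a * f x + b * g x) x = a * laplacian f x + b * laplacian g x.
Proof.
move=> oU Cf Cg.
have [|||H1 H2] := @C2_intro U (fun x => a * f x + b * g x)
    (fun i x => a * partial i f x + b * partial i g x)
    (fun i j x => a * partial j (partial i f) x + b * partial j (partial i g) x) oU.
- by move=> x i Ux; apply: is_derive_lin; exact: C2_is_derive Ux.
- by move=> x i j Ux; apply: is_derive_lin; exact: C2_is_derive2 Ux.
- move=> x i j Ux; apply: continuous_lin.
    exact: ((Cf x Ux i).2 j).2.
  exact: ((Cg x Ux i).2 j).2.
- by split => // x Ux; rewrite H2// big_split/= !mulr_sumr.
Qed.

Lemma harmonic_lin U (a b : R) f g : open U -> harmonic_on U f -> harmonic_on U g ->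
  harmonic_on U (fun x => a * f x + b * g x).
Proof.
move=> oU [Cf hf] [Cg hg]; have [C L] := C2_lin a b oU Cf Cg.
by split; [exact: C|move=> x Ux; rewrite (L x Ux) (hf x Ux) (hg x Ux) !mulr0 addr0].
Qed.

Lemma harmonic_sub U V f : V `<=` U -> harmonic_on U f -> harmonic_on V f.
Proof. by move=> VU [C L]; split => x /VU; [exact: C|exact: L]. Qed.

Lemma quad_C2 U a l b : open U ->
  C2_on U (quad a l b) /\ forall x, U x -> laplacian (quad a l b) x = 2 * a * d%:R.
Proof.
move=> oU.
have [|||H1 H2] := @C2_intro U (quad a l b)
    (fun i => quad 0 (- a *: e_ i) (- 2 * dot (e_ i) l))
    (fun i j _ => 2 * a * dot (e_ i) (e_ j)) oU.
- by move=> x i _; exact: is_derive_quad.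
- move=> x i j _; apply: is_derive_eq (is_derive_quad _ _ _ _ _) _.
  by rewrite /quad !dotZr (dotC (e_ j)); lra.
- by move=> x i j _; exact: cst_continuous.
- split => // x Ux; rewrite H2//.
  transitivity (\sum_(i < d) 2 * a); last by rewrite sumr_const card_ord mulr_natr.
  by apply: eq_bigr => i _; rewrite dot_delta mxE !eqxx mulr1.
Qed.

Lemma affine_harmonic U l b : open U -> harmonic_on U (quad 0 l b).
Proof. by move=> oU; have [C L] := quad_C2 0 l b oU; split=> // x /L->; rewrite mulr0 mul0r. Qed.

Lemma open_quad_gt0 a l b : open [set x | 0 < quad a l b x].
Proof.
apply: (@open_comp _ _ (quad a l b) [set t | 0 < t]); last exact: open_gt.
by move=> x _; exact: quad_continuous.
Qed.

Lemma powR_quad_continuous a l b p x : 0 < quad a l b x ->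
  {for x, continuous (fun y => quad a l b y `^ p)}.
Proof.
move=> Q0; apply: (@continuous_comp _ _ _ (quad a l b) (fun t => t `^ p)).
  exact: quad_continuous.
apply: differentiable_continuous; apply/derivable1_diffP.
exact: (ex_derive (is_derive := is_derive1_powR p Q0)).
Qed.

Lemma is_derive_powR_quad a l b p x v : 0 < quad a l b x ->
  is_derive x v (fun y => quad a l b y `^ p)
    (p * quad a l b x `^ (p - 1) * quad 0 (- a *: v) (- 2 * dot v l) x).
Proof.
move=> Q0; rewrite -[x in is_derive x](add0r x) -(scale0r v); apply/is_derive_line.
have Hq : is_derive (0 : R) (1 : R) (fun h : R => quad a l b (h *: v + x) : R)
    (quad 0 (- a *: v) (- 2 * dot v l) x : R).
  by apply/is_derive_line; rewrite scale0r add0r; exact: is_derive_quad.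
pose q (h : R) : R := quad a l b (h *: v + x).
suff Hp : is_derive (q 0) (1 : R) (fun t : R => t `^ p) (p * quad a l b x `^ (p - 1)).
  exact: (@is_derive1_comp _ _ q _ _ _ Hp Hq).
by rewrite /q scale0r add0r; exact: is_derive1_powR.
Qed.

(* When [a * b = |l|^2] the function [quad a l b] is [a |x - l / a|^2] (the constant
   [b] if [a = 0]), so the power is a multiple of a Newton kernel. *)
Lemma powR_quad_harmonic a l b : a * b = dot l l ->
  harmonic_on [set x | 0 < quad a l b x] (fun x => quad a l b x `^ (1 - d%:R / 2)).
Proof.
move=> abl; set p := 1 - d%:R / 2; set U := [set x | _].
have oU : open U by exact: open_quad_gt0.
pose dq i := quad 0 (- a *: e_ i) (- 2 * dot (e_ i) l).
have [|||H1 H2] := @C2_intro U (fun x => quad a l b x `^ p)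
    (fun i x => p * (quad a l b x `^ (p - 1) * dq i x))
    (fun i j x => p * (quad a l b x `^ (p - 1) * (2 * a * dot (e_ i) (e_ j)) +
        dq i x * ((p - 1) * quad a l b x `^ (p - 1 - 1) * dq j x))) oU.
- by move=> x i Ux; apply: is_derive_eq (is_derive_powR_quad _ _ Ux) _; rewrite mulrA.
- move=> x i j Ux; apply: is_deriveZ.
  apply: is_deriveM; first exact: is_derive_powR_quad.
  apply: is_derive_eq (is_derive_quad _ _ _ _ _) _.
  by rewrite /quad !dotZr (dotC (e_ j)); lra.
- move=> x i j Ux; have FF : Filter (nbhs x) by exact: nbhs_filter.
  rewrite /prop_for /continuous_at; apply: cvgM; first exact: cvg_cst.
  apply: cvgD; apply: cvgM.
  + exact: powR_quad_continuous.
  + exact: cvg_cst.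
  + exact: quad_continuous.
  + apply: cvgM; last exact: quad_continuous.
    by apply: cvgM; [exact: cvg_cst|exact: powR_quad_continuous].
split => // x Ux; rewrite H2//.
have Q0 : 0 < quad a l b x by [].
rewrite -mulr_sumr big_split /= -mulr_sumr.
have -> : \sum_(i < d) 2 * a * dot (e_ i) (e_ i) = 2 * a * d%:R.
  transitivity (\sum_(i < d) 2 * a); last by rewrite sumr_const card_ord mulr_natr.
  by apply: eq_bigr => i _; rewrite dot_delta mxE !eqxx mulr1.
(* The squared gradient is 4 |a x - l|^2, which is 4 a times the quadratic because a b = |l|^2. The
   Laplacian is then a multiple of d + 2 (p - 1) = 0. *)
have -> : \sum_(i < d) dq i x * ((p - 1) * quad a l b x `^ (p - 1 - 1) * dq i x) =
   (p - 1) * quad a l b x `^ (p - 1 - 1) * (4 * a * quad a l b x).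
  transitivity ((p - 1) * quad a l b x `^ (p - 1 - 1) * \sum_(i < d) dq i x * dq i x).
    by rewrite mulr_sumr; apply: eq_bigr => i _; ring.
  congr (_ * _).
  transitivity (\sum_(i < d) 4 * ((a *: x - l) 0 i * (a *: x - l) 0 i)).
    apply: eq_bigr => i _; rewrite /dq /quad dotZr dot_delta dotC dot_delta !mxE; ring.
  rewrite -mulr_sumr -/(dot _ _) dotBl !dotBr !dotZl !dotZr -abl (dotC l x) /quad; ring.
have -> : quad a l b x `^ (p - 1) = quad a l b x `^ (p - 1 - 1) * quad a l b x.
  rewrite -[X in _ * X](@powRr1 _ _ (ltW Q0)) -powRD; first by congr (_ `^ _); ring.
  by apply/implyP => _; rewrite gt_eqF.
by rewrite /p; field.
Qed.

Lemma exists_lt_both (a b : R) : 0 < a -> 0 < b -> exists2 m, 0 < m & m < a /\ m < b.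
Proof. by move=> a0 b0; exists (Num.min a b / 2); case: (leP a b) => ?; lra. Qed.

(** The derivative [dg] vanishes at 0. With [c] positive it would be positive just to the right of
    0, and the mean value theorem would push [g] above its maximum. *)
Lemma second_derivative_at_max (g dg : R -> R) (c e : R) : 0 < e ->
  (forall t, `|t| < e -> is_derive t 1 g (dg t)) -> (forall t, `|t| < e -> g t <= g 0) ->
  is_derive (0 : R) (1 : R) dg c -> c <= 0.
Proof.
move=> e0 Dg gmax Ddg; rewrite leNgt; apply/negP => c0.
have dg0 : dg 0 = 0.
  have inE t : t \in `](- e), e[ = (`|t| < e) by rewrite in_itv/= ltr_norml.
  have Dg0 : is_derive (0 : R) (1 : R) g 0.
    apply: (@derive1_at_max _ g (- e) e 0).
    - by rewrite lerNl (le_trans _ (ltW e0))// lerNl oppr0 ltW.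
    - by move=> t; rewrite inE => te; exact: (ex_derive (is_derive := Dg t te)).
    - by rewrite inE normr0.
    - by move=> t; rewrite inE; exact: gmax.
  have D0 := Dg 0; rewrite normr0 in D0.
  by rewrite -(derive_val (is_derive := D0 e0)) (derive_val (is_derive := Dg0)).
have [k k0 kP] : exists2 k, 0 < k & forall t, 0 < t < k -> 0 < dg t.
  have [D V] := Ddg.
  have : h^-1 *: ((dg \o shift 0) (h *: 1) - dg 0) @[h --> 0^'] --> c.
    by rewrite -V; exact: D.
  move=> /cvgr_gt/(_ _ c0) /nbhs_ballP [k /= k0 kP].
  exists k => // t /andP[t0 tk].
  have := kP t; rewrite /ball /= sub0r normrN gtr0_norm// => /(_ tk).
  rewrite gt_eqF// => /(_ isT); rewrite dg0 subr0 addr0 [t *: 1]mulr1.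
  by rewrite /GRing.scale/= pmulr_rgt0// invr_gt0.
have [m m0 [mk me]] := exists_lt_both k0 e0.
have [|| t] := @MVT _ g dg 0 m m0.
- move=> t /itvP tm; apply: Dg; rewrite ger0_norm ?tm//.
  by rewrite (lt_trans _ me) ?tm.
- apply: derivable_within_continuous => t /itvP tm.
  apply: (ex_derive (is_derive := Dg t _)); rewrite ger0_norm ?tm//.
  by rewrite (le_lt_trans _ me) ?tm.
move=> /itvP tm; rewrite subr0 => E.
have : g m <= g 0 by apply: gmax; rewrite gtr0_norm.
rewrite -subr_le0 E leNgt => /negP; apply.
by rewrite mulr_gt0// kP// tm (lt_trans _ mk)// tm.
Qed.

Lemma laplacian_at_max U f x : open U -> C2_on U f -> U x ->
  (\forall z \near x, f z <= f x) -> laplacian f x <= 0.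
Proof.
move=> oU Cf Ux fmax; apply: sumr_le0 => i _.
have [e e0 eP] : exists2 e, 0 < e & forall z, enorm (z - x) < e -> U z /\ f z <= f x.
  apply/nbhs_enorm; have FF : Filter (nbhs x) by exact: nbhs_filter.
  by apply: filterI => //; exact: open_near.
have eP' (t : R) : `|t| < e -> U (t *: e_ i + x) /\ f (t *: e_ i + x) <= f x.
  move=> te; apply: eP; rewrite addrK enormZ.
  suff -> : enorm (e_ i) = 1 by rewrite mulr1.
  by rewrite enormE dot_delta mxE !eqxx sqrtr1.
apply: (@second_derivative_at_max (fun t => f (t *: e_ i + x))
  (fun t => partial i f (t *: e_ i + x)) _ e e0).
- by move=> t te; apply/is_derive_line; apply: C2_is_derive Cf _; exact: (eP' t te).1.
- by move=> t te; rewrite scale0r add0r; exact: (eP' t te).2.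
- by apply/is_derive_line; rewrite scale0r add0r; exact: C2_is_derive2 Cf _.
Qed.

End Harmonic.

(** * Comparison principle *)

Section Subharmonic.
Context {R : realType} {d : nat}.
Implicit Types (x y z l v : 'rV[R]_d) (r a b s t : R) (U V Om : set 'rV[R]_d)
  (f g h : 'rV[R]_d -> R) (u : 'rV[R]_d -> \bar R).

Definition usc_at Om u x := forall a, (u x < a%:E)%E ->
  \forall y \near x, Om y -> (u y < a%:E)%E.

(* The condition of F. Riesz, required only on small balls and only at their
   centres. *)
Definition submean_at u x := exists2 r0, 0 < r0 & forall r h, 0 < r < r0 ->
  {within closed_eball x r, continuous h} -> harmonic_on (open_eball x r) h ->
  (forall y, esphere x r y -> (u y <= (h y)%:E)%E) -> (u x <= (h x)%:E)%E.

Lemma open_eball_sub U x : open U -> U x -> exists2 e, 0 < e & closed_eball x e `<=` U.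
Proof.
move=> oU Ux; have /nbhs_enorm[e e0 eU] := open_near oU Ux.
exists (e / 2); first by rewrite divr_gt0.
move=> y; rewrite /closed_eball /= enormBC => xy; apply: eU; lra.
Qed.

Lemma seq_max_ereal (T : eqType) (w : T -> \bar R) (s : seq T) (x : T) : x \in s ->
  exists2 z, z \in s & forall t : T, t \in s -> (w t <= w z)%E.
Proof.
elim: s x => // a s IH x _; case: s IH => [_|b s IH].
  by exists a; rewrite ?mem_seq1// => t; rewrite mem_seq1 => /eqP->.
have [|z zs zP] := IH b; first by rewrite mem_head.
have [az|za] := leP (w a) (w z).
  by exists z; [rewrite inE zs orbT|move=> t; rewrite inE => /predU1P[->//|/zP]].
exists a; first exact: mem_head.
move=> t; rewrite inE => /predU1P[->//|/zP tz].
exact: le_trans tz (ltW za).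
Qed.

(** Finitely many witnesses suffice for all of [K]. The one with the largest value of [w] lies in
    [K] too, hence would be beaten by another of them. *)
Lemma compact_no_max (K V : set 'rV[R]_d) (w : 'rV[R]_d -> \bar R) :
  compact K -> V `<=` K ->
  (forall y, K y -> exists2 z, V z & \forall t \near y, V t -> (w t < w z)%E) ->
  forall x, ~ V x.
Proof.
move=> cK VK H x Vx; have cK' := cK; rewrite compact_cover in cK'.
pose O z := interior [set t | V t -> (w t < w z)%E].
have [D' D'V cov] : finite_subset_cover V O K.
  apply: cK' => [i _|y Ky]; first exact: open_interior.
  by have [z Vz nz] := H y Ky; exists z.
have [z0 /= z0D _] := cov x (VK _ Vx).
have [z zD zmax] := seq_max_ereal w z0D.
have Vz : V z := set_mem (D'V z zD).
have [z' z'D /interior_subset /(_ Vz)] := cov z (VK _ Vz).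
by rewrite ltNge zmax.
Qed.

Lemma exists_real_between (a : \bar R) r : (a < r%:E)%E ->
  exists2 c, (a < c%:E)%E & c < r.
Proof.
case: a => [s|//|_].
  by rewrite lte_fin => sr; exists ((s + r) / 2); rewrite ?lte_fin; lra.
by exists (r - 1); [exact: ltNyr|lra].
Qed.

Lemma enorm_sqr_le x t : enorm x <= t -> dot x x <= t ^+ 2.
Proof.
move=> xt; rewrite -sqr_enorm ler_pXn2r// nnegrE ?enorm_ge0//.
exact: le_trans (enorm_ge0 _) xt.
Qed.

Lemma dot_diag_continuous : continuous (fun x => dot x x).
Proof.
have -> : (fun x => dot x x) = quad 1 0 0; last exact: quad_continuous.
by apply/funext => x; rewrite /quad (dotC x 0) dot0l; ring.
Qed.

Lemma continuous_within (A : set 'rV[R]_d) f : (forall x, A x -> {for x, continuous f}) ->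
  {within A, continuous f}.
Proof.
move=> H; apply/subspace_continuousP => x /H fx P nP.
rewrite /from_subspace in nP; have H1 : \forall t \near x, P (f t) := fx P nP.
have FF : Filter (nbhs x) by exact: nbhs_filter.
have H2 : \forall t \near x, A t -> P (f t) by apply: filterS H1 => t Pt _; exact: Pt.
exact: H2.
Qed.

Lemma within_continuous_near (A : set 'rV[R]_d) f x (P : set R) : {within A, continuous f} ->
  A x -> nbhs (f x) P -> \forall t \near x, A t -> P (f t).
Proof.
move=> /subspace_continuousP fc Ax nP.
by have H := fc x Ax P nP; rewrite /from_subspace in H; exact: H.
Qed.

Lemma within_continuous_lin (A : set 'rV[R]_d) (a b : R) f g : {within A, continuous f} ->
  {within A, continuous g} -> {within A, continuous (fun y => a * f y + b * g y)}.
Proof.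
move=> /subspace_continuousP fc /subspace_continuousP gc; apply/subspace_continuousP => x Ax.
have FF : Filter (within A (nbhs x)) by apply: within_filter; exact: nbhs_filter.
exact: (cvgD (cvgM (cvg_cst a) (fc x Ax)) (cvgM (cvg_cst b) (gc x Ax))).
Qed.

(* On a sphere about [x0] the function [|y|^2] is affine, hence so is the
   perturbation that makes the maximum strict. *)
Theorem max_principle V B u h :
  open V -> (forall x, V x -> enorm x <= B) ->
  (forall x, V x -> (u x < +oo)%E) -> (forall x, V x -> usc_at V u x) ->
  (forall x, V x -> submean_at u x) ->
  (forall x, V x -> {for x, continuous h}) -> harmonic_on V h ->
  (forall y e, closure V y -> ~ V y -> 0 < e ->
     \forall z \near y, V z -> (u z <= (h z + e)%:E)%E) ->
  forall x, V x -> (u x <= (h x)%:E)%E.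
Proof.
move=> oV VB ufin uusc usub hc hh ubd x Vx; rewrite leNgt; apply/negP => hux.
have B0 : 0 <= B by exact: le_trans (enorm_ge0 x) (VB _ Vx).
have [s us] : exists s, u x = s%:E.
  by move: (ufin x Vx) hux; case: (u x) => // s _ _; exists s.
pose m := s - h x; have m0 : 0 < m by rewrite subr_gt0 -lte_fin -us.
pose e := m / (4 * (B ^+ 2 + 1)).
have B1 : 0 < B ^+ 2 + 1 by rewrite ltr_wpDl// sqr_ge0.
have e0 : 0 < e by rewrite divr_gt0// mulr_gt0.
have eB : e * B ^+ 2 <= m / 4.
  have : e * (B ^+ 2 + 1) = m / 4.
    by rewrite /e; field; rewrite gt_eqF.
  lra.
have VeB z : V z -> 0 <= e * dot z z <= m / 4.
  move=> Vz; apply/andP; split; first by rewrite mulr_ge0 ?dot_ge0// ltW.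
  by apply: le_trans eB; rewrite ler_pM2l// enorm_sqr_le// VB.
pose k z := h z - e * dot z z.
have kc z : V z -> {for z, continuous k}.
  move=> Vz; have -> : k = (fun y => 1 * h y + (- e) * dot y y).
    by apply/funext => y; rewrite /k; ring.
  by apply: continuous_lin; [exact: hc|exact: dot_diag_continuous].
pose w z := (u z - (k z)%:E)%E.
have [x0 Vx0 x0max] : exists2 x0, V x0 & forall z, V z -> (w z <= w x0)%E.
  apply: contrapT => nomax.
  have nomax' z : V z -> exists2 t, V t & (w z < w t)%E.
    move=> Vz; apply: contrapT => nt; apply: nomax; exists z => // t Vt.
    by rewrite leNgt; apply/negP => wt; apply: nt; exists t.
  (* Without a maximum every point of the closure has a witness: at points of [V] by semicontinuity,
     and at boundary points [x] itself, since [w] is at most m / 2 near them and at least [m] at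
     [x]. *)
  apply: (@compact_no_max (closure V) V w _ _ _ x Vx).
  - apply: (subclosed_compact _ (@closed_eball_compact _ _ 0 B)); first exact: closed_closure.
    rewrite (proj1 (closure_id (@closed_eball R d 0 B)) (@closed_eball_closed _ _ _ _)).
    by apply: closureS => y Vy; rewrite /closed_eball /= sub0r enormN VB.
  - exact: subset_closure.
  move=> y cVy; have [Vy|nVy] := pselect (V y).
    have [z Vz wz] := nomax' y Vy; exists z => //.
    have [r wr] : exists r, w z = r%:E.
      move: (ufin z Vz) (le_lt_trans (leNye _) wz); rewrite /w.
      case: (u z) => [q _ _|/=|/=]; last by rewrite !ltxx.
        by exists (q - k z).
      by rewrite ltxx.
    have [c wc cr] : exists2 c, (w y < c%:E)%E & c < r by apply: exists_real_between; rewrite -wr.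
    have uc : (u y < (c + k y)%:E)%E by move: wc; rewrite /w lteBlDr.
    have [a' ua' a'c] := exists_real_between uc.
    have FF : Filter (nbhs y) by exact: nbhs_filter.
    have nk : \forall t \near y, a' - c < k t.
      by apply: (@cvgr_gt _ _ (nbhs y) _ k (k y) (kc y Vy)); rewrite ltrBlDl.
    near=> t => Vt; rewrite wr (@lt_trans _ _ c%:E)%E ?lte_fin//.
    rewrite /w lteBlDr// (@lt_trans _ _ a'%:E)%E//.
      by have : V t -> (u t < a'%:E)%E; [near: t; exact: uusc|exact].
    by rewrite -EFinD lte_fin -ltrBlDl; near: t.
  exists x => //; have m40 : 0 < m / 4 by rewrite divr_gt0.
  apply: filterS (ubd y _ cVy nVy m40) => t Ht Vt; have {Ht} := Ht Vt => Ht.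
  rewrite /w us -EFinB lteBlDr// (le_lt_trans Ht)// -EFinD lte_fin.
  by have := VeB t Vt; have := VeB x Vx; rewrite /k /m; rewrite /m in m0; lra.
have [M wM] : exists M, w x0 = M%:E.
  have := x0max x Vx; have := ufin x0 Vx0; rewrite /w us.
  by case: (u x0) => // q _ _; exists (q - k x0).
have uM z : V z -> (u z <= (M + k z)%:E)%E.
  by move=> Vz; have := x0max z Vz; rewrite wM /w leeBlDr// -EFinD.
have ux0 : u x0 = (M + k x0)%:E.
  by move: wM; rewrite /w; case: (u x0) => // q [<-]; congr _%:E; ring.
have [r0 r00 r0P] := usub x0 Vx0.
have [r1 r10 r1V] := open_eball_sub oV Vx0.
have [r r_0 [rr0 rr1]] := exists_lt_both r00 r10.
have crV : closed_eball x0 r `<=` V.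
  by move=> y xy; apply: r1V; apply: le_trans xy (ltW rr1).
(* On the sphere of radius [r] about [x0] this harmonic function equals M + k and so dominates [u],
   but at [x0] it is smaller than u x0 by e r^2. *)
pose H y := 1 * h y + 1 * quad 0 (e *: x0) (M - e * (r ^+ 2 - dot x0 x0)) y.
have := r0P r H; rewrite r_0 rr0 => /(_ isT).
have -> : (u x0 <= (H x0)%:E)%E = false.
  rewrite ux0 lee_fin; apply/negbTE; rewrite -ltNge /H /quad /k dotZr.
  by have : 0 < e * r ^+ 2; [rewrite mulr_gt0 ?exprn_gt0|lra].
move=> F; have : false; last by []; apply: F.
- apply/subspace_continuousP => y /crV Vy.
  apply: cvg_within_filter.
  by apply: continuous_lin; [exact: hc|exact: quad_continuous].
- have oB := @open_eball_open _ _ x0 r.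
  apply: harmonic_lin => //; last exact: affine_harmonic.
  by apply: harmonic_sub hh => y xy; apply: crV; apply: ltW.
- move=> y; rewrite /esphere /= enormBC => xy.
  have Vy : V y by apply: crV; rewrite /closed_eball /= enormBC xy.
  rewrite (le_trans (uM y Vy))// lee_fin le_eqVlt; apply/orP; left; apply/eqP.
  have := sqr_enorm (y - x0); rewrite xy dotBl !dotBr (dotC x0 y) => E.
  by rewrite /H /quad /k dotZr E; ring.
Unshelve. all: by end_near. Qed.

Lemma within_continuous_open U A f x : open U -> U `<=` A -> U x ->
  {within A, continuous f} -> {for x, continuous f}.
Proof.
move=> oU UA Ux /subspace_continuousP/(_ x (UA _ Ux)).
rewrite within_interior//; exact: filterS UA (open_near oU Ux).
Qed.

(** The local condition gives the one on arbitrary balls by comparison inside the ball.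
    Semicontinuity of [u] and continuity of [h] on the closed ball, with e / 2 each, supply the
    boundary hypothesis. *)
Lemma subharmonic_intro Om u : open Om -> (forall x, Om x -> (u x < +oo)%E) ->
  (forall x, Om x -> usc_at Om u x) -> (forall x, Om x -> submean_at u x) ->
  subharmonic_on Om u.
Proof.
move=> oOm ufin uusc usub; split; first exact: ufin.
  by move=> x a Ox uxa; exact: uusc.
move=> x r h r0 cOm hc hh hs y xy.
have [sy|nsy] := pselect (esphere x r y); first exact: hs.
have oy : open_eball x r y by rewrite /open_eball/= lt_neqAle xy andbT; apply/eqP.
have oc : open_eball x r `<=` closed_eball x r by move=> z /ltW.
have oOm' z : open_eball x r z -> Om z by move=> /oc /cOm.
apply: (@max_principle (open_eball x r) (enorm x + r)) oy.
- exact: open_eball_open.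
- move=> z /ltW xz; rewrite -[z](subKr x) (le_trans (enormD _ _))//.
  by rewrite enormN lerD2l.
- by move=> z /oOm' /ufin.
- move=> z /oOm' Oz a uza; apply: filterS (uusc z Oz a uza) => t Ht /oOm'; exact: Ht.
- by move=> z /oOm' /usub.
- by move=> z oz; apply: within_continuous_open oc oz hc; exact: open_eball_open.
- exact: hh.
move=> z e cz noz e0.
have cez : closed_eball x r z.
  rewrite (proj1 (closure_id (@closed_eball R d x r)) (@closed_eball_closed _ _ _ _)).
  exact: closureS oc _ cz.
have sz : esphere x r z.
  apply/eqP; rewrite eq_le [X in X && _]cez/= leNgt; apply/negP => ?; exact: noz.
have FF : Filter (nbhs z) by exact: nbhs_filter.
have e20 : 0 < e / 2 by rewrite divr_gt0.
have uz : (u z < (h z + e / 2)%:E)%E.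
  by rewrite (le_lt_trans (hs z sz))// lte_fin ltrDl.
have n1 := uusc z (cOm _ cez) _ uz.
have n2 : \forall t \near z, closed_eball x r t -> h z - e / 2 < h t.
  apply: (@within_continuous_near _ h z [set s | h z - e / 2 < s] hc cez).
  by apply: open_nbhs_nbhs; split; [exact: open_gt|rewrite /= ltrBlDr ltrDl].
near=> t => ot; have : Om t -> (u t < (h z + e / 2)%:E)%E by near: t.
move=> /(_ (oOm' t ot))/ltW/le_trans; apply; rewrite lee_fin.
have : h z - e / 2 < h t by move: (oc t ot); near: t.
lra.
Unshelve. all: by end_near. Qed.

Lemma subharmonic_submean Om u x : open Om -> subharmonic_on Om u -> Om x -> submean_at u x.
Proof.
move=> oOm [_ _ H] Ox; have [e e0 eO] := open_eball_sub oOm Ox.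
exists e => // r h /andP[r0 re] hc hh hs; apply: (H x r) => //.
  by move=> y xy; apply: eO; apply: le_trans xy (ltW re).
by rewrite /closed_eball /= subrr enorm0 ltW.
Qed.

Lemma subharmonic_usc Om u x : subharmonic_on Om u -> Om x -> usc_at Om u x.
Proof. by move=> [_ H _] Ox a uxa; exact: H. Qed.

Lemma continuous_usc Om f x : {for x, continuous f} -> usc_at Om (EFin \o f) x.
Proof.
move=> fc a; rewrite lte_fin => fa; have FF : Filter (nbhs x) by exact: nbhs_filter.
apply: filterS (@cvgr_lt _ _ (nbhs x) _ f (f x) fc a fa) => y ? _.
by rewrite lte_fin.
Qed.

(** A stand-in for the mean value property: f - h + e |z|^2 attains its maximum on the closed ball.
    Inside, its Laplacian 2 e d is positive, which excludes a maximum; on the sphere f <= h makes it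
    too small if f x > h x. *)
Lemma harmonic_submean (hd : (0 < d)%N) U f x : open U -> harmonic_on U f ->
  (forall x, U x -> {for x, continuous f}) -> U x -> submean_at (EFin \o f) x.
Proof.
move=> oU [Cf hf] fc Ux; have [e0 e00 e0U] := open_eball_sub oU Ux.
exists e0 => // r h /andP[r0 re] hc [Ch hh] hs; rewrite /= lee_fin.
have crU : closed_eball x r `<=` U by move=> y xy; apply: e0U; apply: le_trans xy (ltW re).
have oc : open_eball x r `<=` closed_eball x r by move=> z /ltW.
have oB := @open_eball_open _ _ x r.
rewrite leNgt; apply/negP => hfx.
pose m := f x - h x; have m0 : 0 < m by rewrite subr_gt0.
pose B := enorm x + r.
pose e := m / (4 * (B ^+ 2 + 1)).
have B1 : 0 < B ^+ 2 + 1 by rewrite ltr_wpDl// sqr_ge0.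
have e_gt0 : 0 < e by rewrite divr_gt0// mulr_gt0.
have eB : e * (B ^+ 2 + 1) = m / 4 by rewrite /e; field; rewrite gt_eqF.
pose w z := 1 * (1 * f z + (- 1) * h z) + e * quad 1 0 0 z.
have wc : {within closed_eball x r, continuous w}.
  apply: within_continuous_lin; last by apply: continuous_within => y _; exact: quad_continuous.
  by apply: within_continuous_lin => //; apply: continuous_within => y /crU; exact: fc.
have qE y : quad 1 0 0 y = dot y y by rewrite /quad (dotC y 0) dot0l; ring.
have xx : closed_eball x r x by rewrite /closed_eball /= subrr enorm0 ltW.
have [|c /set_mem xc cmax] := EVT_max_rV _ (@closed_eball_compact _ _ x r) wc; first by exists x.
have wcx : w x <= w c by apply: cmax; exact: mem_set.
have cB : dot c c <= B ^+ 2.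
  apply: enorm_sqr_le; rewrite -[c](subKr x) (le_trans (enormD _ _))//.
  by rewrite enormN lerD2l.
have [sc|nsc] := pselect (esphere x r c).
  have := hs c sc; rewrite /= lee_fin => fhc.
  have ec : e * dot c c <= m / 4.
    by rewrite -eB ler_pM2l// (le_trans cB)// lerDl.
  have ex : 0 <= e * dot x x by rewrite mulr_ge0 ?dot_ge0 ?ltW.
  by move: wcx; rewrite /w !qE; rewrite /m in m0 ec; lra.
have oc' : open_eball x r c by rewrite /open_eball/= lt_neqAle xc andbT; apply/eqP.
have Cfo : C2_on (open_eball x r) f by move=> z /oc /crU /Cf.
have [Cfh Lfh] := C2_lin 1 (-1) oB Cfo Ch.
have [Cq Lq] := @quad_C2 R d _ 1 0 0 oB.
have [Cw Lw] := C2_lin 1 e oB Cfh Cq.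
have : laplacian w c <= 0.
  apply: (laplacian_at_max oB Cw oc').
  by apply: filterS (open_near oB oc') => z oz; apply: cmax; apply: mem_set; exact: oc.
rewrite (Lw c oc') (Lfh c oc') (Lq c oc') (hf c (crU _ xc)) (hh c oc').
rewrite !mulr0 addr0 mulr0 add0r leNgt => /negP; apply.
by have d0 : (0 : R) < d%:R; [rewrite ltr0n|rewrite mulr1; apply: mulr_gt0 => //; exact: mulr_gt0].
Qed.

(** Raising the function around [x] only makes domination on small spheres harder, while the value
    to be bounded stays the same. This is what permits gluing. *)
Lemma submean_lift u u' x : submean_at u x -> u x = u' x ->
  (\forall y \near x, (u y <= u' y)%E) -> submean_at u' x.
Proof.
move=> [r0 r00 H] E /nbhs_enorm[e e0 eP].
have [r1 r10 [r1r r1e]] := exists_lt_both r00 e0.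
exists r1 => // r h /andP[r_0 rr1] hc hh hs; rewrite -E; apply: (H r) => //.
  by rewrite r_0 (lt_trans rr1).
move=> y xy; apply: le_trans (hs y xy); apply: eP.
by rewrite enormBC [enorm _]xy (lt_trans rr1).
Qed.

Lemma usc_near Om u u' x : usc_at Om u x -> Om x ->
  (\forall y \near x, Om y -> u y = u' y) -> usc_at Om u' x.
Proof.
move=> H Ox E a; rewrite -(nbhs_singleton E Ox) => /H uxa.
have FF : Filter (nbhs x) by exact: nbhs_filter.
by apply: filterS2 E uxa => y E1 E2 Oy; rewrite -E1// E2.
Qed.

Lemma usc_max Om u u' x : usc_at Om u x -> usc_at Om u' x ->
  usc_at Om (fun y => Order.max (u y) (u' y)) x.
Proof.
move=> H1 H2 a; rewrite gt_max => /andP[/H1 n1 /H2 n2].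
have FF : Filter (nbhs x) by exact: nbhs_filter.
by apply: filterS2 n1 n2 => y h1 h2 Oy; rewrite gt_max h1// h2.
Qed.

Lemma submean_max u u' x : submean_at u x -> submean_at u' x ->
  submean_at (fun y => Order.max (u y) (u' y)) x.
Proof.
move=> [r0 r00 H] [r0' r00' H']; have [r1 r10 [a b]] := exists_lt_both r00 r00'.
exists r1 => // r h /andP[r_0 rr1] hc hh hs; rewrite ge_max; apply/andP; split.
  apply: (H r) => //; first by rewrite r_0 (lt_trans rr1).
  by move=> y /hs; rewrite ge_max => /andP[].
apply: (H' r) => //; first by rewrite r_0 (lt_trans rr1).
by move=> y /hs; rewrite ge_max => /andP[].
Qed.

Lemma limf_esup_within_le u Om y b :
  (limf_esup u (within Om (nbhs y)) <= b%:E)%E <->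
  forall e, 0 < e -> \forall z \near y, Om z -> (u z <= (b + e)%:E)%E.
Proof.
rewrite limf_esupE; split => [H e e0|H].
  have : (ereal_inf [set ereal_sup [set u x | x in V] | V in within Om (nbhs y)] < (b + e)%:E)%E.
    by rewrite (le_lt_trans H)// lte_fin ltrDl.
  move=> /ereal_inf_lt [_ [W WP <-] supW].
  have FF : Filter (nbhs y) by exact: nbhs_filter.
  have {}WP : \forall z \near y, Om z -> W z := WP.
  apply: filterS WP => z Wz Oz; apply: le_trans _ (ltW supW).
  by apply: ereal_sup_ubound; exists z => //; exact: Wz.
apply/lee_addgt0Pr => e e0; rewrite -EFinD.
apply: (@le_trans _ _ (ereal_sup [set u x | x in [set z | (u z <= (b + e)%:E)%E]])).
  by apply: ereal_inf_lbound; exists [set z | (u z <= (b + e)%:E)%E] => //; exact: H.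
by apply: ge_ereal_sup => _ [z /= uz <-].
Qed.

End Subharmonic.

(** * Two-sided bounds for a difference of inverse powers *)

Section KernelBounds.
Context {R : realType}.
Implicit Types A E D r t : R.

Lemma bernoulli_le (n : nat) t : 0 <= t <= 1 -> 1 - n%:R * (1 - t) <= t ^+ n.
Proof.
move=> /andP[t0 t1]; elim: n => [|n IH]; first by rewrite expr0 mul0r subr0.
rewrite exprS -[n.+1]addn1 natrD.
have : t * (1 - n%:R * (1 - t)) <= t * t ^+ n by rewrite ler_wpM2l.
apply: le_trans; rewrite -subr_ge0.
have -> : t * (1 - n%:R * (1 - t)) - (1 - (n%:R + 1) * (1 - t)) = n%:R * (1 - t) ^+ 2 by ring.
by rewrite mulr_ge0// sqr_ge0.
Qed.

Lemma ler_invX (n : nat) (a b : R) : 0 < a -> a <= b -> b^-1 ^+ n <= a^-1 ^+ n.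
Proof.
move=> a0 ab; have b0 : 0 < b by exact: lt_le_trans ab.
by apply: lerXn2r; rewrite ?nnegrE ?invr_ge0 ?(ltW a0) ?(ltW b0)// lef_pV2 ?posrE.
Qed.

(** The Green function of a ball written in scalars: [A] is the distance to the pole, and [E] is the
    excess of the image term over its square. *)
Definition kern (n : nat) A E := A^-1 ^+ n - (Num.sqrt (A ^+ 2 + E))^-1 ^+ n.

Lemma kern_factor n A E : 0 < A -> kern n A E = A^-1 ^+ n * (1 - (A / Num.sqrt (A ^+ 2 + E)) ^+ n).
Proof.
move=> A0; rewrite /kern exprMn mulrBr mulr1 mulrA -exprMn mulVf ?gt_eqF//.
by rewrite expr1n mul1r.
Qed.

Lemma kern_ratio A E : 0 < A -> 0 <= E ->
  [/\ 0 <= A / Num.sqrt (A ^+ 2 + E), A / Num.sqrt (A ^+ 2 + E) <= 1 &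
      (A / Num.sqrt (A ^+ 2 + E)) ^+ 2 = 1 - E / (A ^+ 2 + E)].
Proof.
move=> A0 E0; have AE : 0 < A ^+ 2 + E by rewrite ltr_pwDl// exprn_gt0.
have s0 : 0 < Num.sqrt (A ^+ 2 + E) by rewrite sqrtr_gt0.
split.
- by rewrite divr_ge0// ltW.
- rewrite ler_pdivrMr// mul1r -[leLHS](ger0_norm (ltW A0)) -sqrtr_sqr ler_sqrt; lra.
- by rewrite exprMn exprVn sqr_sqrtr ?ltW//; field; rewrite gt_eqF.
Qed.

Lemma kern_ge0 n A E : 0 < A -> 0 <= E -> 0 <= kern n A E.
Proof.
move=> A0 E0; rewrite kern_factor//; have [a b _] := kern_ratio A0 E0.
apply: mulr_ge0; first by rewrite exprn_ge0// invr_ge0 ltW.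
by rewrite subr_ge0 exprn_ile1.
Qed.

Lemma kern_le n A E : 0 < A -> 0 <= E -> kern n A E <= A^-1 ^+ n.
Proof.
by move=> A0 E0; rewrite /kern lerBlDr lerDl exprn_ge0// invr_ge0 sqrtr_ge0.
Qed.

(** With t = A / sqrt (A^2 + E) in [0, 1], Bernoulli for t^2 gives 1 - t^n <= 1 - t^(2 n) <= n (1 -
    t^2), and 1 - t^2 <= E / A^2. Linearity in [E] encodes the decay at the boundary. *)
Lemma kern_upper n A E : 0 < A -> 0 <= E -> kern n A E <= A^-1 ^+ (n + 2) * (n%:R * E).
Proof.
move=> A0 E0; rewrite kern_factor// exprD -mulrA.
apply: ler_wpM2l; first by rewrite exprn_ge0// invr_ge0 ltW.
have [a b c] := kern_ratio A0 E0; set t := _ / _ in a b c *.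
have AE : 0 < A ^+ 2 + E by rewrite ltr_pwDl// exprn_gt0.
have t21 : 0 <= t ^+ 2 <= 1 by rewrite sqr_ge0/= exprn_ile1.
have H := bernoulli_le n t21.
have tn : (t ^+ 2) ^+ n <= t ^+ n.
  rewrite exprAC expr2; apply: ler_piMr; first exact: exprn_ge0.
  exact: exprn_ile1.
apply: (@le_trans _ _ (n%:R * (1 - t ^+ 2))); first by lra.
have -> : 1 - t ^+ 2 = E / (A ^+ 2 + E) by lra.
rewrite [leRHS]mulrCA; apply: ler_wpM2l => //; rewrite [leRHS]mulrC.
apply: ler_wpM2l => //; rewrite exprVn.
by rewrite lef_pV2 ?posrE ?exprn_gt0// lerDl.
Qed.

(** With the same ratio t, 1 - t^n >= 1 - t >= (1 - t^2) / 2, and 1 - t^2 = E / (A^2 + E) decreases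
    in [A] and increases in [E]. *)
Lemma kern_lower n A E r E0 : (0 < n)%N -> 0 < A -> A <= r -> 0 < E0 -> E0 <= E ->
  r^-1 ^+ n * (E0 / (2 * (r ^+ 2 + E0))) <= kern n A E.
Proof.
move=> n0 A0 Ar E00 EE.
have E_0 : 0 <= E by exact: le_trans (ltW E00) EE.
have r0 : 0 < r by exact: lt_le_trans Ar.
rewrite kern_factor//; have [a b c] := kern_ratio A0 E_0; set t := _ / _ in a b c *.
have AE : 0 < A ^+ 2 + E by rewrite ltr_pwDl// exprn_gt0.
have rE : 0 < r ^+ 2 + E0 by rewrite ltr_pwDl ?exprn_gt0// ltW.
apply: ler_pM.
- by rewrite exprn_ge0// invr_ge0 ltW.
- by rewrite divr_ge0 ?mulr_ge0// ltW.
- exact: ler_invX.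
have tn : t ^+ n <= t.
  by case: n n0 => // n _; rewrite exprS; apply: ler_piMr => //; exact: exprn_ile1.
apply: (@le_trans _ _ ((1 - t ^+ 2) / 2)).
  have -> : 1 - t ^+ 2 = E / (A ^+ 2 + E) by lra.
  have -> : E0 / (2 * (r ^+ 2 + E0)) = E0 / (r ^+ 2 + E0) / 2 by field; rewrite gt_eqF.
  rewrite ler_pM2r ?invr_gt0// ler_pdivrMr// mulrAC ler_pdivlMr//.
  have Ar2 : A ^+ 2 <= r ^+ 2 by rewrite ler_pXn2r ?nnegrE// ltW.
  by have := ler_pM (ltW E00) (sqr_ge0 A) EE Ar2; lra.
have : 0 <= (1 - t) ^+ 2 by rewrite sqr_ge0.
lra.
Qed.

End KernelBounds.

(** * Green function of a ball *)

Section Green.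
Context {R : realType} {d : nat}.
Hypothesis hd : (3 <= d)%N.
Implicit Types (x y z l : 'rV[R]_d) (r s t : R) (F : {fset 'rV[R]_d}).

(** The argument is a squared distance, whence half of the usual exponent 2 - d. *)
Definition newton (t : R) := t `^ (1 - d%:R / 2).

Lemma newtonE t : 0 < t -> newton t = (Num.sqrt t)^-1 ^+ (d - 2).
Proof.
move=> t0; have s0 : 0 < Num.sqrt t by rewrite sqrtr_gt0.
rewrite /newton -[in LHS](sqr_sqrtr (ltW t0)) -powR_mulrn ?ltW// -powRrM.
have -> : 2%:R * (1 - d%:R / 2) = - (d - 2)%:R :> R.
  by rewrite natrB ?(ltnW hd)//; field.
by rewrite powRN powR_mulrn ?ltW// exprVn.
Qed.

(** For l != 0 the second quadratic is (|l| / s)^2 times the squared distance to the Kelvin image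
    s^2 l / |l|^2; in this form it also makes sense at l = 0. *)
Definition green s l x := newton (quad 1 l (dot l l) x) -
  newton (quad (dot l l / s ^+ 2) l (s ^+ 2) x).

Definition gap s l x := (s ^+ 2 - enorm x ^+ 2) * (s ^+ 2 - enorm l ^+ 2) / s ^+ 2.

Lemma quad_direct l x : quad 1 l (dot l l) x = enorm (x - l) ^+ 2.
Proof. by rewrite sqr_enorm dotBl !dotBr (dotC l x) /quad; ring. Qed.

Lemma quad_image s l x : s != 0 ->
  quad (dot l l / s ^+ 2) l (s ^+ 2) x = enorm (x - l) ^+ 2 + gap s l x.
Proof.
move=> s0; rewrite /gap !sqr_enorm dotBl !dotBr (dotC l x) /quad; field; exact: s0.
Qed.

Lemma gap_ge0 s l x : enorm l <= s -> enorm x <= s -> 0 <= gap s l x.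
Proof.
move=> ls xs; have s0 : 0 <= s by exact: le_trans (enorm_ge0 l) ls.
by rewrite /gap divr_ge0 ?sqr_ge0// mulr_ge0// subr_ge0 ler_pXn2r ?nnegrE ?enorm_ge0.
Qed.

Lemma quad_image_gt0 s l x : 0 < s -> enorm l <= s -> enorm x <= s -> x <> l ->
  0 < quad (dot l l / s ^+ 2) l (s ^+ 2) x.
Proof.
move=> s0 ls xs xl; rewrite quad_image ?gt_eqF// ltr_pwDl ?gap_ge0//.
by rewrite exprn_gt0// sub_neq0_enorm.
Qed.

Lemma quad_direct_gt0 l x : x <> l -> 0 < quad 1 l (dot l l) x.
Proof. by move=> xl; rewrite quad_direct exprn_gt0// sub_neq0_enorm. Qed.

Lemma greenE s l x : 0 < s -> enorm l <= s -> enorm x <= s -> x <> l ->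
  green s l x = kern (d - 2) (enorm (x - l)) (gap s l x).
Proof.
move=> s0 ls xs xl; rewrite /green !newtonE ?quad_image_gt0 ?quad_direct_gt0//.
by rewrite quad_direct quad_image ?gt_eqF// sqrtr_sqr ger0_norm// enorm_ge0.
Qed.

Lemma green_ge0 s l x : 0 < s -> enorm l <= s -> enorm x <= s -> x <> l -> 0 <= green s l x.
Proof.
by move=> s0 ls xs xl; rewrite greenE// kern_ge0 ?gap_ge0// sub_neq0_enorm.
Qed.

Lemma green_boundary s l x : 0 < s -> enorm l <= s -> enorm x = s -> x <> l -> green s l x = 0.
Proof.
move=> s0 ls xs xl; rewrite greenE ?xs// /gap xs subrr !mul0r /kern addr0.
by rewrite sqrtr_sqr ger0_norm ?enorm_ge0// subrr.
Qed.

Lemma green_continuous s l x : 0 < s -> enorm l <= s -> enorm x <= s -> x <> l ->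
  {for x, continuous (green s l)}.
Proof.
move=> s0 ls xs xl; have FF : Filter (nbhs x) by exact: nbhs_filter.
rewrite /prop_for /continuous_at /green; apply: cvgB.
  by apply: powR_quad_continuous; exact: quad_direct_gt0.
by apply: powR_quad_continuous; exact: quad_image_gt0.
Qed.

Lemma green_harmonic U s l : open U -> 0 < s -> enorm l <= s ->
  (forall x, U x -> enorm x <= s /\ x <> l) -> harmonic_on U (green s l).
Proof.
move=> oU s0 ls HU.
have -> : green s l = (fun x => 1 * newton (quad 1 l (dot l l) x) +
    (-1) * newton (quad (dot l l / s ^+ 2) l (s ^+ 2) x)).
  by apply/funext => x; rewrite /green mul1r mulN1r.
apply: harmonic_lin => //.
  apply: (@harmonic_sub _ _ [set x | 0 < quad 1 l (dot l l) x]).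
    by move=> x /HU [_ xl]; exact: quad_direct_gt0.
  by apply: powR_quad_harmonic; rewrite mul1r.
apply: (@harmonic_sub _ _ [set x | 0 < quad (dot l l / s ^+ 2) l (s ^+ 2) x]).
  by move=> x /HU [xs xl]; exact: quad_image_gt0.
by apply: powR_quad_harmonic; rewrite mulfVK// sqrf_eq0 gt_eqF.
Qed.

Lemma gap1_upper l x : enorm l <= 1 -> enorm x <= 1 ->
  gap 1 l x <= 4 * (1 - enorm x) * (1 - enorm l).
Proof.
move=> l1 x1; rewrite /gap expr1n divr1.
have := enorm_ge0 l; have := enorm_ge0 x; move: (enorm l) (enorm x) l1 x1 => a b *.
have -> : (1 - b ^+ 2) * (1 - a ^+ 2) = ((1 + b) * (1 + a)) * ((1 - b) * (1 - a)) by ring.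
rewrite -[leRHS]mulrA; apply: ler_wpM2r; first by apply: mulr_ge0; lra.
have -> : 4 = 2 * 2 :> R by ring.
by apply: ler_pM; lra.
Qed.

Lemma gap1_lower l x : enorm l <= 1 -> enorm x <= 1 -> (1 - enorm x) * (1 - enorm l) <= gap 1 l x.
Proof.
move=> l1 x1; rewrite /gap expr1n divr1.
have := enorm_ge0 l; have := enorm_ge0 x; move: (enorm l) (enorm x) l1 x1 => a b *.
by apply: ler_pM; nra.
Qed.

Lemma green1_upper l x r : 0 < r -> r <= enorm (x - l) -> enorm l <= 1 -> enorm x <= 1 ->
  green 1 l x <= r^-1 ^+ d * (d%:R * (4 * (1 - enorm x) * (1 - enorm l))).
Proof.
move=> r0 rA l1 x1; have A0 : 0 < enorm (x - l) by exact: lt_le_trans rA.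
have xl : x <> l by move=> E; rewrite E subrr enorm0 ltxx in A0.
rewrite greenE//; apply: le_trans (kern_upper _ A0 (gap_ge0 l1 x1)) _.
rewrite subnK ?(ltnW hd)//; apply: ler_pM.
- by rewrite exprn_ge0// invr_ge0 ltW.
- by rewrite mulr_ge0// gap_ge0.
- exact: ler_invX.
- apply: ler_pM; rewrite ?gap_ge0 ?gap1_upper//.
  by rewrite ler_nat leq_subr.
Qed.

Lemma green_lower s l x r E0 : 0 < s -> enorm l <= s -> enorm x <= s -> x <> l ->
  enorm (x - l) <= r -> 0 < E0 -> E0 <= gap s l x ->
  r^-1 ^+ (d - 2) * (E0 / (2 * (r ^+ 2 + E0))) <= green s l x.
Proof.
move=> s0 ls xs xl xr E00 EE; rewrite greenE//; apply: kern_lower => //.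
  by rewrite subn_gt0.
exact: sub_neq0_enorm.
Qed.

Definition greens (w : 'rV[R]_d -> R) F x := \sum_(l <- F) w l * green 1 l x.

Lemma greens_harmonic (w : 'rV[R]_d -> R) F U : open U -> (forall l, l \in F -> enorm l <= 1) ->
  (forall x, U x -> enorm x <= 1 /\ x \notin F) -> harmonic_on U (greens w F).
Proof.
rewrite /greens.
move=> oU lF HU; have {lF HU} : (forall l, l \in (F : seq _) -> enorm l <= 1) /\
  (forall x, U x -> enorm x <= 1 /\ x \notin (F : seq _)) by [].
elim: (F : seq _) => [|l s IH] [lF HU].
  have -> : (fun x => \sum_(l <- [::]) w l * green 1 l x) = quad 0 0 0.
    by apply/funext => x; rewrite big_nil /quad (dotC x) dot0l; ring.
  exact: affine_harmonic.
have -> : (fun x => \sum_(l <- l :: s) w l * green 1 l x) =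
    (fun x => w l * green 1 l x + 1 * \sum_(l <- s) w l * green 1 l x).
  by apply/funext => x; rewrite big_cons mul1r.
apply: harmonic_lin => //.
  apply: green_harmonic => // [|x /HU [x1 xF]]; first by apply: lF; rewrite mem_head.
  by split => // xl; move: xF; rewrite xl mem_head.
apply: IH; split => [k ks|x /HU [x1 xF]]; first by apply: lF; rewrite inE ks orbT.
by split => //; move: xF; rewrite inE negb_or => /andP[].
Qed.

Lemma greens_continuous (w : 'rV[R]_d -> R) F x : (forall l, l \in F -> enorm l <= 1) ->
  enorm x <= 1 -> x \notin F -> {for x, continuous (greens w F)}.
Proof.
move=> lF x1 xF; have FF : Filter (nbhs x) by exact: nbhs_filter.
rewrite /prop_for /continuous_at /greens.
have H : forall l, l \in (F : seq _) -> {for x, continuous (green 1 l)}.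
  move=> l lF'; apply: green_continuous => //; first exact: lF.
  by move=> E; move: xF; rewrite E lF'.
elim: (F : seq _) H => [|l s IH] H.
  by under eq_fun do rewrite big_nil; rewrite big_nil; exact: cvg_cst.
under eq_fun do rewrite big_cons; rewrite big_cons; apply: cvgD.
  by apply: cvgM; [exact: cvg_cst|exact: (H l (mem_head _ _))].
by apply: IH => k ks; apply: H; rewrite inE ks orbT.
Qed.

End Green.

(** * Geometry of the obstacles *)

Section Obstacles.
Context {R : realType} {d : nat}.
Implicit Types (x y z l : 'rV[R]_d) (r s t : R) (Lam : set 'rV[R]_d)
  (rad : 'rV[R]_d -> R) (phi : R -> R).

Record spaced_obstacles Lam rad phi : Prop := SpacedObstacles {
  so_dim : (3 <= d)%N;
  so_ball : Lam `<=` open_eball 0 1;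
  so_sep : separated_centers Lam;
  so_dense : uniformly_dense Lam;
  so_dec : decreasing_profile phi;
  so_rad : forall l, Lam l -> rad l = phi (enorm l);
  so_disj : trivIset Lam (fun l => closed_eball l (rad l));
  so_in : forall l, Lam l -> closed_eball l (rad l) `<=` open_eball 0 1;
  so_0 : ~ obstacles Lam rad 0
}.

Lemma open_eball0 x r : open_eball 0 r x <-> enorm x < r.
Proof. by rewrite /open_eball /= sub0r enormN. Qed.

(** Finitely many balls of radius e / 2 cover the bounded region, and each contains at most one
    point of [A]. *)
Lemma separated_bounded_finite (A : set 'rV[R]_d) B e : 0 < e ->
  (forall x, A x -> enorm x <= B) ->
  (forall x y, A x -> A y -> enorm (x - y) < e -> x = y) -> finite_set A.
Proof.
move=> e0 AB sep; have := @closed_eball_compact R d 0 B; rewrite compact_cover => cK.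
have [D' _ cov] : finite_subset_cover setT (fun i : 'rV[R]_d => open_eball i (e / 2))
    (closed_eball 0 B).
  apply: cK => [i _|y _]; first exact: open_eball_open.
  by exists y => //; rewrite /open_eball /= subrr enorm0 divr_gt0.
have -> : A = \bigcup_(i in [set` D']) (A `&` open_eball i (e / 2)).
  apply/seteqP; split => [x Ax|x [i _ []]//].
  have [|i iD xi] := cov x; last by exists i.
  by rewrite /closed_eball /= sub0r enormN AB.
apply: bigcup_finite => [|i _]; first exact: finite_fset.
have [->|/set0P[a [Aa ia]]] := eqVneq (A `&` open_eball i (e / 2)) set0.
  exact: finite_set0.
apply: (@sub_finite_set _ _ [set a]); last exact: finite_set1.
move=> x [Ax ix]; apply: sep => //; apply: le_lt_trans (enorm_tri x i a) _.
by move: ia ix; rewrite /open_eball /= (enormBC i x); lra.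
Qed.

Section Geometry.
Context {Lam : set 'rV[R]_d} {rad : 'rV[R]_d -> R} {phi : R -> R}.
Hypothesis H : spaced_obstacles Lam rad phi.

Let Om := open_eball (0 : 'rV[R]_d) 1 `\` obstacles Lam rad.

Lemma so_norm1 l : Lam l -> enorm l < 1.
Proof. by move=> /(so_ball H)/open_eball0. Qed.

Lemma so_rad_ge0 l : Lam l -> 0 <= rad l.
Proof.
move=> Ll; rewrite (so_rad H Ll); have [+ _] := so_dec H.
by move=> /(_ (enorm l)); rewrite enorm_ge0 so_norm1// => /(_ isT)/andP[].
Qed.

Lemma so_neq0 l : Lam l -> l != 0.
Proof.
move=> Ll; apply/eqP => l0; apply: (so_0 H); exists l => //.
by rewrite /closed_eball /= subr0 l0 enorm0 -l0 so_rad_ge0.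
Qed.

(** The obstacle contains the point obtained by moving [l] radially outwards by [rad l], and this
    point lies in the open unit ball. The direction exists because the origin is not in the
    obstacle. *)
Lemma so_rad_lt l : Lam l -> enorm l + rad l < 1.
Proof.
move=> Ll; have l0 := enorm_gt0 (so_neq0 Ll); have r0 := so_rad_ge0 Ll.
have yE : enorm ((1 + rad l / enorm l) *: l) = enorm l + rad l.
  rewrite enormZ ger0_norm; first by rewrite mulrDl mul1r divfK// gt_eqF.
  by rewrite addr_ge0// divr_ge0// enorm_ge0.
rewrite -yE -open_eball0; apply: (so_in H Ll).
rewrite /closed_eball /= scalerDl scale1r opprD addrA subrr sub0r enormN enormZ.
by rewrite ger0_norm ?divfK ?gt_eqF// divr_ge0// enorm_ge0.
Qed.

Lemma so_finite s : s < 1 -> finite_set (Lam `&` [set l | enorm l <= s]).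
Proof.
move=> s1; have [e e0 sep] := so_sep H.
apply: (@separated_bounded_finite _ s (e * (1 - s))).
- by rewrite mulr_gt0// subr_gt0.
- by move=> x [].
have aux x y : Lam x -> Lam y -> enorm x <= s -> enorm y <= enorm x ->
    enorm (x - y) < e * (1 - s) -> x = y.
  move=> Lx Ly xs yx xy; apply: contrapT => nxy.
  have := sep x y Lx Ly nxy yx; apply/negP; rewrite -leNgt (le_trans (ltW xy))//.
  by apply: ler_wpM2l; [exact: ltW|lra].
move=> x y [Lx xs] [Ly ys] xy; have [yx|/ltW xy'] := leP (enorm y) (enorm x).
  exact: aux.
by apply/esym; apply: aux => //; rewrite enormBC.
Qed.

Lemma so_open_sub Lam' : Lam' `<=` Lam -> open (open_eball 0 1 `\` obstacles Lam' rad).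
Proof.
move=> L'L; rewrite openE => x [/open_eball0 x1 xo].
pose s := (1 + enorm x) / 2; have [xs s1] : enorm x < s /\ s < 1 by rewrite /s; split; lra.
(* An obstacle that meets the ball of radius [s] satisfies |l| - s <= rad l < 1 - |l|, hence |l| <
   t; there are finitely many of those. *)
pose t := (1 + s) / 2; have t1 : t < 1 by rewrite /t; lra.
pose G := Lam' `&` [set l | enorm l <= t].
have finG : finite_set G.
  by apply: sub_finite_set (so_finite t1) => l [/L'L ? ?].
have cK : closed (\bigcup_(l in G) closed_eball l (rad l)).
  by apply: closed_bigcup => // l _; exact: closed_eball_closed.
have nx : ~ (\bigcup_(l in G) closed_eball l (rad l)) x.
  by move=> [l [Ll _] xl]; apply: xo; exists l.
have FF : Filter (nbhs x) by exact: nbhs_filter.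
have n1 : \forall z \near x, ~ (\bigcup_(l in G) closed_eball l (rad l)) z.
  exact: (@open_near _ _ (~` _) x (closed_openC cK) nx).
have n2 : \forall z \near x, open_eball 0 s z.
  by apply: open_near; [exact: open_eball_open|exact/open_eball0].
rewrite /interior; apply: filterS2 n1 n2 => z nz /open_eball0 zs.
split; first by apply/open_eball0; exact: lt_trans s1.
move=> [l Ll zl]; apply: nz; exists l => //; split => //=.
have := so_rad_lt (L'L _ Ll); move: zl; rewrite /closed_eball /= => zl.
have := enormB_ge l z; rewrite /t; lra.
Qed.

Lemma so_open : open Om.
Proof. exact: so_open_sub. Qed.

Lemma so_Om0 : Om 0.
Proof. by split; [apply/open_eball0; rewrite enorm0|exact: so_0 H]. Qed.

Lemma so_Om_norm x : Om x -> enorm x < 1.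
Proof. by move=> [/open_eball0]. Qed.

Lemma so_Om_dist x l : Om x -> Lam l -> rad l < enorm (x - l).
Proof.
move=> [_ xo] Ll; rewrite ltNge; apply/negP => xl; apply: xo; exists l => //.
by rewrite /closed_eball /= enormBC.
Qed.

Lemma so_Om_neq x l : Om x -> Lam l -> x <> l.
Proof.
move=> Ox Ll xl; have := so_Om_dist Ox Ll.
by rewrite xl subrr enorm0 ltNge so_rad_ge0.
Qed.

Lemma closure_norm_le (A : set 'rV[R]_d) s y : (forall z, A z -> enorm z <= s) ->
  closure A y -> enorm y <= s.
Proof.
move=> As cy; have : closed_eball 0 s y.
  rewrite (proj1 (closure_id (@closed_eball R d 0 s)) (@closed_eball_closed _ _ _ _)).
  by apply: closureS cy => z /As; rewrite /closed_eball /= sub0r enormN.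
by rewrite /closed_eball /= sub0r enormN.
Qed.

Lemma so_frontier y : frontier Om y <-> closure Om y /\ ~ Om y.
Proof. by rewrite /frontier ((interior_id _).1 so_open). Qed.

Lemma so_frontierP y : closure Om y -> ~ Om y ->
  enorm y = 1 \/ (enorm y < 1 /\ obstacles Lam rad y).
Proof.
move=> cy nOy; have y1 : enorm y <= 1.
  by apply: closure_norm_le cy => z /so_Om_norm/ltW.
move: y1; rewrite le_eqVlt => /predU1P[->|y1]; [by left|right; split => //].
by apply: contrapT => no; apply: nOy; split => //; apply/open_eball0.
Qed.

End Geometry.
End Obstacles.

(** * Necessity *)

Section Necessity.
Context {R : realType} {d : nat}.
Implicit Types (x y z l : 'rV[R]_d) (r s t M : R) (u : 'rV[R]_d -> \bar R).
Context {Lam : set 'rV[R]_d} {rad : 'rV[R]_d -> R} {phi : R -> R}.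
Hypothesis H : spaced_obstacles Lam rad phi.

Let Om := open_eball (0 : 'rV[R]_d) 1 `\` obstacles Lam rad.

Lemma so_phi_ge0 t : 0 <= t -> t < 1 -> 0 <= phi t.
Proof.
by move=> t0 t1; have [+ _] := so_dec H; move=> /(_ t); rewrite t0 t1 => /(_ isT)/andP[].
Qed.

Definition lower_class u := subharmonic_on Om u /\
  forall y, frontier Om y ->
    (limf_esup u (within Om (nbhs y)) <= (\1_(esphere (0 : 'rV[R]_d) 1) y)%:E)%E.

Lemma lower_class_intro u : subharmonic_on Om u ->
  (forall y e, closure Om y -> enorm y = 1 -> 0 < e ->
     \forall z \near y, Om z -> (u z <= (1 + e)%:E)%E) ->
  (forall y e, closure Om y -> enorm y < 1 -> obstacles Lam rad y -> 0 < e ->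
     \forall z \near y, Om z -> (u z <= e%:E)%E) ->
  lower_class u.
Proof.
move=> su H1 H0; split => // y /(so_frontier H)[cy nOy].
apply/limf_esup_within_le => e e0.
have [y1|[y1 oy]] := so_frontierP cy nOy.
  by rewrite indicE mem_set ?/esphere /= ?sub0r ?enormN//; exact: H1.
rewrite indicE memNset ?add0r; first exact: H0.
by rewrite /esphere /= sub0r enormN => E; rewrite E ltxx in y1.
Qed.

Lemma lower_class_sphere u y e : lower_class u -> closure Om y -> ~ Om y -> 0 < e ->
  \forall z \near y, Om z -> (u z <= (1 + e)%:E)%E.
Proof.
move=> [_ Hu] cy nOy e0.
have Fy : frontier Om y by apply/(so_frontier H).
have FF : Filter (nbhs y) by exact: nbhs_filter.
have /limf_esup_within_le/(_ e e0) := Hu y Fy.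
apply: filterS => z uz Oz; apply: le_trans (uz Oz) _.
by rewrite lee_fin lerD2r indicE; case: (_ \in _).
Qed.

Lemma lower_class_obstacle u y e : lower_class u -> closure Om y -> ~ Om y ->
  enorm y < 1 -> 0 < e -> \forall z \near y, Om z -> (u z <= e%:E)%E.
Proof.
move=> [_ Hu] cy nOy y1 e0.
have Fy : frontier Om y by apply/(so_frontier H).
have /limf_esup_within_le/(_ e e0) := Hu y Fy.
rewrite indicE memNset ?add0r//.
by rewrite /esphere /= sub0r enormN => E; rewrite E ltxx in y1.
Qed.

Lemma quad_cst M x : quad 0 0 M x = M.
Proof. by rewrite /quad dotC dot0l; ring. Qed.

Lemma closure_setI_subset (A B : set 'rV[R]_d) : closure (A `&` B) `<=` closure A.
Proof. by apply: closureS => z []. Qed.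

Lemma lower_class_le1 u x : lower_class u -> Om x -> (u x <= 1%:E)%E.
Proof.
move=> Lu Ox; have [Su _] := Lu; have oO := so_open H.
rewrite -[X in X%:E](quad_cst _ x).
apply: (@max_principle _ _ Om 1 u (quad 0 0 1) oO) Ox.
- by move=> z /so_Om_norm/ltW.
- by move=> z Oz; have [H1 _ _] := Su; exact: H1.
- by move=> z Oz; exact: subharmonic_usc Su Oz.
- by move=> z Oz; exact: subharmonic_submean Su Oz.
- by move=> z _; exact: quad_continuous.
- exact: affine_harmonic.
move=> y e cy nOy e0; have FF : Filter (nbhs y) by exact: nbhs_filter.
apply: filterS (lower_class_sphere Lu cy nOy e0) => z uz Oz.
by rewrite quad_cst; exact: uz.
Qed.

(** The truncated domain is bounded by points of [Om] on the sphere of radius [s], where the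
    hypothesis applies, and by obstacle points, where the upper limit of [u] is at most 0 <= M. The
    unit sphere is out of reach as s < 1. *)
Lemma lower_class_ball u M s x : lower_class u -> 0 <= M -> s < 1 ->
  (forall y, Om y -> enorm y = s -> (u y <= M%:E)%E) ->
  Om x -> enorm x < s -> (u x <= M%:E)%E.
Proof.
move=> Lu M0 s1 uM Ox xs; have [Su _] := Lu; have oO := so_open H.
rewrite -[X in X%:E](quad_cst _ x).
have oV : open (Om `&` open_eball 0 s) by apply: openI => //; exact: open_eball_open.
apply: (@max_principle _ _ (Om `&` open_eball 0 s) 1 u (quad 0 0 M) oV).
- by move=> z [/so_Om_norm/ltW].
- by move=> z [Oz _]; have [H1 _ _] := Su; exact: H1.
- move=> z [Oz _] a uza; have FF : Filter (nbhs z) by exact: nbhs_filter.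
  by apply: filterS (subharmonic_usc Su Oz uza) => t Ht [/Ht].
- by move=> z [Oz _]; exact: subharmonic_submean Su Oz.
- by move=> z _; exact: quad_continuous.
- exact: affine_harmonic.
- move=> y e cy nVy e0; have FF : Filter (nbhs y) by exact: nbhs_filter.
  have ys : enorm y <= s.
    by apply: closure_norm_le cy => z [_ /open_eball0/ltW].
  have [Oy|nOy] := pselect (Om y).
    have ys' : enorm y = s.
      apply/eqP; rewrite eq_le ys/= leNgt; apply/negP => ys'; apply: nVy; split => //.
      exact/open_eball0.
    have uy : (u y < (M + e)%:E)%E by rewrite (le_lt_trans (uM y Oy ys'))// lte_fin ltrDl.
    apply: filterS (subharmonic_usc Su Oy uy) => z Hz [/Hz/ltW uz _].
    by rewrite quad_cst.
  have cOy := closure_setI_subset cy.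
  apply: filterS (lower_class_obstacle Lu cOy nOy (le_lt_trans ys s1) e0) => z Hz [/Hz uz _].
  by rewrite quad_cst (le_trans uz)// lee_fin lerDr.
- by split => //; exact/open_eball0.
Qed.

(** The majorant equals [M] on the sphere of radius [s]. It is nonnegative off the obstacles,
    because the Green function is at most |x - l|^(2 - d) and |x - l| > rad l; so it dominates [u]
    at all boundary points. *)
Lemma lower_class_green u M s l x : lower_class u -> 0 <= M -> 0 < s < 1 -> Lam l -> enorm l < s ->
  (forall y, Om y -> enorm y < s -> (u y <= M%:E)%E) ->
  Om x -> enorm x < s -> (u x <= (M * (1 - rad l ^+ (d - 2) * green s l x))%:E)%E.
Proof.
move=> Lu M0 /andP[s0 s1] Ll ls uM Ox xs; have [Su _] := Lu; have oO := so_open H.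
have hd := so_dim H.
have oV : open (Om `&` open_eball 0 s) by apply: openI => //; exact: open_eball_open.
pose h z := M * quad 0 0 1 z + (- (M * rad l ^+ (d - 2))) * green s l z.
have hE z : h z = M * (1 - rad l ^+ (d - 2) * green s l z).
  by rewrite /h quad_cst; ring.
have hc z : enorm z <= s -> z <> l -> {for z, continuous h}.
  move=> zs zl; apply: continuous_lin; first exact: quad_continuous.
  by apply: green_continuous => //; exact: ltW.
have h_ge0 z : Om z -> enorm z < s -> 0 <= h z.
  move=> Oz zs; rewrite hE mulr_ge0// subr_ge0.
  have zl := so_Om_neq H Oz Ll; have rl := so_Om_dist Oz Ll.
  have A0 := sub_neq0_enorm zl.
  rewrite greenE ?(ltW ls) ?(ltW zs)//.
  have g0 := gap_ge0 (ltW ls) (ltW zs).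
  apply: le_trans (ler_wpM2l _ (kern_le _ A0 g0)) _; first by rewrite exprn_ge0// (so_rad_ge0 H Ll).
  rewrite -exprMn exprn_ile1 ?divr_ge0 ?(so_rad_ge0 H Ll) ?enorm_ge0//.
  by rewrite ler_pdivrMr// mul1r ltW.
rewrite -hE.
apply: (@max_principle _ _ (Om `&` open_eball 0 s) 1 u h oV).
- by move=> z [/so_Om_norm/ltW].
- by move=> z [Oz _]; have [H1 _ _] := Su; exact: H1.
- move=> z [Oz _] a uza; have FF : Filter (nbhs z) by exact: nbhs_filter.
  by apply: filterS (subharmonic_usc Su Oz uza) => t Ht [/Ht].
- by move=> z [Oz _]; exact: subharmonic_submean Su Oz.
- move=> z [Oz /open_eball0 zs]; apply: hc; first exact: ltW.
  exact: (so_Om_neq H Oz Ll).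
- apply: harmonic_lin => //; first exact: affine_harmonic.
  apply: green_harmonic => //; first exact: ltW.
  move=> z [Oz /open_eball0 zs]; split; first exact: ltW.
  exact: (so_Om_neq H Oz Ll).
- move=> y e cy nVy e0; have FF : Filter (nbhs y) by exact: nbhs_filter.
  have ys : enorm y <= s.
    by apply: closure_norm_le cy => z [_ /open_eball0/ltW].
  have [Oy|nOy] := pselect (Om y).
    have ys' : enorm y = s.
      apply/eqP; rewrite eq_le ys/= leNgt; apply/negP => ys'; apply: nVy; split => //.
      exact/open_eball0.
    have yl := so_Om_neq H Oy Ll.
    have hy : h y = M by rewrite hE green_boundary ?(ltW ls)// mulr0 subr0 mulr1.
    have n1 : \forall z \near y, M - e < h z.
      by apply: (@cvgr_gt _ _ (nbhs y) _ h (h y) (hc y ys yl)); rewrite hy ltrBlDr ltrDl.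
    apply: filterS n1 => z Hz [Oz /open_eball0 zs].
    by apply: le_trans (uM z Oz zs) _; rewrite lee_fin; lra.
  have cOy := closure_setI_subset cy.
  apply: filterS (lower_class_obstacle Lu cOy nOy (le_lt_trans ys s1) e0).
  move=> z Hz [Oz /open_eball0 zs].
  by apply: le_trans (Hz Oz) _; rewrite lee_fin lerDr h_ge0.
- by split => //; exact/open_eball0.
Qed.

(** Since rho = 1 - 2 q, the centre [l] supplied by density near a point of the sphere |y| = s has
    norm at most 1 - 2 q (1 - s). It thus stays q (1 - s) away from the sphere of radius s', while
    that sphere is (1 - q)(1 - s) away from [y]. The product of these distances is the lower bound k
    (1 - s)^2 for the gap. *)
Lemma lower_class_step u M s rho : lower_class u -> 0 <= M -> 0 < s < 1 -> 0 < rho < 1 ->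
  (forall x, open_eball 0 1 x -> exists2 l, Lam l & closed_eball x (rho * (1 - enorm x)) l) ->
  let q := (1 - rho) / 2 in let k := q * (1 - q) in let s' := 1 - q * (1 - s) in
  let a := k / (2 * (1 + k)) * (phi s' / (1 - s)) ^+ (d - 2) in
  (forall y, Om y -> enorm y < s' -> (u y <= M%:E)%E) ->
  forall x, Om x -> enorm x < s -> (u x <= (M / (1 + a))%:E)%E.
Proof.
move=> Lu M0 /andP[s0 s1] /andP[r0 r1] dense q k s' a uM.
have hd := so_dim H; have [_ phidec] := so_dec H.
have q0 : 0 < q by rewrite /q; lra.
have q1 : q < 1 / 2 by rewrite /q; lra.
have k0 : 0 < k by rewrite /k mulr_gt0//; lra.
have d0 : 0 < 1 - s by lra.
have qd : q * (1 - s) <= (1 - s) / 2 by rewrite mulrC ler_wpM2l//; lra.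
have qd0 : 0 < q * (1 - s) by rewrite mulr_gt0.
have s'0 : 0 < s' by rewrite /s'; lra.
have s'1 : s' < 1 by rewrite /s'; lra.
have ss' : s < s' by rewrite /s'; lra.
have ps' : 0 <= phi s' by apply: so_phi_ge0; rewrite ?(ltW s'0).
have a0 : 0 <= a.
  rewrite /a; apply: mulr_ge0; first by apply: divr_ge0; lra.
  by apply: exprn_ge0; apply: divr_ge0 => //; exact: ltW.
have Ma : 0 <= M / (1 + a) by rewrite divr_ge0// addr_ge0.
move=> x Ox xs; apply: (lower_class_ball Lu Ma s1) => // y Oy ys.
have [l Ll yl] := dense y Oy.1; rewrite /closed_eball /= ys in yl.
have ls : enorm l <= s + rho * (1 - s).
  have := enormB_ge l y; rewrite enormBC ys; lra.
have rhoE : rho = 1 - 2 * q by rewrite /q; lra.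
have ls' : enorm l <= 1 - 2 * (q * (1 - s)).
  by apply: le_trans ls _; rewrite rhoE; lra.
have lt' : enorm l < s' by rewrite /s'; lra.
have ys' : enorm y < s' by rewrite ys.
have := lower_class_green Lu M0 _ Ll lt' uM Oy ys'.
rewrite s'0 s'1 => /(_ isT) /le_trans; apply; rewrite lee_fin.
apply: ler_wpM2l => //.
have yl' := so_Om_neq H Oy Ll.
have gk : k * (1 - s) ^+ 2 <= gap s' l y.
  rewrite /gap ys ler_pdivlMr ?exprn_gt0//.
  have -> : k * (1 - s) ^+ 2 * s' ^+ 2 = ((1 - q) * (1 - s) * s') * (q * (1 - s) * s').
    by rewrite /k; ring.
  have f0 : 0 <= (1 - q) * (1 - s) * s' by rewrite !mulr_ge0 ?ltW//; lra.
  have f1 : 0 <= q * (1 - s) * s' by exact: mulr_ge0 (ltW qd0) (ltW s'0).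
  apply: ler_pM => //.
    have -> : s' ^+ 2 - s ^+ 2 = (s' - s) * (s' + s) by ring.
    have -> : s' - s = (1 - q) * (1 - s) by rewrite /s'; ring.
    by apply: ler_wpM2l; [rewrite mulr_ge0 ?ltW//; lra|lra].
  have -> : s' ^+ 2 - enorm l ^+ 2 = (s' - enorm l) * (s' + enorm l) by ring.
  have := enorm_ge0 l => l0.
  by apply: ler_pM; rewrite ?(ltW qd0) ?(ltW s'0)//; rewrite /s'; lra.
have yl1 : enorm (y - l) <= 1 - s.
  by apply: le_trans yl _; rewrite ger_pMl// ltW.
have := green_lower hd s'0 (ltW lt') (ltW ys') yl' yl1 _ gk.
rewrite mulr_gt0 ?exprn_gt0// => /(_ isT) Hg.
have Ha : a <= rad l ^+ (d - 2) * green s' l y.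
  have rp : phi s' <= rad l.
    by rewrite (so_rad H Ll); apply: phidec; rewrite ?enorm_ge0 ?(ltW lt').
  have E : k * (1 - s) ^+ 2 / (2 * ((1 - s) ^+ 2 + k * (1 - s) ^+ 2)) = k / (2 * (1 + k)).
    have D0 : (1 - s) ^+ 2 != 0 by rewrite gt_eqF// exprn_gt0.
    move: ((1 - s) ^+ 2) D0 => D D0.
    have -> : 2 * (D + k * D) = (2 * (1 + k)) * D by ring.
    by rewrite -mulf_div divff// mulr1.
  rewrite E in Hg.
  have -> : a = phi s' ^+ (d - 2) * ((1 - s)^-1 ^+ (d - 2) * (k / (2 * (1 + k)))).
    by rewrite /a exprMn; ring.
  have c0 : 0 <= k / (2 * (1 + k)) by apply: divr_ge0; lra.
  apply: ler_pM => //; first exact: exprn_ge0.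
    by rewrite mulr_ge0// exprn_ge0// invr_ge0 ltW.
  by rewrite lerXn2r ?nnegrE// (so_rad_ge0 H Ll).
have a1 : 0 < 1 + a by rewrite ltr_pwDl.
(* The comparison yields the factor 1 - a. It is weakened to 1 / (1 + a), which is positive for
   every [a] and whose reciprocals accumulate additively under iteration. *)
apply: (@le_trans _ _ (1 - a)); first by lra.
rewrite -[leRHS]mul1r ler_pdivlMr// mulrDr.
by have := sqr_ge0 a; lra.
Qed.

(** The induction runs inwards from the trivial bound u <= 1 on the ball of radius 1 - q^(i + m),
    and (1 + T)(1 + a) >= 1 + T + a turns products into sums. The restriction 0 < i keeps the radius
    1 - q^i positive. *)
Lemma lower_class_iterate u rho : lower_class u -> 0 < rho < 1 ->
  (forall x, open_eball 0 1 x -> exists2 l, Lam l & closed_eball x (rho * (1 - enorm x)) l) ->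
  let q := (1 - rho) / 2 in let k := q * (1 - q) in
  let a (i : nat) := k / (2 * (1 + k)) * (phi (1 - q ^+ i.+1) / q ^+ i) ^+ (d - 2) in
  forall (m i : nat) x, (0 < i)%N -> Om x -> enorm x < 1 - q ^+ i ->
  (u x <= ((1 + \sum_(i <= j < i + m) a j)^-1)%:E)%E.
Proof.
move=> Lu rho01 dense q k a.
have /andP[r0 r1] := rho01.
have q0 : 0 < q by rewrite /q; lra.
have q1 : q < 1 by rewrite /q; lra.
have k0 : 0 < k by rewrite /k mulr_gt0//; lra.
have qi i : 0 < q ^+ i by rewrite exprn_gt0.
have a0 i : 0 <= a i.
  have qi1 : q ^+ i.+1 <= 1 by rewrite exprn_ile1 ?ltW.
  have pi : 0 <= phi (1 - q ^+ i.+1) by apply: so_phi_ge0; have := qi i.+1; lra.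
  rewrite /a; apply: mulr_ge0; first by apply: divr_ge0; lra.
  by apply: exprn_ge0; apply: divr_ge0 => //; exact: ltW.

elim=> [|m IH] i x i0 Ox xi.
  by rewrite addn0 big_geq// addr0 invr1; exact: lower_class_le1.
have T0 : 0 <= \sum_(i.+1 <= j < i.+1 + m) a j by apply: sumr_ge0.
have := @lower_class_step u (1 + \sum_(i.+1 <= j < i.+1 + m) a j)^-1 (1 - q ^+ i) rho
  Lu _ _ rho01 dense.
cbv zeta; have -> : 1 - (1 - rho) / 2 * (1 - (1 - q ^+ i)) = 1 - q ^+ i.+1.
  by rewrite exprS /q; ring.
have -> : 1 - (1 - q ^+ i) = q ^+ i by ring.
move=> /(_ _ _ _ x Ox xi) Hx; apply: le_trans (Hx _ _ _) _.
- by rewrite invr_ge0 addr_ge0.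
- have := qi i; case: i i0 {IH xi T0 Hx} => // i _.
  have : q ^+ i.+1 < 1 by rewrite exprn_ilt1 ?ltW.
  lra.
- by move=> y Oy yi; exact: IH.
rewrite lee_fin -/q -/k -/(a i).
rewrite (@big_ltn _ _ _ i (i + m.+1)) ?addSnnS; last by rewrite addnS ltnS leq_addr.
move: T0; rewrite addSnnS; set T := \sum_(_ <= _ < _) _ => T0.
rewrite -invfM lef_pV2 ?posrE; first by have := mulr_ge0 T0 (a0 i); lra.
  by rewrite mulr_gt0// ltr_pwDl// a0.
by rewrite ltr_pwDl// addr_ge0// a0.
Qed.

(** The origin lies in the ball of radius 1 - q, so a lower function with value b > 0 there bounds
    every partial sum by 1 / b. *)
Lemma avoidable_sum_bounded : avoidable (obstacles Lam rad) ->
  exists q c C, [/\ 0 < q < 1, 0 < c &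
   forall m, \sum_(1 <= j < 1 + m) c * (phi (1 - q ^+ j.+1) / q ^+ j) ^+ (d - 2) <= C].
Proof.
rewrite /avoidable /harmonic_measure /perron => /ereal_sup_gt[_ [u Lu <-] u0].
have [rho rho01 dense] := so_dense H.
have := lower_class_iterate Lu rho01 dense; cbv zeta.
set q := (1 - rho) / 2; set k := q * (1 - q).
have /andP[r0 r1] := rho01.
have q0 : 0 < q by rewrite /q; lra.
have q1 : q < 1 by rewrite /q; lra.
have k0 : 0 < k by rewrite /k mulr_gt0//; lra.
have O0 := so_Om0 H.
have [b u0b b0] : exists2 b : R, u 0 = b%:E & 0 < b.
  by move: u0 (lower_class_le1 Lu O0); case: (u 0) => // b; exists b; rewrite -?lte_fin.
move=> Hu; exists q, (k / (2 * (1 + k))), (b^-1); split.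
- by rewrite q0.
- by rewrite divr_gt0// mulr_gt0// addr_gt0.
move=> m; have := Hu m 1%N 0 isT O0; rewrite enorm0 expr1 subr_gt0 q1 u0b => /(_ isT).
set S := \sum_(_ <= _ < _) _; rewrite lee_fin => bS.
have S0 : 0 < 1 + S by rewrite -invr_gt0 (lt_le_trans b0).
have : 1 + S <= b^-1 by rewrite -(invrK (1 + S)) lef_pV2 ?posrE// invr_gt0.
lra.
Qed.

End Necessity.

Arguments lower_class {R d} Lam rad u.

(** * The integral as a dyadic sum *)

Section DyadicIntegral.
Context {R : realType}.
Implicit Types (q t : R) (phi : R -> R).

Let mu := @lebesgue_measure R.

Definition shell q (k : nat) : set R := `[1 - q ^+ k, 1 - q ^+ k.+1[%classic.

Lemma exists_pow_lt q t : 0 < q < 1 -> 0 < t -> exists k, q ^+ k < t.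
Proof.
move=> /andP[q0 q1] t0; have : `|q| < 1 by rewrite gtr0_norm.
move=> /cvg_expr /cvgr0_norm_lt /(_ t t0) [k _ /(_ k)]; rewrite /= leqnn => /(_ isT).
by rewrite ger0_norm ?exprn_ge0 ?ltW// => qk; exists k.
Qed.

Lemma shellP q k t : shell q k t <-> q ^+ k.+1 < 1 - t /\ 1 - t <= q ^+ k.
Proof.
rewrite /shell /= in_itv /=; split; first by move=> /andP[]; lra.
by move=> [a b]; apply/andP; split; lra.
Qed.

Lemma shell_exists q t : 0 < q < 1 -> 0 <= t < 1 -> exists k, shell q k t.
Proof.
move=> q01 /andP[t0 t1].
have ex : exists k, q ^+ k < 1 - t by apply: exists_pow_lt; rewrite // subr_gt0.
case: (ex_minnP ex) => -[|k] kt kmin; first by move: kt; rewrite expr0; lra.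
exists k; apply/shellP; split => //; rewrite leNgt; apply/negP => /kmin.
by rewrite ltnn.
Qed.

Lemma shell_range q k t : 0 < q < 1 -> shell q k t -> 0 <= t < 1.
Proof.
move=> /andP[q0 q1] /shellP[a b]; have := @exprn_ile1 _ k q (ltW q0) (ltW q1).
have := exprn_gt0 k.+1 q0; lra.
Qed.

Lemma bigcup_shell q : 0 < q < 1 -> \bigcup_k shell q k = `[0, 1[%classic.
Proof.
move=> q01; apply/seteqP; split => [t [k _ /(shell_range q01)]|t]; rewrite /= in_itv //=.
by move=> /(shell_exists q01)[k]; exists k.
Qed.

Lemma shell_inj q i j t : 0 < q < 1 -> shell q i t -> shell q j t -> i = j.
Proof.
move=> /andP[q0 q1].
have aux a b : (a < b)%N -> shell q a t -> shell q b t -> False.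
  move=> ab /shellP[H1 _] /shellP[_ H2].
  by have := @ler_wiXn2l _ q (ltW q0) (ltW q1) _ _ ab; lra.
move=> Hi Hj; case: (ltngtP i j) => // ij; exfalso; [exact: aux ij Hi Hj|exact: aux ij Hj Hi].
Qed.

Lemma trivIset_shell q : 0 < q < 1 -> trivIset [set: nat] (shell q).
Proof. by move=> q01 i j _ _ [t [ti tj]]; exact: shell_inj ti tj. Qed.

Lemma measure_shell q k : 0 < q < 1 -> mu (shell q k) = (q ^+ k - q ^+ k.+1)%:E.
Proof.
move=> /andP[q0 q1]; rewrite /mu /shell lebesgue_measure_itv /= lte_fin.
rewrite ltrD2l ltrN2 exprS gtr_pMl ?exprn_gt0// q1.
by rewrite -EFinD; congr _%:E; ring.
Qed.

Definition profile_density phi (n : nat) t : R := phi t ^+ n / (1 - t) ^+ n.+1.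

Lemma profile_density_ge0 phi n t : decreasing_profile phi -> 0 <= t < 1 ->
  0 <= profile_density phi n t.
Proof.
move=> [phi01 _] t01; have /andP[p0 _] := phi01 t t01; move: t01 => /andP[_ t1].
by rewrite divr_ge0 ?exprn_ge0// subr_ge0 ltW.
Qed.

Lemma profile_density_measurable phi (n : nat) : decreasing_profile phi ->
  measurable_fun (`[0%R, 1%R[%classic : set R) (EFin \o profile_density phi n).
Proof.
move=> [phi01 dec]; apply/measurable_EFinP.
(* Monotonicity of [phi] is known only on [0, 1); [psi] is an extension that is nonincreasing on the
   whole line, hence measurable. *)
pose psi t := if t < 0 then phi 0 else if t < 1 then phi t else 0.
pose g t := psi t ^+ n * ((1 - t) `^ (-1)) ^+ n.+1.
apply: (@eq_measurable_fun _ _ _ _ _ g).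
  move=> t /set_mem /=; rewrite in_itv /= => /andP[t0 t1].
  rewrite /g /psi ltNge t0 t1 /= powR_inv1 ?subr_ge0 ?ltW//.
  by rewrite /profile_density exprVn.
apply: measurable_funM; apply: measurable_funX.
  apply: nonincreasing_measurable => // s t st; rewrite /psi.
  have [t0|t0] := ltP t 0; first by rewrite (le_lt_trans st t0).
  have p0 : 0 <= phi 0 by have /andP[] : 0 <= phi 0 < 1 by apply: phi01; rewrite lexx ltr01.
  have [t1|t1] := ltP t 1.
    have [s0|s0] := ltP s 0; first exact: dec.
    by rewrite (le_lt_trans st t1); exact: dec.
  have [s0|s0] := ltP s 0 => //.
  have [s1|s1] := ltP s 1 => //.
  by have /andP[] : 0 <= phi s < 1 by apply: phi01; rewrite s0.
apply: measurable_funTS.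
apply: (@measurableT_comp _ _ _ _ _ _ (fun s : R => s `^ (-1)) _ (fun t : R => 1 - t)).
  exact: measurable_powR.
by apply: measurable_funB; [exact: measurable_cst|exact: measurable_id].
Qed.

Lemma shell_density_bounds phi n q k t : decreasing_profile phi -> 0 < q < 1 -> shell q k t ->
  phi (1 - q ^+ k.+1) ^+ n / (q ^+ k) ^+ n.+1 <= profile_density phi n t <=
  phi (1 - q ^+ k) ^+ n / (q ^+ k.+1) ^+ n.+1.
Proof.
move=> [phi01 dec] q01 tk; have /andP[t0 t1] := shell_range q01 tk.
have /andP[q0 q1] := q01; move/shellP: tk => [a b].
have qk0 i : 0 < q ^+ i by exact: exprn_gt0.
have qk1 i : q ^+ i <= 1 by apply: exprn_ile1; exact: ltW.
have p0 s : 0 <= s -> s < 1 -> 0 <= phi s.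
  by move=> s0 s1; have /andP[] : 0 <= phi s < 1 by apply: phi01; rewrite s0.
have H1 := qk0 k.+1; have H2 := qk1 k.+1; have H3 := qk0 k; have H4 := qk1 k.
have t1' : 0 < 1 - t by rewrite subr_gt0.
apply/andP; split; (apply: ler_pM;
  [by apply: exprn_ge0; apply: p0; lra|by rewrite invr_ge0 exprn_ge0// ltW| |]).
- by apply: lerXn2r; rewrite ?nnegrE ?p0//; try lra; apply: dec; lra.
- by rewrite lef_pV2 ?posrE ?exprn_gt0//; apply: lerXn2r; rewrite ?nnegrE//; exact: ltW.
- by apply: lerXn2r; rewrite ?nnegrE ?p0//; try lra; apply: dec; lra.
- by rewrite lef_pV2 ?posrE ?exprn_gt0//; apply: lerXn2r;
    rewrite ?nnegrE; exact: ltW.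
Qed.

Lemma integral_shells phi n q : decreasing_profile phi -> 0 < q < 1 ->
  (\int[mu]_(t in `[0%R, 1%R[) (profile_density phi n t)%:E =
   \sum_(0 <= k <oo) \int[mu]_(t in shell q k) (profile_density phi n t)%:E)%E.
Proof.
move=> Hphi q01; rewrite -(bigcup_shell q01); apply: ge0_integral_bigcup.
- by move=> k; exact: measurable_itv.
- by rewrite bigcup_shell//; exact: profile_density_measurable.
- move=> t [k _ /(shell_range q01) t01]; rewrite lee_fin.
  exact: profile_density_ge0.
- exact: trivIset_shell.
Qed.

Lemma shell_measurable_density phi n q k : decreasing_profile phi -> 0 < q < 1 ->
  measurable_fun (shell q k) (EFin \o profile_density phi n).
Proof.
move=> Hphi q01; apply: measurable_funS (profile_density_measurable n Hphi).
  exact: measurable_itv.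
by move=> t /(shell_range q01); rewrite /= in_itv.
Qed.

Lemma integral_shell_ge0 phi n q k : decreasing_profile phi -> 0 < q < 1 ->
  (0 <= \int[mu]_(t in shell q k) (profile_density phi n t)%:E)%E.
Proof.
move=> Hphi q01; apply: integral_ge0 => t /(shell_range q01) t01.
by rewrite lee_fin profile_density_ge0.
Qed.

Lemma integral_shell_upper phi n q k : decreasing_profile phi -> 0 < q < 1 ->
  (\int[mu]_(t in shell q k) (profile_density phi n t)%:E <=
   (phi (1 - q ^+ k) ^+ n / (q ^+ k.+1) ^+ n.+1 * q ^+ k)%:E)%E.
Proof.
move=> Hphi q01; have /andP[q0 q1] := q01; set c := _ / _.
have c0 : 0 <= c.
  apply: divr_ge0; last by rewrite exprn_ge0// exprn_ge0// ltW.
  have [phi01 _] := Hphi; have H1 := exprn_gt0 k q0; have H2 := @exprn_ile1 _ k q (ltW q0) (ltW q1).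
  by apply: exprn_ge0; have /andP[] : 0 <= phi (1 - q ^+ k) < 1 by apply: phi01; lra.
apply: (@le_trans _ _ (\int[mu]_(t in shell q k) cst c%:E t)%E).
  apply: ge0_le_integral.
  - exact: measurable_itv.
  - by move=> t /(shell_range q01) t01; rewrite lee_fin profile_density_ge0.
  - exact: shell_measurable_density.
  - exact: measurable_cst.
  - by move=> t tk; rewrite lee_fin; have /andP[] := shell_density_bounds n Hphi q01 tk.
rewrite integral_cst; last exact: measurable_itv.
rewrite [X in (_ * X)%E]measure_shell// -EFinM lee_fin; apply: ler_wpM2l => //.
by rewrite lerBlDr lerDl exprn_ge0// ltW.
Qed.

Lemma integral_shell_lower phi n q k : decreasing_profile phi -> 0 < q < 1 ->
  (((1 - q) * (phi (1 - q ^+ k.+1) / q ^+ k) ^+ n)%:E <=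
   \int[mu]_(t in shell q k) (profile_density phi n t)%:E)%E.
Proof.
move=> Hphi q01; have /andP[q0 q1] := q01; set c := phi (1 - q ^+ k.+1) ^+ n / (q ^+ k) ^+ n.+1.
have qk0 : 0 < q ^+ k by exact: exprn_gt0.
have c0 : 0 <= c.
  apply: divr_ge0; last by rewrite exprn_ge0// ltW.
  have [phi01 _] := Hphi; have H1 := exprn_gt0 k.+1 q0.
  have H2 := @exprn_ile1 _ k.+1 q (ltW q0) (ltW q1).
  by apply: exprn_ge0; have /andP[] : 0 <= phi (1 - q ^+ k.+1) < 1 by apply: phi01; lra.
apply: (@le_trans _ _ (\int[mu]_(t in shell q k) cst c%:E t)%E).
  rewrite integral_cst; last exact: measurable_itv.
  rewrite [X in (_ * X)%E]measure_shell// -EFinM lee_fin.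
  rewrite le_eqVlt; apply/orP; left; apply/eqP.
  rewrite /c expr_div_n (exprS _ n) (exprS q k); field.
  by rewrite !expf_neq0 ?gt_eqF.
apply: ge0_le_integral.
- exact: measurable_itv.
- by move=> t _; rewrite lee_fin.
- exact: measurable_cst.
- exact: shell_measurable_density.
- by move=> t tk; rewrite lee_fin; have /andP[] := shell_density_bounds n Hphi q01 tk.
Qed.

(** The bound [b] of shell j + 1 involves the profile at its inner radius 1 - q^(j+1), the same
    value as in the j-th term of the sum; the two differ by the constant factor [K]. As the sum
    starts at j = 1, shells 0 and 1 are counted separately. *)
Lemma integral_lt_pinfty_of_sum phi n q c C : decreasing_profile phi -> 0 < q < 1 -> 0 < c ->
  (forall m, \sum_(1 <= j < 1 + m) c * (phi (1 - q ^+ j.+1) / q ^+ j) ^+ n <= C) ->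
  (\int[mu]_(t in `[0%R, 1%R[) (profile_density phi n t)%:E < +oo)%E.
Proof.
move=> Hphi q01 c0 HC; have /andP[q0 q1] := q01.
pose b k := phi (1 - q ^+ k) ^+ n / (q ^+ k.+1) ^+ n.+1 * q ^+ k.
pose K := c^-1 * (q ^+ (n + n).+1)^-1.
have b0 k : 0 <= b k.
  apply: mulr_ge0; last by rewrite exprn_ge0// ltW.
  apply: divr_ge0; last by rewrite exprn_ge0// exprn_ge0// ltW.
  have [phi01 _] := Hphi; have H1 := exprn_gt0 k q0; have H2 := @exprn_ile1 _ k q (ltW q0) (ltW q1).
  by apply: exprn_ge0; have /andP[] : 0 <= phi (1 - q ^+ k) < 1 by apply: phi01; lra.
have bE j : b j.+1 = K * (c * (phi (1 - q ^+ j.+1) / q ^+ j) ^+ n).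
  rewrite /b /K expr_div_n.
  have -> : q ^+ j.+2 = q * q * q ^+ j by rewrite !exprS mulrA.
  have -> : q ^+ j.+1 = q * q ^+ j by rewrite exprS.
  rewrite !exprMn !exprS exprD; field.
  by rewrite !expf_neq0 ?gt_eqF.
have bsum m : \sum_(0 <= k < m) b k <= b 0%N + b 1%N + K * C.
  apply: (@le_trans _ _ (\sum_(0 <= k < m.+2) b k)).
    by rewrite [leRHS]big_nat_recr//= big_nat_recr//= -addrA lerDl addr_ge0.
  rewrite big_nat_recl// big_nat_recl// -addrA lerD2l lerD2l.
  have -> : \sum_(0 <= i < m) b i.+2 =
      K * \sum_(1 <= j < 1 + m) c * (phi (1 - q ^+ j.+1) / q ^+ j) ^+ n.
    rewrite mulr_sumr add1n big_add1 /=; apply: eq_bigr => i _; exact: bE.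
  by apply: ler_wpM2l => //; rewrite /K mulr_ge0 ?invr_ge0 ?exprn_ge0 ?ltW.
rewrite (integral_shells n Hphi q01).
apply: (@le_lt_trans _ _ (b 0%N + b 1%N + K * C)%:E); last exact: ltry.
apply: lime_le.
  by apply: is_cvg_nneseries => k _ _; exact: integral_shell_ge0.
apply: nearW => m; apply: (@le_trans _ _ (\sum_(0 <= k < m) (b k)%:E)%E).
  by apply: lee_sum => k _; exact: integral_shell_upper.
by rewrite sumEFin lee_fin.
Qed.

Lemma sum_bounded_of_integral phi n q : decreasing_profile phi -> 0 < q < 1 ->
  (\int[mu]_(t in `[0%R, 1%R[) (profile_density phi n t)%:E < +oo)%E ->
  exists C, forall m, \sum_(0 <= j < m) (phi (1 - q ^+ j.+1) / q ^+ j) ^+ n <= C.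
Proof.
move=> Hphi q01; have /andP[q0 q1] := q01; rewrite (integral_shells n Hphi q01).
set S := (\sum_(0 <= k <oo) _)%E => Sy.
have HS m : ((\sum_(0 <= j < m) (1 - q) * (phi (1 - q ^+ j.+1) / q ^+ j) ^+ n)%:E <= S)%E.
  rewrite -sumEFin; apply: (@le_trans _ _ (\sum_(0 <= k < m)
    \int[mu]_(t in shell q k) (profile_density phi n t)%:E)%E).
    by apply: lee_sum => k _; exact: integral_shell_lower.
  by apply: nneseries_lim_ge => k _ _; exact: integral_shell_ge0.
have [B SB] : exists B, S = B%:E.
  have := HS 0%N; rewrite big_geq//; move: Sy.
  by case: S HS => // B _ _ _; exists B.
exists ((1 - q)^-1 * B) => m; have := HS m; rewrite SB lee_fin -mulr_sumr.
by rewrite mulrC -ler_pdivlMr ?subr_gt0// mulrC.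
Qed.

End DyadicIntegral.

(** * Counting centres and summing weights *)

Section Counting.
Context {R : realType} {d : nat}.
Implicit Types (x y z l : 'rV[R]_d) (r s t : R).

Lemma size_le_card (T : eqType) (U : finType) (key : T -> U) (s : seq T) :
  uniq s -> {in s &, injective key} -> (size s <= #|U|)%N.
Proof.
move=> us kinj; rewrite -(size_map key).
have /card_uniqP <- : uniq (map key s) by rewrite map_inj_in_uniq.
exact: max_card.
Qed.

Lemma truncn_eq_dist (a b : R) : 0 <= a -> 0 <= b -> Num.truncn a = Num.truncn b ->
  `|a - b| <= 1.
Proof.
move=> /Num.Theory.truncn_itv/andP[a1 a2] /Num.Theory.truncn_itv/andP[b1 b2] E.
rewrite E in a1 a2; rewrite -natr1 in a2 b2; rewrite ler_norml; lra.
Qed.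

Lemma truncn_ltS (a : R) (n : nat) : 0 <= a -> a <= n%:R -> (Num.truncn a < n.+1)%N.
Proof.
move=> a0 an; rewrite ltnS -(ler_nat R); apply: le_trans an.
by have /andP[] := Num.Theory.truncn_itv a0.
Qed.

Lemma exists_large_coord x : (0 < d)%N -> exists i, enorm x ^+ 2 <= d%:R * x 0 i ^+ 2.
Proof.
move=> d0; apply: contrapT => nex.
have lt i : d%:R * x 0 i ^+ 2 < enorm x ^+ 2.
  by rewrite ltNge; apply/negP => ?; apply: nex; exists i.
have : \sum_(i < d) d%:R * x 0 i ^+ 2 < \sum_(i < d) enorm x ^+ 2.
  apply: ltr_sum => [|i _]; last exact: lt.
  by apply/hasP; exists (Ordinal d0); rewrite ?mem_index_enum.
rewrite sumr_const card_ord -mulr_sumr -[ltRHS]mulr_natl sqr_enorm.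
by rewrite (eq_bigr (fun i => x 0 i * x 0 i)) ?ltxx// => i _; rewrite expr2.
Qed.

(* Two points of a thin spherical shell that agree up to [h] in all coordinates
   but a large one, and in squared norm, are close: this is why a shell of
   thickness [h] needs only [h^(1-d)] cells. *)
Lemma close_of_partial_coords x y (h : R) (i : 'I_d) :
  0 <= h -> enorm x <= 1 -> enorm y <= 1 -> 1 / 4 <= enorm x ^+ 2 -> 1 / 4 <= enorm y ^+ 2 ->
  enorm x ^+ 2 <= d%:R * x 0 i ^+ 2 -> enorm y ^+ 2 <= d%:R * y 0 i ^+ 2 ->
  (0 <= x 0 i) = (0 <= y 0 i) ->
  `|enorm x ^+ 2 - enorm y ^+ 2| <= h -> (forall j, j != i -> `|x 0 j - y 0 j| <= h) ->
  enorm (x - y) <= 2 * d%:R ^+ 3 * h.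
Proof.
move=> h0 x1 y1 xx yy xi yi sg nn cc.
have d0 : (0 < d)%N by case: d i {x y x1 y1 xx yy xi yi sg nn cc} => [[]|].
have d1 : 1 <= d%:R :> R by rewrite (ler_nat R 1).

(* The large coordinate has square at least 1 / (4 d) >= 1 / (2 d)^2. *)
have lowr (v : 'rV[R]_d) : 1 / 4 <= enorm v ^+ 2 -> enorm v ^+ 2 <= d%:R * v 0 i ^+ 2 ->
    1 <= 2 * d%:R * `|v 0 i|.
  move=> v4 vi; rewrite -(@ler_pXn2r _ 2%N) ?nnegrE ?mulr_ge0//.
  rewrite !exprMn real_normK ?num_real// expr1n.
  have : 1 / 4 <= d%:R * v 0 i ^+ 2 by exact: le_trans vi.
  have := sqr_ge0 (v 0 i); set w := v 0 i ^+ 2 => w0 Hw.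
  have : d%:R * w * 1 <= d%:R * w * d%:R by apply: ler_wpM2l => //; rewrite mulr_ge0.
  by rewrite expr2; lra.
have hx := lowr x xx xi; have hy := lowr y yy yi.
have sq : `|x 0 i ^+ 2 - y 0 i ^+ 2| <= 2 * d%:R * h.
  have -> : x 0 i ^+ 2 - y 0 i ^+ 2 = (enorm x ^+ 2 - enorm y ^+ 2) -
      \sum_(j < d | j != i) (x 0 j ^+ 2 - y 0 j ^+ 2).
    have EX (v : 'rV[R]_d) : enorm v ^+ 2 = v 0 i ^+ 2 + \sum_(j < d | j != i) v 0 j ^+ 2.
      by rewrite sqr_enorm /dot (bigD1 i).
    by rewrite !EX sumrB; ring.
  apply: le_trans (ler_normB _ _) _.
  have : `|\sum_(j < d | j != i) (x 0 j ^+ 2 - y 0 j ^+ 2)| <= (d%:R - 1) * (2 * h).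
    apply: le_trans (ler_norm_sum _ _ _) _.
    have -> : (d%:R - 1) * (2 * h) = \sum_(j < d | j != i) 2 * h.
      rewrite sumr_const; have -> : #|[pred j | j != i]| = d.-1.
        by rewrite cardC1 card_ord.
      by rewrite -[in LHS](prednK d0) -natr1 addrK mulr_natl.
    apply: ler_sum => j ji.
    have -> : x 0 j ^+ 2 - y 0 j ^+ 2 = (x 0 j - y 0 j) * (x 0 j + y 0 j) by ring.
    rewrite normrM mulrC; apply: ler_pM => //; last exact: cc.
    apply: le_trans (ler_normD _ _) _.
    have := coord_le_enorm x j; have := coord_le_enorm y j; lra.
  have : 2 * h + (d%:R - 1) * (2 * h) = 2 * d%:R * h by ring.
  lra.
(* Equal signs factor the difference of squares as |x_i - y_i| (|x_i| + |y_i|), and the second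
   factor is at least 1 / d. *)
have xyi : `|x 0 i - y 0 i| <= 2 * d%:R ^+ 2 * h.
  have E : `|x 0 i ^+ 2 - y 0 i ^+ 2| = `|x 0 i - y 0 i| * (`|x 0 i| + `|y 0 i|).
    have -> : x 0 i ^+ 2 - y 0 i ^+ 2 = (x 0 i - y 0 i) * (x 0 i + y 0 i) by ring.
    rewrite normrM; congr (_ * _); move: sg; have [a1|a1] := leP 0 (x 0 i).
      by move=> /esym b1; rewrite !ger0_norm ?addr_ge0.
    move=> /esym/negbT; rewrite -ltNge => b1.
    have ab : x 0 i + y 0 i < 0 by lra.
    by rewrite (ltr0_norm ab) (ltr0_norm a1) (ltr0_norm b1) opprD.
  rewrite E in sq.
  have : `|x 0 i - y 0 i| * 1 <= `|x 0 i - y 0 i| * (d%:R * (`|x 0 i| + `|y 0 i|)).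
    by apply: ler_wpM2l => //; lra.
  have : d%:R * (`|x 0 i - y 0 i| * (`|x 0 i| + `|y 0 i|)) <= d%:R * (2 * d%:R * h).
    by apply: ler_wpM2l.
  rewrite expr2; lra.
have h2 : 1 * h <= 2 * d%:R ^+ 2 * h.
  apply: ler_wpM2r => //; have : 1 * 1 <= d%:R * d%:R :> R by apply: ler_pM.
  by rewrite expr2; lra.
have H3 : enorm (x - y) <= Num.sqrt d%:R * (2 * d%:R ^+ 2 * h).
  apply: enorm_coord_le => [|j]; first by lra.
  rewrite !mxE; have [->//|ji] := eqVneq j i.
  by apply: le_trans (cc j ji) _; lra.
apply: le_trans H3 _; have -> : 2 * d%:R ^+ 3 * h = d%:R * (2 * d%:R ^+ 2 * h) by ring.
apply: ler_wpM2r; first by lra.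
rewrite -[leRHS]ger0_norm// -sqrtr_sqr ler_sqrt ?sqr_ge0//.
by rewrite expr2 ler_peMr.
Qed.

(* The index and sign of a large coordinate, then truncations of [1 - |x|^2] and of
   the other coordinates: points of one shell with equal keys are close. *)
Definition shell_key (M k : nat) (hd : (0 < d)%N) (x : 'rV[R]_d) :=
  let i := xchoose (exists_large_coord x hd) in
  let m := (M * 2 ^ k)%N in
  (i, (0 <= x 0 i), inord (Num.truncn ((1 - enorm x ^+ 2) * m%:R)) : 'I_(2 * M).+1,
   [ffun j : 'I_d.-1 => inord (Num.truncn ((x 0 (lift i j) + 1) * m%:R)) : 'I_(2 * m).+1]).

(** Keys are injective on separated centres of one shell. The truncated norm takes only 2 M + 1
    values there, so the growth in [k] comes from the d - 1 remaining coordinates alone. For k > 0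
    all norms are at least 1 / 2, which bounds the large coordinate from below. *)
Lemma shell_count (hd : (0 < d)%N) (Lam : set 'rV[R]_d) : Lam `<=` open_eball 0 1 ->
  separated_centers Lam ->
  exists K : nat, forall (k : nat) (s : seq 'rV[R]_d), (0 < k)%N -> uniq s ->
    (forall l, l \in s -> Lam l /\ shell (2^-1) k (enorm l)) ->
    (size s <= K * (2 ^ k) ^ d.-1)%N.
Proof.
move=> Lam1 [e e0 sep].
(* With 4 d^3 <= e M, points with equal keys are within 2 d^3 / (M 2^k) <= e 2^-(k+1), below the
   separation in shell [k]. *)
pose M := (Num.truncn (4 * d%:R ^+ 3 / e)).+1.
have Me : 4 * d%:R ^+ 3 <= e * M%:R.
  rewrite -ler_pdivrMl// mulrC /M -natr1.
  have /Num.Theory.truncn_itv/andP[_] : 0 <= 4 * d%:R ^+ 3 / e by rewrite divr_ge0 ?mulr_ge0// ltW.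
  by rewrite -natr1 => /ltW.
have M0 : (0 < M)%N by [].
exists (d * 2 * (2 * M).+1 * (3 * M) ^ d.-1)%N => k s k0 us Hs.
set m := (M * 2 ^ k)%N.
have m0 : (0 < m)%N by rewrite muln_gt0 M0 expn_gt0.
have mR0 : 0 < m%:R :> R by rewrite ltr0n.
have mE : m%:R = M%:R * 2 ^+ k :> R by rewrite natrM natrX.
have p0 : 0 < (2^-1 : R) ^+ k by rewrite exprn_gt0.
have pk : (2^-1 : R) ^+ k * 2 ^+ k = 1 by rewrite -exprMn mulVf// expr1n.
have fact x : x \in s -> [/\ Lam x, enorm x <= 1, 1 / 2 <= enorm x &
    0 <= 1 - enorm x ^+ 2 <= 2 * 2^-1 ^+ k].
  move=> /Hs[Lx /shellP[s1 s2]].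
  have x1 : enorm x < 1 by have /open_eball0 := Lam1 _ Lx.
  have x0 := enorm_ge0 x.
  split => //; first exact: ltW.
    have : (2^-1 : R) ^+ k <= 2^-1 ^+ 1 by apply: ler_wiXn2l => //; lra.
    by rewrite expr1; lra.
  have -> : 1 - enorm x ^+ 2 = (1 - enorm x) * (1 + enorm x) by ring.
  rewrite mulr_ge0 ?subr_ge0 ?addr_ge0 ?(ltW x1)//= mulrC.
  by apply: ler_pM; lra.
have := @size_le_card _ _ (shell_key M k hd) s us.
have -> : #|{: 'I_d * bool * 'I_(2 * M).+1 * {ffun 'I_d.-1 -> 'I_(2 * m).+1}}| =
    (d * 2 * (2 * M).+1 * (2 * m).+1 ^ d.-1)%N.
  by rewrite !card_prod card_bool card_ffun !card_ord.
move=> Hsz; apply: (leq_trans (Hsz _)); last first.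
  rewrite -[leqRHS]mulnA leq_mul2l -expnMn -mulnA -/m; apply/orP; right.
  by case: d.-1 => // p; rewrite leq_exp2r//; lia.
move=> x y xs ys; have [Lx x1 x2 x3] := fact x xs; have [Ly y1 y2 y3] := fact y ys.
rewrite /shell_key; set ix := xchoose _; set iy := xchoose _ => -[Ei Es Er Ef].
have Hx : enorm x ^+ 2 <= d%:R * x 0 ix ^+ 2 := xchooseP (exists_large_coord x hd).
have Hy : enorm y ^+ 2 <= d%:R * y 0 iy ^+ 2 := xchooseP (exists_large_coord y hd).
clearbody ix iy; subst iy.
apply: contrapT => nxy.
have sq4 (v : 'rV[R]_d) : 1 / 2 <= enorm v -> 1 / 4 <= enorm v ^+ 2.
  by move=> v2; rewrite expr2; have : 1 / 2 * (1 / 2) <= enorm v * enorm v;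
    [apply: ler_pM|]; lra.
have rad_lt (v : 'rV[R]_d) : 0 <= 1 - enorm v ^+ 2 <= 2 * 2^-1 ^+ k ->
    (Num.truncn ((1 - enorm v ^+ 2) * m%:R) < (2 * M).+1)%N.
  move=> /andP[a b]; apply: truncn_ltS; first by rewrite mulr_ge0.
  apply: (@le_trans _ _ (2 * 2^-1 ^+ k * m%:R)); first by rewrite ler_wpM2r.
  have -> : 2 * 2^-1 ^+ k * m%:R = 2 * M%:R * (2^-1 ^+ k * 2 ^+ k) :> R by rewrite mE; ring.
  by rewrite pk mulr1 natrM.
have coord_lt (v : 'rV[R]_d) (j : 'I_d) : enorm v <= 1 -> 0 <= v 0 j + 1 /\
    (Num.truncn ((v 0%R j + 1) * m%:R)%R < (2 * m).+1)%N.
  move=> v1; have := coord_le_enorm v j; rewrite ler_norml => /andP[a b].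
  split; first by lra.
  apply: truncn_ltS; first by rewrite mulr_ge0//; lra.
  by rewrite natrM; apply: ler_wpM2r => //; lra.
have div_m (a b : R) : `|a * m%:R - b * m%:R| <= 1 -> `|a - b| <= m%:R^-1.
  by rewrite -mulrBl normrM (ger0_norm (ltW mR0)) -ler_pdivlMr// mul1r.
have nn : `|enorm x ^+ 2 - enorm y ^+ 2| <= m%:R^-1.
  have -> : enorm x ^+ 2 - enorm y ^+ 2 = - ((1 - enorm x ^+ 2) - (1 - enorm y ^+ 2)) by ring.
  rewrite normrN; apply: div_m; apply: truncn_eq_dist.
  - by have /andP[a _] := x3; rewrite mulr_ge0.
  - by have /andP[a _] := y3; rewrite mulr_ge0.
  - by move: Er => /(congr1 val); rewrite /= !inordK ?rad_lt.
have cc j : j != ix -> `|x 0 j - y 0 j| <= m%:R^-1.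
  rewrite eq_sym => ji; have [j' ->] := unlift_some ji; move=> _.
  have [a1 a2] := coord_lt x (lift ix j') x1; have [b1 b2] := coord_lt y (lift ix j') y1.
  have -> : x 0 (lift ix j') - y 0 (lift ix j') =
      (x 0 (lift ix j') + 1) - (y 0 (lift ix j') + 1) by ring.
  apply: div_m; apply: truncn_eq_dist; rewrite ?mulr_ge0//.
  move: Ef => /ffunP/(_ j'); rewrite !ffunE => /(congr1 val).
  by rewrite /= !inordK.
have mV0 : 0 <= (m%:R : R)^-1 by rewrite invr_ge0 ltW.
have close := close_of_partial_coords mV0 x1 y1 (sq4 x x2) (sq4 y y2) Hx Hy Es nn cc.
have far : e * 2^-1 ^+ k.+1 < enorm (x - y).
  have [_ /shellP[sx _]] := Hs x xs; have [_ /shellP[sy _]] := Hs y ys.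
  have [yx|/ltW xy] := leP (enorm y) (enorm x).
    by apply: le_lt_trans (sep x y Lx Ly nxy yx); apply: ler_wpM2l; [exact: ltW|exact: ltW].
  rewrite enormBC; apply: le_lt_trans (sep y x Ly Lx _ xy); last by move=> E; exact: nxy.
  by apply: ler_wpM2l; exact: ltW.
have : 2 * d%:R ^+ 3 * m%:R^-1 <= e * 2^-1 ^+ k.+1.
  rewrite ler_pdivrMr// (exprS _ k) mE.
  have -> : e * (2^-1 * 2^-1 ^+ k) * (M%:R * 2 ^+ k) = e * M%:R / 2 * (2^-1 ^+ k * 2 ^+ k) by ring.
  by rewrite pk mulr1; lra.
by move: close far; lra.
Qed.

Lemma sum_le_uniq_sub (T : eqType) (s t : seq T) (f : T -> R) : uniq s -> uniq t ->
  {subset s <= t} -> (forall l : T, l \in t -> 0 <= f l) ->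
  \sum_(l <- s) f l <= \sum_(l <- t) f l.
Proof.
move=> us ut st f0; rewrite [leRHS](bigID (mem s))/=.
have -> : \sum_(l <- t | l \in s) f l = \sum_(l <- s) f l.
  rewrite -big_filter; apply: perm_big; apply: uniq_perm => //; first exact: filter_uniq.
  by move=> l; rewrite mem_filter; case: (boolP (l \in s)) => // /st ->.
rewrite lerDl big_seq_cond; apply: sumr_ge0 => l /andP[lt _]; exact: f0.
Qed.

Lemma sum_bool_size (T : Type) (s : seq T) (P : pred T) :
  \sum_(l <- s) (P l)%:R = (size [seq l <- s | P l])%:R :> R.
Proof.
elim: s => [|x s IH]; first by rewrite big_nil.
rewrite big_cons IH /=; case: (P x); last by rewrite add0r.
by rewrite /= -[in RHS]add1n natrD.
Qed.

Lemma bounded_sum_terms_small (a : nat -> R) C : (forall j, 0 <= a j) ->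
  (forall m, \sum_(0 <= j < m) a j <= C) ->
  forall e, 0 < e -> exists j0, forall j, (j0 <= j)%N -> a j <= e.
Proof.
move=> a0 aC e e0; have : cvgn (series a).
  apply: nondecreasing_is_cvgn.
    apply/nondecreasing_seqP => m; rewrite /series /= big_nat_recr//= lerDl.
    exact: a0.
  by exists C => _ [m _ <-]; exact: aC.
move=> /cvg_series_cvg_0 /cvgr0_norm_lt /(_ e e0) [j0 _ Hj]; exists j0 => j /Hj /=.
by rewrite ger0_norm// => /ltW.
Qed.

Lemma sum_half_pow (j0 m : nat) : \sum_(j0 <= j < m) (2^-1 : R) ^+ j.+1 <= 1.
Proof.
have H k : \sum_(0 <= j < k) (2^-1 : R) ^+ j.+1 = 1 - 2^-1 ^+ k.
  elim: k => [|k IH]; first by rewrite big_geq// expr0 subrr.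
  by rewrite big_nat_recr//= IH exprS; lra.
have ge0 k m' : 0 <= \sum_(k <= j < m') (2^-1 : R) ^+ j.+1.
  by apply: sumr_ge0 => i _; rewrite exprn_ge0.
apply: (@le_trans _ _ (\sum_(0 <= j < m) (2^-1 : R) ^+ j.+1)).
  have [jm|jm] := leqP j0 m; last by rewrite big_geq 1?ltnW.
  by rewrite [leRHS](big_cat_nat _ jm)//= lerDr.
by rewrite H lerBlDr lerDl exprn_ge0.
Qed.

(** * Weights of the centres and their summability *)

Section Weights.
Context {Lam : set 'rV[R]_d} {rad : 'rV[R]_d -> R} {phi : R -> R}.
Hypothesis H : spaced_obstacles Lam rad phi.

Let n := (d - 2)%N.

(** A lower bound for [gap 1 l] on the whole obstacle at [l], where |x| <= |l| + rad l. *)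
Definition slack l := (1 - enorm l - rad l) * (1 - enorm l).

(* The first summand makes [weight l * green 1 l] at least [1] on the obstacle
   at [l]; the second keeps the pole when the radius vanishes. *)
Definition weight l :=
  rad l ^+ n * (2 * (rad l ^+ 2 + slack l) / slack l) + (1 - enorm l) ^+ (2 * n).

Lemma slack_gt0 l : Lam l -> 0 < slack l.
Proof.
move=> Ll; have := so_rad_lt H Ll; have := so_norm1 H Ll => l1 lr.
by rewrite /slack mulr_gt0//; lra.
Qed.

Lemma subn2_gt0 : (0 < n)%N.
Proof. by rewrite /n subn_gt0 (so_dim H). Qed.

Lemma weight_gt0 l : Lam l -> 0 < weight l.
Proof.
move=> Ll; have E0 := slack_gt0 Ll; have l1 := so_norm1 H Ll; have r0 := so_rad_ge0 H Ll.
rewrite /weight ltr_wpDl ?exprn_gt0 ?subr_gt0//.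
apply: mulr_ge0; first exact: exprn_ge0.
by apply: divr_ge0; [rewrite mulr_ge0// addr_ge0 ?sqr_ge0// ltW|exact: ltW].
Qed.

(** The first summand of [weight] is the reciprocal of the bound in [green_lower] for r = rad l and
    E0 = slack l. The existence of such an x <> l makes the radius positive. *)
Lemma weight_green l x : Lam l -> x <> l -> enorm (x - l) <= rad l ->
  enorm x < 1 /\ 1 <= weight l * green 1 l x.
Proof.
move=> Ll xl xr; have E0 := slack_gt0 Ll; have l1 := so_norm1 H Ll.
have lr := so_rad_lt H Ll.
have xlr : enorm x <= enorm l + rad l by have := enormB_ge x l; lra.
have x1 : enorm x < 1 by exact: le_lt_trans lr.
split => //; have r0 : 0 < rad l by exact: lt_le_trans (sub_neq0_enorm xl) xr.
have Eg : slack l <= gap 1 l x.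
  apply: le_trans (gap1_lower (ltW l1) (ltW x1)).
  by rewrite /slack ler_wpM2r ?subr_ge0 ?(ltW l1)//; lra.
have := green_lower (so_dim H) ltr01 (ltW l1) (ltW x1) xl xr E0 Eg; rewrite -/n => Hg.
have g0 := green_ge0 (so_dim H) ltr01 (ltW l1) (ltW x1) xl.
apply: (@le_trans _ _ (rad l ^+ n * (2 * (rad l ^+ 2 + slack l) / slack l) * green 1 l x));
  last first.
  by apply: ler_wpM2r => //; rewrite lerDl exprn_ge0// subr_ge0 ltW.
have rE : 0 < rad l ^+ 2 + slack l by rewrite ltr_wpDl ?sqr_ge0.
have c0 : 0 <= rad l ^+ n * (2 * (rad l ^+ 2 + slack l) / slack l).
  apply: mulr_ge0; first by rewrite exprn_ge0// ltW.
  by apply: divr_ge0; [rewrite mulr_ge0// ltW|exact: ltW].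
apply: le_trans (ler_wpM2l c0 Hg).
rewrite le_eqVlt; apply/orP; left; apply/eqP; rewrite exprVn; field.
by rewrite !gt_eqF// exprn_gt0.
Qed.

(** Only positivity of the weight enters, so a vanishing radius is covered: the Green function is
    unbounded at its pole. *)
Lemma weight_pole l : Lam l ->
  \forall x \near l, x <> l -> enorm x < 1 /\ 1 <= weight l * green 1 l x.
Proof.
move=> Ll; have w0 := weight_gt0 Ll; have l1 := so_norm1 H Ll.
have a0 : 0 < (1 - enorm l) / 2 by lra.
have b0 : 0 < weight l / 4 by rewrite divr_gt0.
(* The first bound on [t] makes t^2 <= E below, so that the factor E / (2 (t^2 + E)) is at least 1 /
   4; the second gives t^n <= t < weight l / 4. *)
have [t t0 [ta tb]] := exists_lt_both a0 b0.
apply/nbhs_enorm; exists t => // x /ltW xt xl.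
have xlr : enorm x <= enorm l + t by have := enormB_ge x l; lra.
have x1 : enorm x < 1 by lra.
split => //.
have E0 : 0 < (1 - enorm l) ^+ 2 / 2 by rewrite divr_gt0// exprn_gt0// subr_gt0.
have Eg : (1 - enorm l) ^+ 2 / 2 <= gap 1 l x.
  apply: le_trans (gap1_lower (ltW l1) (ltW x1)).
  have -> : (1 - enorm l) ^+ 2 / 2 = (1 - enorm l) / 2 * (1 - enorm l) by rewrite expr2; lra.
  by rewrite ler_wpM2r ?subr_ge0 ?(ltW l1)//; lra.
have := green_lower (so_dim H) ltr01 (ltW l1) (ltW x1) xl xt E0 Eg; rewrite -/n.
set E := (1 - enorm l) ^+ 2 / 2 in E0 *.
have tE : t ^+ 2 <= E.
  have : t ^+ 2 <= ((1 - enorm l) / 2) ^+ 2 by rewrite lerXn2r ?nnegrE ?ltW.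
  rewrite /E exprMn; have : 0 <= (1 - enorm l) ^+ 2 by rewrite sqr_ge0.
  by rewrite exprVn; lra.
have F4 : 1 / 4 <= E / (2 * (t ^+ 2 + E)).
  by rewrite ler_pdivlMr ?mulr_gt0 ?addr_gt0 ?exprn_gt0//; lra.
have tn : t ^+ n <= weight l / 4.
  apply: le_trans (ltW tb); case: n subn2_gt0 => // k _.
  have := enorm_ge0 l => l0; rewrite exprS; apply: ler_piMr; first exact: ltW.
  by apply: exprn_ile1; lra.
have tn0 : 0 < t ^+ n by rewrite exprn_gt0.
move=> Hg; apply: (@le_trans _ _ (weight l * (t^-1 ^+ n * (1 / 4)))).
  have -> : weight l * (t^-1 ^+ n * (1 / 4)) = weight l / 4 / t ^+ n by rewrite exprVn; ring.
  by rewrite ler_pdivlMr// mul1r.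
rewrite ler_pM2l//; apply: le_trans Hg; apply: ler_wpM2l => //.
by rewrite exprn_ge0// invr_ge0 ltW.
Qed.

(** For such radii 2 (rad l)^2 <= slack l, so the quotient in [weight] is at most 3. *)
Lemma weight_upper l : Lam l -> rad l <= (1 - enorm l) / 2 ->
  weight l <= 3 * rad l ^+ n + (1 - enorm l) ^+ (2 * n).
Proof.
move=> Ll rl; have E0 := slack_gt0 Ll; have r0 := so_rad_ge0 H Ll.
have l1 := so_norm1 H Ll.
rewrite /weight lerD2r mulrC ler_wpM2r ?exprn_ge0// ler_pdivrMr//.
have : 2 * rad l ^+ 2 <= slack l; last by lra.
have : rad l * (2 * rad l) <= (1 - enorm l - rad l) * (1 - enorm l) by apply: ler_pM; lra.
by rewrite /slack expr2; lra.
Qed.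

(** A bounded sum has terms tending to 0, so all but finitely many obstacles are small compared with
    their distance to the unit sphere, and [weight_upper] applies to them. The remaining centres
    contribute a constant; late shells are handled by counting. *)
Lemma weight_sum_bounded C :
  (forall m, \sum_(0 <= j < m) (phi (1 - 2^-1 ^+ j.+1) / 2^-1 ^+ j) ^+ n <= C) ->
  exists B, forall F : {fset 'rV[R]_d}, (forall l, l \in F -> Lam l) ->
    \sum_(l <- F) weight l * (1 - enorm l) <= B.
Proof.
have [q qE] : exists q : R, q = 2^-1 by exists 2^-1.
rewrite -qE => HC.
have q0 : 0 < q by rewrite qE invr_gt0.
have q1 : q < 1 by rewrite qE; lra.
have q01 : 0 < q < 1 by rewrite q0.
have qk0 k : 0 < q ^+ k by exact: exprn_gt0.
have qk1 k : q ^+ k <= 1 by apply: exprn_ile1; exact: ltW.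
have p0 k : 0 <= phi (1 - q ^+ k).
  by apply: (so_phi_ge0 H); have := qk0 k; have := qk1 k; lra.
pose a j := (phi (1 - q ^+ j.+1) / q ^+ j) ^+ n.
have a0 j : 0 <= a j by rewrite /a exprn_ge0// divr_ge0// ltW.
(* A term at most 8^-n means phi (1 - q^(j+1)) <= q^j / 8 = q^(j+2) / 2, which is below (1 - |l|) /
   2 for centres in shell j + 1. *)
have e0 : 0 < (8^-1 : R) ^+ n by rewrite exprn_gt0.
have [j0 Hj0] := bounded_sum_terms_small a0 HC e0.
have small j : (j0 <= j)%N -> phi (1 - q ^+ j.+1) <= q ^+ j / 8.
  move=> /Hj0; rewrite /a ler_pXn2r ?subn2_gt0// ?nnegrE; last 2 first.
  - by rewrite divr_ge0// ltW.
  - by [].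
  by rewrite ler_pdivrMr// mulrC.
have d0 : (0 < d)%N by exact: leq_trans (so_dim H).
have [K] := shell_count d0 (so_ball H) (so_sep H); rewrite -qE => HK.
pose f l := weight l * (1 - enorm l).
have f0 l : Lam l -> 0 <= f l.
  by move=> Ll; rewrite /f mulr_ge0 ?(ltW (weight_gt0 Ll))// subr_ge0 ltW// (so_norm1 H Ll).
pose G k := q ^+ k * (3 * phi (1 - q ^+ k) ^+ n + (q ^+ k) ^+ (2 * n)).
have fG l k : Lam l -> (j0 < k)%N -> shell q k (enorm l) -> f l <= G k.
  case: k => // j Ll jj /shellP[s1 s2]; have l1 := so_norm1 H Ll.
  have r0 := so_rad_ge0 H Ll.
  have rp : rad l <= phi (1 - q ^+ j.+1).
    rewrite (so_rad H Ll); have [_ dec] := so_dec H; apply: dec => //.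
      by rewrite subr_ge0 qk1.
    by rewrite lerBlDr addrC -lerBlDr.
  have := small j jj => sj.
  have qq : q ^+ j = 4 * q ^+ j.+2.
    have q4 : 4 * (q * q) = 1 by rewrite qE; lra.
    by rewrite 2!exprS !mulrA -(mulrA 4) q4 mul1r.
  have rl : rad l <= (1 - enorm l) / 2 by lra.
  rewrite /f /G mulrC; apply: ler_pM; rewrite ?subr_ge0 ?(ltW l1) ?(ltW (weight_gt0 Ll))//.
  apply: le_trans (weight_upper Ll rl) _; apply: lerD.
    by rewrite ler_pM2l// lerXn2r ?nnegrE.
  by rewrite lerXn2r ?nnegrE// ?subr_ge0 ltW.
have G0 k : 0 <= G k.
  by rewrite /G mulr_ge0 ?addr_ge0 ?mulr_ge0 ?exprn_ge0 ?(ltW q0)// ltW.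
(* As d - 1 = n + 1, the number of centres cancels n + 1 powers of q^(j+1). The exponent 2 n in
   [weight] leaves q^((j+1) n) <= q^(j+1), a summable rest. *)
have KG j : (K * (2 ^ j.+1) ^ d.-1)%N%:R * G j.+1 <= K%:R * (3 * 2 ^+ n * a j + q ^+ j.+1).
  have -> : d.-1 = n.+1 by rewrite /n; have := so_dim H; lia.
  rewrite natrM -mulrA ler_wpM2l// natrX natrX /G.
  have E1 : (2 ^+ j.+1) ^+ n.+1 * (q ^+ j.+1) ^+ n.+1 = 1 :> R.
    by rewrite -!exprMn qE mulfV// !expr1n.
  have -> : (2 ^+ j.+1) ^+ n.+1 * (q ^+ j.+1 * (3 * phi (1 - q ^+ j.+1) ^+ n
      + (q ^+ j.+1) ^+ (2 * n))) =
     3 * (phi (1 - q ^+ j.+1) ^+ n * ((2 ^+ j.+1) ^+ n.+1 * q ^+ j.+1)) +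
     ((2 ^+ j.+1) ^+ n.+1 * (q ^+ j.+1) ^+ n.+1) * (q ^+ j.+1) ^+ n.
    by rewrite mul2n -addnn exprD (exprS (q ^+ j.+1) n); ring.
  rewrite E1 mul1r; apply: lerD; last first.
    rewrite -[leRHS]expr1; apply: ler_wiXn2l; first exact: ltW.
      exact: qk1.
    exact: subn2_gt0.
  rewrite -[leRHS]mulrA ler_pM2l// /a expr_div_n.
  have -> : (2 ^+ j.+1) ^+ n.+1 * q ^+ j.+1 = 2 ^+ n * (q ^+ j)^-1 ^+ n.
    have -> : (q ^+ j)^-1 = 2 ^+ j by rewrite -exprVn qE invrK.
    have pq : 2 ^+ j.+1 * q ^+ j.+1 = 1 :> R by rewrite -exprMn qE mulfV// expr1n.
    by rewrite exprSr -mulrA pq mulr1 -exprMn -exprS.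
  by rewrite exprVn mulrCA.
(* The index of the shell containing |l|; the default 0 never occurs for centres outside every
   shell, since |l| < 1. *)
pose kap l := xget 0%N [set k | shell q k (enorm l)].
have kapP l : Lam l -> shell q (kap l) (enorm l).
  move=> Ll; apply: (@xgetPex _ 0%N [set k | shell q k (enorm l)]).
  by apply: shell_exists => //; rewrite enorm_ge0 (so_norm1 H Ll).
have s1 : 1 - q ^+ j0.+1 < 1 by rewrite ltrBlDr ltrDl.
have finA := so_finite H s1.
pose A := fset_set (Lam `&` [set l | enorm l <= 1 - q ^+ j0.+1]).
exists (\sum_(l <- A) f l + K%:R * (3 * 2 ^+ n * C + 1)) => F FL.
rewrite (bigID (fun l => (kap l <= j0)%N))/=; apply: lerD.
  rewrite -big_filter; apply: sum_le_uniq_sub; rewrite ?filter_uniq ?fset_uniq//.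
    move=> l; rewrite mem_filter => /andP[kl lF]; rewrite in_fset_set// mem_set//.
    have /shellP[s _] := kapP l (FL l lF); split; first exact: FL.
    have jk : q ^+ j0.+1 <= q ^+ (kap l).+1 by apply: ler_wiXn2l => //; exact: ltW.
    by rewrite /= lerBrDr addrC -lerBrDr; exact: le_trans jk (ltW s).
  by move=> l; rewrite in_fset_set// => /set_mem[Ll _]; exact: f0.
pose N := (\max_(l <- F) kap l).+1.
have kN l : l \in F -> (kap l < N)%N by move=> lF; rewrite ltnS; exact: leq_bigmax_seq.
apply: (@le_trans _ _ (\sum_(j0 <= j < N) (K * (2 ^ j.+1) ^ d.-1)%N%:R * G j.+1)); last first.
  apply: (@le_trans _ _ (\sum_(j0 <= j < N) K%:R * (3 * 2 ^+ n * a j + q ^+ j.+1))).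
    by apply: ler_sum => j _; exact: KG.
  rewrite -mulr_sumr ler_wpM2l// big_split/=; apply: lerD; last by rewrite qE; exact: sum_half_pow.
  rewrite -mulr_sumr ler_wpM2l ?mulr_ge0 ?exprn_ge0//.
  have HC' m : \sum_(0 <= j < m) a j <= C := HC m.
  apply: le_trans (HC' N); have [jm|jm] := leqP j0 N.
    by rewrite [leRHS](big_cat_nat _ jm)//= lerDr sumr_ge0.
  by rewrite big_geq 1?ltnW// sumr_ge0.
apply: (@le_trans _ _ (\sum_(j0 <= j < N) \sum_(l <- F) (kap l == j.+1)%:R * G j.+1)); last first.
  apply: ler_sum => j _; rewrite -mulr_suml ler_wpM2r//.
  rewrite sum_bool_size ler_nat; apply: HK => //; first by rewrite filter_uniq// fset_uniq.
  move=> l; rewrite mem_filter => /andP[/eqP <- lF]; split; first exact: FL.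
  exact: kapP (FL l lF).
rewrite exchange_big/= big_mkcond big_seq [leRHS]big_seq; apply: ler_sum => l lF.
case: ifPn => [|_]; last first.
  by rewrite sumr_ge0// => j _; rewrite mulr_ge0.
rewrite -ltnNge => jl; have := kN l lF; have := kapP l (FL l lF).
case: (kap l) jl => // j jl sj jN; rewrite (bigD1_seq j) ?iota_uniq ?mem_index_iota//=; last first.
  by rewrite -ltnS jl (ltnW jN).
apply: (@le_trans _ _ (G j.+1)); first exact: fG (FL l lF) jl sj.
by rewrite eqxx mul1r lerDl; apply: sumr_ge0 => i _; rewrite mulr_ge0.
Qed.

(** Take [F0] within [e] of the supremum of all finite sums: adding a set disjoint from it cannot
    exceed the supremum. *)
Lemma weight_tail_small B :
  (forall F : {fset 'rV[R]_d}, (forall l, l \in F -> Lam l) ->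
    \sum_(l <- F) weight l * (1 - enorm l) <= B) ->
  forall e, 0 < e -> exists2 F0 : {fset 'rV[R]_d}, (forall l, l \in F0 -> Lam l) &
    forall F : {fset 'rV[R]_d}, (forall l, l \in F -> Lam l /\ l \notin F0) ->
    \sum_(l <- F) weight l * (1 - enorm l) <= e.
Proof.
move=> HB e e0.
pose S := [set \sum_(l <- F) weight l * (1 - enorm l) | F in
  [set F : {fset 'rV[R]_d} | forall l, l \in F -> Lam l]].
have supS : has_sup S.
  split; first by exists (\sum_(l <- (fset0 : {fset 'rV[R]_d})) weight l * (1 - enorm l)), fset0.
  by exists B => _ [F FL <-]; exact: HB.
have [_ [F0 F0L <-] HF0] := sup_adherent e0 supS.
exists F0 => // F FL.
have FF0 : S (\sum_(l <- (F `|` F0)%fset) weight l * (1 - enorm l)).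
  by exists (F `|` F0)%fset => // l; rewrite in_fsetU => /orP[/FL[]|/F0L].
have := sup_upper_bound supS FF0.
have -> : \sum_(l <- (F `|` F0)%fset) weight l * (1 - enorm l) =
    \sum_(l <- F) weight l * (1 - enorm l) + \sum_(l <- F0) weight l * (1 - enorm l).
  rewrite -big_cat; apply: perm_big; apply: uniq_perm; first exact: fset_uniq.
    rewrite cat_uniq !fset_uniq andbT /=; apply/hasPn => l lF0.
    by apply/negP => /FL[_]; rewrite lF0.
  by move=> l; rewrite mem_cat in_fsetU.
lra.
Qed.

End Weights.

End Counting.

Arguments slack {R d} rad l.
Arguments weight {R d} rad l.

(** * The superpotential *)

Section Potential.
Context {R : realType} {d : nat}.
Implicit Types (x y z l : 'rV[R]_d) (r s t : R) (F : {fset 'rV[R]_d}).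

Lemma harmonic_subharmonic (hd : (0 < d)%N) (U : set 'rV[R]_d) (f : 'rV[R]_d -> R) : open U ->
  harmonic_on U f -> (forall x, U x -> {for x, continuous f}) -> subharmonic_on U (EFin \o f).
Proof.
move=> oU hf fc; apply: subharmonic_intro => // x Ux; first exact: ltry.
  exact: continuous_usc (fc x Ux).
exact: (harmonic_submean hd oU hf fc Ux).
Qed.

Lemma fset_upper_bound (L : set 'rV[R]_d) (s : seq {fset 'rV[R]_d}) :
  (forall F, F \in s -> forall l, l \in F -> L l) ->
  exists2 G : {fset 'rV[R]_d}, (forall l, l \in G -> L l) &
    forall F, F \in s -> forall l, l \in F -> l \in G.
Proof.
elim: s => [|F s IH] Hs; first by exists fset0.
have [|G GL HG] := IH; first by move=> F' F's; apply: Hs; rewrite inE F's orbT.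
exists (F `|` G)%fset => [l|F' +l lF'].
  by rewrite in_fsetU => /orP[|/GL//]; apply: Hs; exact: mem_head.
rewrite inE in_fsetU => /predU1P[E|F's]; first by rewrite -E lF'.
by rewrite (HG F' F's l lF') orbT.
Qed.

(* Dini's argument along the directed family of finite sets. *)
Lemma compact_directed (L K : set 'rV[R]_d) (P : {fset 'rV[R]_d} -> 'rV[R]_d -> Prop) :
  compact K ->
  (forall F G y, (forall l, l \in F -> l \in G) -> (forall l, l \in G -> L l) -> K y ->
    P F y -> P G y) ->
  (forall y, K y -> exists2 F : {fset 'rV[R]_d}, (forall l, l \in F -> L l) &
     \forall z \near y, K z -> P F z) ->
  exists2 F : {fset 'rV[R]_d}, (forall l, l \in F -> L l) & forall y, K y -> P F y.
Proof.
move=> cK mono Hloc; have cK' := cK; rewrite compact_cover in cK'.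
pose O F := interior [set z | K z -> P F z].
have [D' D'L cov] : finite_subset_cover [set F : {fset 'rV[R]_d} | forall l, l \in F -> L l] O K.
  apply: cK' => [F _|y Ky]; first exact: open_interior.
  by have [F FL nF] := Hloc y Ky; exists F.
have [|G GL HG] := @fset_upper_bound L D'.
  by move=> F FD'; exact: (set_mem (D'L F FD')).
exists G => // y Ky; have [F /= FD /interior_subset /(_ Ky) PF] := cov y Ky.
by apply: mono PF => //; exact: HG.
Qed.

Section Super.
Context {Lam : set 'rV[R]_d} {rad : 'rV[R]_d -> R} {phi : R -> R}.
Hypothesis H : spaced_obstacles Lam rad phi.

Let Om := open_eball (0 : 'rV[R]_d) 1 `\` obstacles Lam rad.
Let w := weight rad.
Let finLam := [set F : {fset 'rV[R]_d} | forall l, l \in F -> Lam l].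

Lemma finLam_norm F l : finLam F -> l \in F -> enorm l <= 1.
Proof. by move=> FL /FL /(so_norm1 H)/ltW. Qed.

Lemma Om_notin F x : finLam F -> Om x -> x \notin F.
Proof. by move=> FL Ox; apply/negP => /FL Lx; exact: (so_Om_neq H Ox Lx). Qed.

Lemma green_term_ge0 F x l : finLam F -> enorm x <= 1 -> x \notin F -> l \in F ->
  0 <= w l * green 1 l x.
Proof.
move=> FL x1 xF lF; rewrite mulr_ge0 ?(ltW (weight_gt0 H (FL l lF)))//.
apply: (green_ge0 (so_dim H) ltr01 (finLam_norm FL lF) x1).
by move=> E; rewrite E lF in xF.
Qed.

Lemma greens_mono F G x : finLam G -> (forall l, l \in F -> l \in G) -> enorm x <= 1 ->
  x \notin G -> greens w F x <= greens w G x.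
Proof.
move=> GL FG x1 xG; apply: sum_le_uniq_sub; rewrite ?fset_uniq//.
by move=> l lG; exact: green_term_ge0 lG.
Qed.

Lemma greens_term_le F x l : finLam F -> l \in F -> enorm x <= 1 -> x \notin F ->
  w l * green 1 l x <= greens w F x.
Proof.
move=> FL lF x1 xF.
have -> : w l * green 1 l x = greens w [fset l]%fset x.
  by rewrite /greens big_seq_fset1.
by apply: greens_mono => // k; rewrite in_fset1 => /eqP->.
Qed.

Lemma greens_split F G x : finLam F -> finLam G -> enorm x <= 1 -> x \notin F -> x \notin G ->
  greens w F x <= greens w G x + greens w (F `\` G)%fset x.
Proof.
move=> FL GL x1 xF xG; rewrite /greens [leLHS](bigID (mem G))/=; apply: lerD.
  rewrite -big_filter; apply: sum_le_uniq_sub; rewrite ?filter_uniq ?fset_uniq//.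
    by move=> l; rewrite mem_filter => /andP[].
  by move=> l lG; exact: green_term_ge0 lG.
rewrite -big_filter; apply: sum_le_uniq_sub; rewrite ?filter_uniq ?fset_uniq//.
  by move=> l; rewrite mem_filter in_fsetD.
move=> l; rewrite in_fsetD => /andP[_ lF]; exact: green_term_ge0 lF.
Qed.

Lemma greens_le_of_far F x r : finLam F -> 0 < r -> enorm x <= 1 ->
  (forall l, l \in F -> r <= enorm (x - l)) ->
  greens w F x <= r^-1 ^+ d * (d%:R * 4) * \sum_(l <- F) w l * (1 - enorm l).
Proof.
move=> FL r0 x1 far; rewrite /greens mulr_sumr big_seq [leRHS]big_seq; apply: ler_sum => l lF.
have l1 := finLam_norm FL lF; have w0 := ltW (weight_gt0 H (FL l lF)).
rewrite mulrCA; apply: ler_wpM2l => //.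
apply: le_trans (green1_upper (so_dim H) r0 (far l lF) l1 x1) _.
rewrite -!mulrA; apply: ler_wpM2l; first by rewrite exprn_ge0// invr_ge0 ltW.
apply: ler_wpM2l => //; apply: ler_wpM2l => //.
rewrite -[leRHS]mul1r; apply: ler_wpM2r; first by rewrite subr_ge0.
by rewrite gerDl oppr_le0 enorm_ge0.
Qed.

(** An infimum over finite sets instead of one minus a series: it is meaningful, possibly with value
    -oo, before any convergence is known. *)
Definition superpotential x : \bar R := ereal_inf [set (1 - greens w F x)%:E | F in finLam].

Lemma superpotential_le F x : finLam F -> (superpotential x <= (1 - greens w F x)%:E)%E.
Proof. by move=> FL; apply: ereal_inf_lbound; exists F. Qed.

Lemma superpotential_lt x (a : R) : (superpotential x < a%:E)%E ->
  exists2 F, finLam F & 1 - greens w F x < a.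
Proof. by move=> /ereal_inf_lt[_ [F FL <-]]; rewrite lte_fin; exists F. Qed.

Lemma superpotential_le1 x : (superpotential x <= 1%:E)%E.
Proof.
have := @superpotential_le fset0 x; rewrite /greens big_seq_fset0 subr0; apply.
by move=> l; rewrite in_fset0.
Qed.

Lemma partial_potential_continuous F x : finLam F -> enorm x <= 1 -> x \notin F ->
  {for x, continuous (fun y => 1 * quad 0 0 1 y + (-1) * greens w F y)}.
Proof.
move=> FL x1 xF; apply: continuous_lin; first exact: quad_continuous.
by apply: (greens_continuous _ x1 xF) => l; exact: finLam_norm.
Qed.

Lemma partial_potentialE F y : 1 * quad 0 0 1 y + (-1) * greens w F y = 1 - greens w F y.
Proof. by rewrite quad_cst mul1r mulN1r. Qed.

Lemma partial_potential_subharmonic F : finLam F ->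
  subharmonic_on Om (EFin \o (fun y => 1 * quad 0 0 1 y + (-1) * greens w F y)).
Proof.
move=> FL; have d0 : (0 < d)%N by exact: leq_trans (so_dim H).
apply: (harmonic_subharmonic d0 (so_open H)).
- apply: (harmonic_lin _ _ (so_open H)); first exact: affine_harmonic (so_open H).
  apply: (greens_harmonic w (so_open H)) => [l|x Ox]; first exact: finLam_norm.
  by split; [exact: ltW (so_Om_norm Ox)|exact: Om_notin].
- move=> x Ox; apply: partial_potential_continuous => //; first exact: ltW (so_Om_norm Ox).
  exact: Om_notin.
Qed.

(** An infimum of continuous functions is upper semicontinuous. For the sub-mean property,
    compactness of the sphere and monotonicity in [F] give one finite [F] whose harmonic function
    lies below h + t on the whole sphere, hence at the centre. *)
Lemma superpotential_subharmonic : subharmonic_on Om superpotential.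
Proof.
apply: (subharmonic_intro (so_open H)) => x Ox.
- by apply: le_lt_trans (superpotential_le1 x) _; exact: ltry.
- move=> a /superpotential_lt[F FL]; rewrite -partial_potentialE => Fa.
  have FF : Filter (nbhs x) by exact: nbhs_filter.
  have xc := partial_potential_continuous FL (ltW (so_Om_norm Ox)) (Om_notin FL Ox).
  apply: filterS (@cvgr_lt _ _ (nbhs x) _ _ _ xc a Fa) => y Hy _.
  by apply: le_lt_trans (superpotential_le y FL) _; rewrite lte_fin -partial_potentialE.
have [e e0 eO] := open_eball_sub (so_open H) Ox.
exists e => // r h /andP[r0 re] hc hh hs.
have crO : closed_eball x r `<=` Om by move=> y xy; apply: eO; apply: le_trans xy (ltW re).
apply/lee_addgt0Pr => t t0; rewrite -EFinD.
have [F FL HF] : exists2 F, finLam F & forall y, esphere x r y ->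
    1 - greens w F y < h y + t.
  apply: compact_directed; first exact: esphere_compact.
    move=> F G y FG GL sy Fy; apply: le_lt_trans Fy; rewrite lerD2l lerN2.
    have Oy : Om y by apply: crO; rewrite /closed_eball /= [enorm _]sy.
    by apply: greens_mono => //; [exact: ltW (so_Om_norm Oy)|exact: Om_notin].
  move=> y sy; have cy : closed_eball x r y by rewrite /closed_eball /= [enorm _]sy.
  have Oy := crO y cy.
  have [F FL Fy] : exists2 F, finLam F & 1 - greens w F y < h y + t / 2.
    apply: superpotential_lt; apply: le_lt_trans (hs y sy) _.
    by rewrite lte_fin ltrDl divr_gt0.
  exists F => //; rewrite -partial_potentialE in Fy.
  have FF : Filter (nbhs y) by exact: nbhs_filter.
  have yc := partial_potential_continuous FL (ltW (so_Om_norm Oy)) (Om_notin FL Oy).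
  have n1 : \forall z \near y, 1 * quad 0 0 1 z + (-1) * greens w F z < h y + t / 2.
    exact: (@cvgr_lt _ _ (nbhs y) _ _ _ yc _ Fy).
  have n2 : \forall z \near y, closed_eball x r z -> h y - t / 2 < h z.
    apply: (@within_continuous_near _ _ _ h y [set s | h y - t / 2 < s] hc cy).
    apply: open_nbhs_nbhs; split; first exact: open_gt.
    by rewrite /= ltrBlDr ltrDl divr_gt0.
  apply: filterS2 n1 n2 => z; rewrite partial_potentialE => Hz1 Hz2 sz.
  have := Hz2 _; rewrite /closed_eball /= [enorm _]sz lexx => /(_ isT); lra.
have [_ _ Hsub] := partial_potential_subharmonic FL.
have Ht := Hsub x r (fun y => 1 * h y + 1 * quad 0 0 t y) r0 crO _ _ _ x _.
apply: (@le_trans _ _ (1 * h x + 1 * quad 0 0 t x)%:E); last first.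
  by rewrite quad_cst !mul1r.
apply: le_trans (superpotential_le x FL) _; rewrite -partial_potentialE.
apply: Ht.
- apply: within_continuous_lin => //; apply: continuous_within => y _.
  exact: quad_continuous.
- have oB := @open_eball_open R d x r.
  exact: (harmonic_lin _ _ oB hh (affine_harmonic _ _ oB)).
- move=> y sy; rewrite /= lee_fin partial_potentialE quad_cst !mul1r.
  by apply/ltW; exact: HF.
- by rewrite /closed_eball /= subrr enorm0 ltW.
Qed.

Lemma fset1_finLam l : Lam l -> finLam [fset l]%fset.
Proof. by move=> Ll k; rewrite in_fset1 => /eqP->. Qed.

(** At a centre the pole decides; elsewhere on the obstacle the weighted kernel is continuous and at
    least 1. The centre is excluded because [newton] only has a default value at the pole. *)
Lemma obstacle_green_near y (c : R) : obstacles Lam rad y -> c < 1 ->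
  exists2 l, Lam l & \forall z \near y, z <> l -> c < w l * green 1 l z.
Proof.
move=> [l Ll]; rewrite /closed_eball /= enormBC => yl c1; exists l => //.
have FF : Filter (nbhs y) by exact: nbhs_filter.
have [->|/eqP nyl] := eqVneq y l.
  by apply: filterS (weight_pole H Ll) => z Hz /Hz[_]; exact: lt_le_trans.
have [y1 w1] := weight_green H Ll nyl yl.
have gc : {for y, continuous (fun z => 0 * green 1 l z + w l * green 1 l z)}.
  by have gy := green_continuous ltr01 (ltW (so_norm1 H Ll)) (ltW y1) nyl; exact: continuous_lin.
have cg : c < 0 * green 1 l y + w l * green 1 l y.
  by rewrite mul0r add0r (lt_le_trans c1).
apply: filterS (@cvgr_gt _ _ (nbhs y) _ _ _ gc _ cg) => z + _.
by rewrite mul0r add0r.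
Qed.

Lemma superpotential_lower_class : lower_class Lam rad superpotential.
Proof.
apply: (lower_class_intro H superpotential_subharmonic).
  move=> y e _ _ e0; apply/nbhs_enorm; exists 1 => // z _ _.
  apply: le_trans (superpotential_le1 z) _.
  by rewrite lee_fin lerDl ltW.
move=> y e _ _ oy e0; have FF : Filter (nbhs y) by exact: nbhs_filter.
have e1 : 1 - e < 1 by rewrite ltrBlDr ltrDl.
have [l Ll nl] := obstacle_green_near oy e1.
apply: filterS nl => z Hz Oz; apply: le_trans (superpotential_le z (fset1_finLam Ll)) _.
rewrite lee_fin /greens big_seq_fset1.
have := Hz (so_Om_neq H Oz Ll); lra.
Qed.

(** Close to the unit sphere all centres of [F] are at least a fixed distance [m] away, and
    [green1_upper] bounds the potential by C (1 - |x|). *)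
Lemma greens_vanish F (e : R) : finLam F -> 0 < e -> exists2 s, 0 < s < 1 &
  forall x, s <= enorm x -> enorm x <= 1 -> x \notin F /\ greens w F x <= e.
Proof.
move=> FL e0.
have [G GL GF] : exists2 s, 0 < s < 1 & forall x, s <= enorm x -> enorm x <= 1 ->
   forall l, l \in (F : seq _) -> (1 - enorm l) / 2 <= enorm (x - l).
  have : forall l, l \in (F : seq _) -> enorm l < 1 by move=> l /FL /(so_norm1 H).
  elim: (F : seq _) => [|l s IH] Hs; first by exists (1 / 2); [lra|].
  have [|t /andP[t0 t1] Ht] := IH; first by move=> k ks; apply: Hs; rewrite inE ks orbT.
  have l1 := Hs l (mem_head _ _); have l0 := enorm_ge0 l.
  exists (Num.max t ((1 + enorm l) / 2)).
    by rewrite lt_max t0/= gt_max t1; lra.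
  move=> x; rewrite ge_max => /andP[tx lx] x1 k; rewrite inE => /predU1P[->|ks].
    by have := enormB_ge x l; lra.
  exact: Ht.
have [m m0 Hm] : exists2 m, 0 < m & forall l, l \in (F : seq _) -> m <= (1 - enorm l) / 2.
  have : forall l, l \in (F : seq _) -> enorm l < 1 by move=> l /FL /(so_norm1 H).
  elim: (F : seq _) => [|l s IH] Hs; first by exists 1.
  have [|t t0 Ht] := IH; first by move=> k ks; apply: Hs; rewrite inE ks orbT.
  have l1 := Hs l (mem_head _ _).
  exists (Num.min t ((1 - enorm l) / 2)); first by rewrite lt_min t0; lra.
  by move=> k; rewrite inE ge_min => /predU1P[->|/Ht->//]; rewrite lexx orbT.
pose C := m^-1 ^+ d * (d%:R * 4) * \sum_(l <- F) w l.
have w0 l : l \in (F : seq _) -> 0 <= w l by move=> lF; apply/ltW/(weight_gt0 H); exact: FL.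
have C0 : 0 <= C.
  rewrite /C mulr_ge0 ?mulr_ge0 ?exprn_ge0 ?invr_ge0 ?(ltW m0)//.
  by rewrite big_seq; apply: sumr_ge0.
have e1 : 0 < e / (C + 1) by rewrite divr_gt0// ltr_wpDl.
have /andP[G0 G1] := GL.
exists (Num.max G (1 - e / (C + 1))); first by rewrite lt_max G0/= gt_max G1; lra.
move=> x; rewrite ge_max => /andP[Gx ex] x1.
have far l : l \in F -> m <= enorm (x - l).
  by move=> lF; apply: le_trans (Hm l lF) _; exact: GF.
split; first by apply/negP => /far; rewrite subrr enorm0 leNgt m0.
apply: (@le_trans _ _ (C * (1 - enorm x))).
  rewrite /greens /C -mulrA mulr_suml mulr_sumr big_seq [leRHS]big_seq; apply: ler_sum => l lF.
  have l1 := finLam_norm FL lF.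
  have -> : m^-1 ^+ d * (d%:R * 4) * (w l * (1 - enorm x)) =
      w l * (m^-1 ^+ d * (d%:R * (4 * (1 - enorm x)))) by ring.
  apply: ler_wpM2l; first exact: w0.
  apply: le_trans (green1_upper (so_dim H) m0 (far l lF) l1 x1) _.
  apply: ler_wpM2l; first by rewrite exprn_ge0// invr_ge0 ltW.
  apply: ler_wpM2l => //; apply: ler_piMr; last by rewrite gerDl oppr_le0 enorm_ge0.
  by rewrite mulr_ge0// subr_ge0.
have ex' : 1 - enorm x <= e / (C + 1) by lra.
apply: le_trans (ler_wpM2l C0 ex') _.
rewrite mulrA ler_pdivrMr ?ltr_wpDl// mulrDr mulr1 mulrC lerDl; exact: ltW.
Qed.

(** * Consequences of summable weights: a positive lower function *)

Section Tail.
Context {B : R}.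
Hypothesis HB : forall F, finLam F -> \sum_(l <- F) w l * (1 - enorm l) <= B.

(** The centres with |l| <= 1 / 2 are put into [F0], so that all others are at distance at least 1 /
    2 from the origin and their potential is controlled by the weighted sum. *)
Lemma tail_at_origin : exists2 F0, finLam F0 & forall F, finLam F ->
  (forall l, l \in F -> l \notin F0) -> greens w F 0 <= 1 / 8.
Proof.
have half1 : (1 / 2 : R) < 1 by lra.
have finA := so_finite H half1.
pose A := fset_set (Lam `&` [set l | enorm l <= 1 / 2]).
pose c : R := (1 / 2)^-1 ^+ d * (d%:R * 4).
have c0 : 0 < c.
  by rewrite /c !mulr_gt0 ?exprn_gt0 ?invr_gt0 ?ltr0n//; exact: leq_trans (so_dim H).
have e0 : 0 < 1 / 8 / c by rewrite divr_gt0.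
have [F1 F1L HF1] := weight_tail_small HB e0.
exists (F1 `|` A)%fset.
  by move=> l; rewrite in_fsetU => /orP[/F1L//|]; rewrite in_fset_set// => /set_mem[].
move=> F FL dis.
have far l : l \in F -> 1 / 2 <= enorm (0 - l).
  move=> lF; rewrite sub0r enormN leNgt; apply/negP => /ltW l2.
  have := dis l lF; rewrite in_fsetU negb_or => /andP[_]; rewrite in_fset_set// => /negP; apply.
  by apply: mem_set; split => //; exact: FL.
have half0 : (0 : R) < 1 / 2 by lra.
apply: le_trans (greens_le_of_far FL half0 _ far) _; first by rewrite enorm0.
rewrite -/c mulrC -ler_pdivlMr//; apply: HF1 => l lF; split; first exact: FL.
by have := dis l lF; rewrite in_fsetU negb_or => /andP[].
Qed.

(** The maximum principle for minus the potential, on the ball without [F]. Near a point of [F] the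
    potential is at least 1 by [weight_pole], hence the restriction c <= 1. *)
Lemma greens_min_principle F s (c : R) : finLam F -> 0 < s < 1 -> c <= 1 ->
  (forall y, enorm y = s -> y \notin F -> c <= greens w F y) -> c <= greens w F 0.
Proof.
move=> FL /andP[s0 s1] c1 Hs; have hd := so_dim H.
pose V := open_eball (0 : 'rV[R]_d) s `\` [set` F].
have oV : open V.
  rewrite /V setDE; apply: openI; first exact: open_eball_open.
  apply: closed_openC.
  by apply: compact_closed; [exact: norm_hausdorff|exact/finite_compact/finite_fset].
have Vs z : V z -> enorm z < s by move=> [/open_eball0].
have V1 z : V z -> enorm z <= 1 by move=> /Vs zs; apply/ltW; exact: lt_trans s1.
have VF z : V z -> z \notin F by move=> [_ /negP].
pose f y := 0 * quad 0 0 0 y + (-1) * greens w F y.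
have fE y : f y = - greens w F y by rewrite /f mul0r add0r mulN1r.
have fc y : enorm y <= 1 -> y \notin F -> {for y, continuous f}.
  move=> y1 yF; apply: continuous_lin; first exact: quad_continuous.
  by apply: (greens_continuous _ y1 yF) => l; exact: finLam_norm.
have fh : harmonic_on V f.
  apply: harmonic_lin => //; first exact: affine_harmonic.
  apply: greens_harmonic => // [l|x Vx]; first exact: finLam_norm.
  by split; [exact: V1|exact: VF].
have V0 : V 0.
  split; first by apply/open_eball0; rewrite enorm0.
  by move=> /= /FL /(so_neq0 H); rewrite eqxx.
have d0 : (0 < d)%N by exact: leq_trans hd.
have : ((EFin \o f) 0%R <= (quad 0 0 (- c) (0%R : 'rV[R]_d))%:E)%E.
  apply: (@max_principle _ _ V 1 (EFin \o f) (quad 0 0 (- c)) oV) V0.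
  - exact: V1.
  - by move=> z _; exact: ltry.
  - by move=> z Vz; apply: continuous_usc; apply: fc; [exact: V1|exact: VF].
  - by move=> z Vz; apply: harmonic_submean Vz => // x Vx; apply: fc; [exact: V1|exact: VF].
  - by move=> z _; exact: quad_continuous.
  - exact: affine_harmonic.
  move=> y e cy nVy e0; have FF : Filter (nbhs y) by exact: nbhs_filter.
  have ys : enorm y <= s by apply: closure_norm_le cy => z /Vs/ltW.
  have [yF|yF] := boolP (y \in F).
    apply: filterS (weight_pole H (FL y yF)) => z Hz Vz; rewrite /= lee_fin fE quad_cst.
    have zy : z <> y by move=> E; have := VF z Vz; rewrite E yF.
    have [_ wz] := Hz zy.
    have := greens_term_le FL yF (V1 z Vz) (VF z Vz); rewrite -/w in wz *; lra.
  have ys' : enorm y = s.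
    apply/eqP; rewrite eq_le ys/= leNgt; apply/negP => ys'; apply: nVy; split.
      exact/open_eball0.
    by apply/negP.
  have y1 : enorm y <= 1 by rewrite ys' ltW.
  have fy : f y < - c + e by rewrite fE; have := Hs y ys' yF; lra.
  apply: filterS (@cvgr_lt _ _ (nbhs y) _ _ _ (fc y y1 yF) _ fy) => z Hz _.
  by rewrite /= lee_fin quad_cst ltW.
by rewrite /= lee_fin fE quad_cst lerN2.
Qed.

(** If no value were positive, each point of a sphere would have a finite potential above 1 / 2: by
    assumption in the domain, from a single obstacle elsewhere. Compactness makes [F] uniform. *)
Lemma superpotential_pos : exists2 x, Om x & (0 < superpotential x)%E.
Proof.
apply: contrapT => npos.
have u0 x : Om x -> (superpotential x <= 0)%E.
  by move=> Ox; rewrite leNgt; apply/negP => ?; apply: npos; exists x.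
have [F0 F0L HF0] := tail_at_origin.
have e0 : (0 : R) < 1 / 4 by lra.
have [s s01 Hs] := greens_vanish F0L e0; have /andP[s0 s1] := s01.
have sphP y : esphere 0 s y <-> enorm y = s by rewrite /esphere /= sub0r enormN.
have [F FL HF] : exists2 F, finLam F &
    forall y, esphere 0 s y -> y \notin F -> 1 / 2 <= greens w F y.
  apply: compact_directed; first exact: esphere_compact.
    move=> F G y FG GL /sphP ys Fy yG.
    have yF : y \notin F by apply: contra yG; exact: FG.
    by apply: le_trans (Fy yF) _; apply: greens_mono => //; rewrite ys ltW.
  move=> y /sphP ys; have FF : Filter (nbhs y) by exact: nbhs_filter.
  have y1 : enorm y <= 1 by rewrite ys ltW.
  have [Oy|nOy] := pselect (Om y).
    have [F FL Fy] : exists2 F, finLam F & 1 - greens w F y < 1 / 2.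
      by apply: superpotential_lt; apply: le_lt_trans (u0 y Oy) _; rewrite lte_fin; lra.
    exists F => //; rewrite -partial_potentialE in Fy.
    have yc := partial_potential_continuous FL y1 (Om_notin FL Oy).
    apply: filterS (@cvgr_lt _ _ (nbhs y) _ _ _ yc _ Fy) => z; rewrite partial_potentialE.
    by move=> ? _ _; lra.
  have oy : obstacles Lam rad y.
    by apply: contrapT => no; apply: nOy; split => //; apply/open_eball0; rewrite ys.
  have h1 : (1 / 2 : R) < 1 by lra.
  have [l Ll nl] := obstacle_green_near oy h1.
  exists [fset l]%fset; first exact: fset1_finLam.
  apply: filterS nl => z Hz _ zF; rewrite /greens big_seq_fset1; apply/ltW; apply: Hz.
  by move=> E; rewrite E in_fset1 eqxx in zF.
(* Discarding [F0] costs at most 1 / 4 on the sphere, so at least 1 / 4 remains there and, by the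
   minimum principle, at the origin; the choice of [F0] allows only 1 / 8. *)
pose F' := (F `\` F0)%fset.
have F'L : finLam F' by move=> l; rewrite in_fsetD => /andP[_ /FL].
have : 1 / 4 <= greens w F' 0.
  apply: (@greens_min_principle F' s (1 / 4) F'L s01); first by lra.
  move=> y ys yF'; have y1 : enorm y <= 1 by rewrite ys ltW.
  have [yF0 yF0'] : y \notin F0 /\ greens w F0 y <= 1 / 4 by apply: Hs; rewrite ?ys ?lexx// ltW.
  have yF : y \notin F by apply: contra yF' => yF; rewrite in_fsetD yF0.
  have := HF y _ yF; rewrite sphP => /(_ ys).
  have := greens_split FL F0L y1 yF yF0; rewrite -/F'; lra.
have : greens w F' 0 <= 1 / 8 by apply: HF0 => // l; rewrite in_fsetD => /andP[].
lra.
Qed.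

(** Semicontinuity gives only upper bounds; the lower one comes from summability. The potential of
    [F0] is continuous at [x], and all other centres together contribute at most e near [x], being
    at distance at least r / 2. With e = b / 3 a third of the value survives. *)
Lemma superpotential_local_lower x : Om x -> (0 < superpotential x)%E ->
  exists2 e : R, 0 < e & \forall z \near x, (e%:E <= superpotential z)%E.
Proof.
move=> Ox ux; have [b ub] : exists b, superpotential x = b%:E.
  by move: ux (superpotential_le1 x); case: (superpotential x) => // b; exists b.
have b0 : 0 < b by rewrite -lte_fin -ub.
pose e := b / 3; have e0 : 0 < e by rewrite divr_gt0.
exists e => //; have [r r0 rO] := open_eball_sub (so_open H) Ox.
have r20 : 0 < r / 2 by rewrite divr_gt0.
pose c := (r / 2)^-1 ^+ d * (d%:R * 4).
have c0 : 0 < c.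
  by rewrite /c !mulr_gt0 ?exprn_gt0 ?invr_gt0 ?ltr0n//; exact: leq_trans (so_dim H).
have ec0 : 0 < e / c by rewrite divr_gt0.
have [F0 F0L HF0] := weight_tail_small HB ec0.
have FF : Filter (nbhs x) by exact: nbhs_filter.
have xc := partial_potential_continuous F0L (ltW (so_Om_norm Ox)) (Om_notin F0L Ox).
have F0x : b - e < 1 * quad 0 0 1 x + (-1) * greens w F0 x.
  rewrite partial_potentialE; have := superpotential_le x F0L; rewrite ub lee_fin.
  by rewrite /e; lra.
apply: filterS2 (near_enorm x r20) (@cvgr_gt _ _ (nbhs x) _ _ _ xc _ F0x) => z zx.
rewrite partial_potentialE => zF0.
have Oz : Om z by apply: rO; rewrite /closed_eball /= enormBC; lra.
have z1 := ltW (so_Om_norm Oz).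
apply: le_ereal_inf_tmp => _ [F FL <-]; rewrite lee_fin.
have := greens_split FL F0L z1 (Om_notin FL Oz) (Om_notin F0L Oz).
have F'L : finLam (F `\` F0)%fset by move=> l; rewrite in_fsetD => /andP[_ /FL].
have far l : l \in (F `\` F0)%fset -> r / 2 <= enorm (z - l).
  move=> /F'L Ll; rewrite leNgt; apply/negP => zl.
  have : Om l.
    apply: rO; rewrite /closed_eball /=; apply: le_trans (enorm_tri x z l) _.
    by rewrite (enormBC x z); lra.
  by move=> Ol; apply: (so_Om_neq H Ol Ll).
have := greens_le_of_far F'L r20 z1 far; rewrite -/c.
have : c * \sum_(l <- (F `\` F0)%fset) w l * (1 - enorm l) <= e.
  rewrite mulrC -ler_pdivlMr//; apply: HF0 => l lF; split; first exact: F'L.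
  by move: lF; rewrite in_fsetD => /andP[].
rewrite /e in zF0 *; lra.
Qed.

Lemma lower_class_positive : exists2 v, lower_class Lam rad v /\ (forall x, (0 <= v x)%E) &
  exists2 x, Om x & exists2 e : R, 0 < e & \forall z \near x, (e%:E <= v z)%E.
Proof.
have [x Ox ux] := superpotential_pos; have [e e0 ne] := superpotential_local_lower Ox ux.
have [Su _] := superpotential_lower_class; have oO := so_open H.
have d0 : (0 < d)%N by exact: leq_trans (so_dim H).
have S0 : subharmonic_on Om (EFin \o quad (0 : R) 0 0).
  apply: harmonic_subharmonic => //; first exact: affine_harmonic.
  by move=> z _; exact: quad_continuous.
pose v z := Order.max (superpotential z) ((EFin \o quad (0 : R) 0 0) z).
have q0 z : (EFin \o quad (0 : R) 0 0) z = 0%:E by rewrite /= quad_cst.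
exists v; last first.
  exists x => //; exists e => //; have FF : Filter (nbhs x) by exact: nbhs_filter.
  by apply: filterS ne => z ez; rewrite /v le_max ez.
split; last by move=> z; rewrite /v q0 le_max lexx orbT.
apply: (lower_class_intro H).
- apply: (subharmonic_intro oO) => z Oz.
  + by rewrite /v q0 gt_max ltry andbT (le_lt_trans (superpotential_le1 z))// ltry.
  + by apply: usc_max; exact: (subharmonic_usc _ Oz).
  + by apply: submean_max; exact: (subharmonic_submean oO _ Oz).
- move=> y t _ _ t0; apply/nbhs_enorm; exists 1 => // z _ _.
  rewrite /v q0 ge_max; apply/andP; split.
    by apply: le_trans (superpotential_le1 z) _; rewrite lee_fin lerDl ltW.
  by rewrite lee_fin addr_ge0// ltW.
move=> y t cy y1 oy t0; have FF : Filter (nbhs y) by exact: nbhs_filter.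
have nOy : ~ Om y by move=> [_].
apply: filterS (lower_class_obstacle H superpotential_lower_class cy nOy y1 t0) => z Hz Oz.
by rewrite /v q0 ge_max Hz//= lee_fin ltW.
Qed.

End Tail.
End Super.
End Potential.

(** * Propagation to the origin *)

Section Connectedness.
Context {R : realType} {d : nat}.
Implicit Types (x y z l o : 'rV[R]_d) (r s t : R).

(** The set where [Q] holds is relatively open and closed in the connected interval. *)
Lemma locally_constant_segment (Q : R -> Prop) :
  (forall t, 0 <= t <= 1 -> \forall s \near t, 0 <= s <= 1 -> (Q s <-> Q t)) -> Q 0 -> Q 1.
Proof.
move=> HQ Q0; have := @segment_connected R 0 1.
move=> /(_ [set t | 0 <= t <= 1 /\ Q t]) Hc.
have inE t : `[0, 1]%classic t <-> 0 <= t <= 1 by rewrite /= in_itv.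
suff : [set t | 0 <= t <= 1 /\ Q t] = `[0, 1]%classic.
  move=> E; have : `[0, 1]%classic (1 : R) by apply/inE; rewrite lexx ler01.
  by rewrite -E => -[].
apply: Hc.
- by exists 0; rewrite /= lexx ler01.
- exists (interior [set t | 0 <= t <= 1 -> Q t]); first exact: open_interior.
  apply/seteqP; split => [t [t01 Qt]|t [/inE t01 /interior_subset/(_ t01)]//].
  split; first exact/inE.
  by apply: filterS (HQ t t01) => s Hs s01; apply/(Hs s01).
exists (~` interior [set t | 0 <= t <= 1 -> ~ Q t]).
  by apply: open_closedC; exact: open_interior.
apply/seteqP; split => [t [t01 Qt]|t [/inE t01 nt]].
  by split; [exact/inE|move=> /interior_subset/(_ t01)].
split => //; apply: contrapT => nQ; apply: nt.
by apply: filterS (HQ t t01) => s Hs s01 /(Hs s01).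
Qed.

Lemma locally_constant_path (P : set 'rV[R]_d) (g : R -> 'rV[R]_d) :
  (forall t, 0 <= t <= 1 -> {for t, continuous g}) ->
  (forall t, 0 <= t <= 1 -> \forall z \near g t, P z <-> P (g t)) -> P (g 0) -> P (g 1).
Proof.
move=> gc HP; apply: (@locally_constant_segment (fun t => P (g t))) => t t01.
have H : \forall s \near t, P (g s) <-> P (g t) by exact: (gc t t01 _ (HP t t01)).
by apply: filterS H.
Qed.

Lemma segment_continuous x y : continuous (fun t : R => (1 - t) *: x + t *: y).
Proof.
move=> t; apply: cvgD; last by apply: cvgZr_tmp; exact: cvg_id.
by apply: cvgZr_tmp; apply: cvgB; [exact: cvg_cst|exact: cvg_id].
Qed.

Lemma annulus_arc_continuous x y l (a b : R) t : (1 - t) *: x + t *: y != 0 ->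
  {for t, continuous (fun s : R => l + (((1 - s) * a + s * b) / enorm ((1 - s) *: x + s *: y))
    *: ((1 - s) *: x + s *: y))}.
Proof.
move=> n0; rewrite /prop_for /continuous_at; apply: cvgD; first exact: cvg_cst.
apply: cvgZ; last exact: segment_continuous.
apply: cvgM.
  apply: cvgD; apply: cvgM; try exact: cvg_cst; last exact: cvg_id.
  by apply: cvgB; [exact: cvg_cst|exact: cvg_id].
apply: cvgV; first by rewrite gt_eqF// enorm_gt0.
have E : (fun s => enorm ((1 - s) *: x + s *: y)) =
    (fun z => enorm (z - 0)) \o (fun s => (1 - s) *: x + s *: y).
  by apply/funext => s /=; rewrite subr0.
rewrite E -[X in _ --> enorm X]subr0.
by apply: continuous_comp; [exact: segment_continuous|exact: enorm_continuous].
Qed.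

(** The path takes its direction from the segment between x - l and y - l, which avoids 0, and its
    distance to [l] from linear interpolation, so it never leaves the annulus. *)
Lemma annulus_path (P : set 'rV[R]_d) x y l r s : 0 <= r ->
  (forall z, r < enorm (z - l) < s -> \forall t \near z, P t <-> P z) ->
  (forall t, 0 <= t <= 1 -> (1 - t) *: (x - l) + t *: (y - l) != 0) ->
  r < enorm (x - l) < s -> r < enorm (y - l) < s -> P x -> P y.
Proof.
move=> r0 HP nz /andP[xr xs] /andP[yr ys].
pose a := enorm (x - l); pose b := enorm (y - l).
pose c t := (1 - t) *: (x - l) + t *: (y - l).
pose g (t : R) := l + (((1 - t) * a + t * b) / enorm (c t)) *: c t.
have a0 : 0 < a by exact: le_lt_trans xr.
have b0 : 0 < b by exact: le_lt_trans yr.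
have g0 : g 0 = x.
  by rewrite /g /c subr0 mul1r mul0r addr0 scale1r scale0r addr0 divff ?gt_eqF// scale1r
    addrC subrK.
have g1 : g 1 = y.
  by rewrite /g /c subrr mul0r mul1r add0r scale0r scale1r add0r divff ?gt_eqF// scale1r
    addrC subrK.
suff : P (g 0) -> P (g 1) by rewrite g0 g1.
apply: locally_constant_path => t t01.
  exact: annulus_arc_continuous (nz t t01).
apply: HP; have c0 : 0 < enorm (c t) by apply: enorm_gt0; exact: nz.
have /andP[t0 t1] := t01.
have ab : 0 <= (1 - t) * a + t * b.
  by rewrite addr_ge0// mulr_ge0 ?subr_ge0// ltW.
have -> : enorm (g t - l) = (1 - t) * a + t * b.
  rewrite /g addrC addKr enormZ ger0_norm; last by rewrite divr_ge0// ltW.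
  by rewrite divfK// gt_eqF.
have [t_0|t_0] := eqVneq t 0.
  by rewrite t_0 subr0 mul1r mul0r addr0 xr xs.
have tp : 0 < t by rewrite lt_neqAle eq_sym t_0.
have H1 : (1 - t) * r <= (1 - t) * a by rewrite ler_wpM2l ?subr_ge0// ltW.
have H2 : (1 - t) * a <= (1 - t) * s by rewrite ler_wpM2l ?subr_ge0// ltW.
have H3 : t * r < t * b by rewrite ltr_pM2l.
have H4 : t * b < t * s by rewrite ltr_pM2l.
by apply/andP; split; lra.
Qed.

Lemma exists_coord_neq0 x : x != 0 -> exists i, x 0 i != 0.
Proof.
move=> x0; apply: contrapT => nx; case/eqP: x0; apply/rowP => i; rewrite mxE.
by apply/eqP; apply: contraT => ni; exfalso; apply: nx; exists i.
Qed.

Lemma exists_ord_avoiding (hd : (3 <= d)%N) (i j : 'I_d) : exists k : 'I_d, k != i /\ k != j.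
Proof.
have : (0 < #|[set~ i] :\ j|)%N.
  have := cardsC1 i; rewrite card_ord => Ci.
  have := cardsD1 j [set~ i]; rewrite Ci => E.
  by move: E; case: (j \in _) => /= E; move: hd E; lia.
by case/card_gt0P => k; rewrite !inE => /andP[kj ki]; exists k.
Qed.

(* In dimension at least [3] any two points of an annulus are joined through a
   point on a coordinate axis that avoids both directions. *)
Lemma annulus_connected (hd : (3 <= d)%N) (P : set 'rV[R]_d) l r s x y : 0 <= r ->
  (forall z, r < enorm (z - l) < s -> \forall t \near z, P t <-> P z) ->
  r < enorm (x - l) < s -> r < enorm (y - l) < s -> P x -> P y.
Proof.
move=> r0 HP xrs yrs.
have nz0 z : r < enorm (z - l) < s -> z - l != 0.
  by move=> /andP[rz _]; apply/eqP => E; move: rz; rewrite E enorm0 ltNge r0.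
have [i xi] := exists_coord_neq0 (nz0 x xrs); have [j yj] := exists_coord_neq0 (nz0 y yrs).
have [k [ki kj]] := exists_ord_avoiding hd i j.
have rs : r < s by have /andP[] := xrs; exact: lt_trans.
pose o := l + ((r + s) / 2) *: delta_mx 0 k.
have ol : o - l = ((r + s) / 2) *: delta_mx 0 k by rewrite /o addrC addKr.
have c0 : 0 < (r + s) / 2 by lra.
have no : enorm (o - l) = (r + s) / 2.
  rewrite ol enormZ gtr0_norm// enormE dot_delta mxE !eqxx sqrtr1 mulr1//.
have ors : r < enorm (o - l) < s by rewrite no; lra.
have ocoord m : m != k -> (o - l) 0 m = 0.
  by move=> mk; rewrite ol !mxE (negPf mk) andbF mulr0.
(* In coordinate [m] only z - l contributes, so a vanishing combination has coefficient 0 at z - l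
   and then reduces to o - l, which is nonzero. *)
have avoid z m : (z - l) 0 m != 0 -> m != k -> forall t : R,
    (1 - t) *: (z - l) + t *: (o - l) != 0 /\ (1 - t) *: (o - l) + t *: (z - l) != 0.
  move=> zm mk t; have oo := nz0 o ors.
  have coordE (A B : 'rV[R]_d) (a b : R) : (a *: A + b *: B) 0 m = a * A 0 m + b * B 0 m.
    by rewrite !mxE.
  split; apply/eqP => E; have := congr1 (fun A : 'rV[R]_d => A 0 m) E;
    rewrite coordE (ocoord _ mk) [RHS]mxE.
    rewrite mulr0 addr0 => /eqP; rewrite mulf_eq0 (negPf zm) orbF => /eqP t1.
    move: E; rewrite t1 scale0r add0r; have -> : t = 1 by lra.
    by rewrite scale1r => E; rewrite E eqxx in oo.
  rewrite mulr0 add0r => /eqP; rewrite mulf_eq0 (negPf zm) orbF => /eqP t1.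
  move: E; rewrite t1 scale0r addr0 subr0 scale1r => E.
  by rewrite E eqxx in oo.
rewrite eq_sym in ki; rewrite eq_sym in kj.
move=> Px; have Po : P o.
  by apply: (@annulus_path P x o l r s r0 HP) => // t _; have [] := avoid x i xi ki t.
by apply: (@annulus_path P o y l r s r0 HP) => // t _; have [] := avoid y j yj kj t.
Qed.

(** * Spreading positivity through the domain and around obstacles *)

Section Positivity.
Context {Lam : set 'rV[R]_d} {rad : 'rV[R]_d -> R} {phi : R -> R}.
Hypothesis H : spaced_obstacles Lam rad phi.

Let Om := open_eball (0 : 'rV[R]_d) 1 `\` obstacles Lam rad.

(** A positive bound on a neighbourhood is required because lower functions are only upper
    semicontinuous; this makes the property open. The function [v] may change with the point. *)
Definition positive_near x := exists2 v : 'rV[R]_d -> \bar R,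
  lower_class Lam rad v /\ (forall z, (0 <= v z)%E) &
  exists2 e : R, 0 < e & \forall z \near x, (e%:E <= v z)%E.

Lemma positive_near_open x : positive_near x -> \forall z \near x, positive_near z.
Proof.
move=> [v Lv [e e0 ve]]; have FF : Filter (nbhs x) by exact: nbhs_filter.
by apply: filterS (nbhs_interior ve) => z vz; exists v => //; exists e.
Qed.

(* Away from a small ball about [x] the lower function is replaced by its maximum
   with a multiple of a Newton kernel, shifted to vanish on the sphere of radius [r]. *)
Lemma positive_near_spread x r : positive_near x -> 0 < r -> closed_eball x r `<=` Om ->
  forall z, enorm (z - x) < r -> positive_near z.
Proof.
move=> Px r0 rO z zr; have [v [Lv v0] [e e0 /nbhs_enorm[t0 t00 ve]]] := Px.
have hd := so_dim H; have oO := so_open H; have [Sv _] := Lv.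
have [t t_0 [tt0 tr]] := exists_lt_both t00 r0.
have d0 : (0 < d)%N by exact: leq_trans hd.
pose n := (d - 2)%N.
pose k y := newton (d := d) (quad 1 x (dot x x) y).
have kE y : y <> x -> k y = (enorm (y - x))^-1 ^+ n.
  move=> yx; rewrite /k newtonE ?quad_direct_gt0// quad_direct sqrtr_sqr.
  by rewrite ger0_norm// enorm_ge0.
(* With this constant the shifted kernel [b] is at most [e] from distance t / 2 on. *)
pose c := e * (t / 2) ^+ n.
have t2 : 0 < t / 2 by rewrite divr_gt0.
have c0 : 0 < c by rewrite mulr_gt0// exprn_gt0.
pose b y := c * k y + (- (c * r^-1 ^+ n)) * quad 0 0 1 y.
have bE y : y <> x -> b y = c * ((enorm (y - x))^-1 ^+ n - r^-1 ^+ n).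
  by move=> yx; rewrite /b kE// quad_cst; ring.
have far_neq y (a : R) : 0 <= a -> a < enorm (y - x) -> y <> x.
  by move=> a0 + yx; rewrite yx subrr enorm0 ltNge a0.
have b_le y : t / 2 <= enorm (y - x) -> b y <= e.
  move=> ty; have yx : y <> x by move=> E; move: ty; rewrite E subrr enorm0 leNgt t2.
  rewrite bE//; apply: (@le_trans _ _ (c * (t / 2)^-1 ^+ n)).
    rewrite ler_pM2l//; apply: le_trans (ler_invX n t2 ty).
    by rewrite gerDl oppr_le0 exprn_ge0// invr_ge0 ltW.
  by rewrite /c -mulrA -exprMn mulfV ?gt_eqF// expr1n mulr1.
have b_le0 y : r <= enorm (y - x) -> b y <= 0.
  move=> ry; have yx : y <> x by move=> E; move: ry; rewrite E subrr enorm0 leNgt r0.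
  by rewrite bE// pmulr_rle0// subr_le0 ler_invX.
(* For t / 2 <= |y - x| < t one has b <= e <= v, so both branches agree there. Hence v' is locally
   either [v] or the maximum of [v] and [b], and the pole of [b] is never met. *)
pose v' y := if enorm (y - x) < t / 2 then v y else Order.max (v y) (EFin (b y)).
have v'v y : (v y <= v' y)%E by rewrite /v'; case: ifP => // _; rewrite le_max lexx.
have v'_in y : enorm (y - x) < t -> v' y = v y.
  move=> yt; rewrite /v'; case: ltP => // ty; apply/max_idPl.
  apply: (@le_trans _ _ e%:E); first by rewrite lee_fin b_le.
  by apply: ve; exact: lt_trans tt0.
have v'_out y : t / 2 <= enorm (y - x) -> v' y = Order.max (v y) ((EFin \o b) y).
  by move=> ty; rewrite /v' ltNge ty.
pose U := [set y | 0 < enorm (y - x)].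
have oU : open U.
  apply: (@open_comp _ _ (fun y => enorm (y - x)) [set s | 0 < s]); last exact: open_gt.
  by move=> y _; exact: enorm_continuous.
have Ux y : U y -> y <> x by move=> Uy; exact: far_neq Uy.
have kh : harmonic_on U k.
  apply: (@harmonic_sub _ _ [set y | 0 < quad 1 x (dot x x) y]).
    by move=> y /Ux; exact: quad_direct_gt0.
  by apply: powR_quad_harmonic; rewrite mul1r.
have bh : harmonic_on U b by exact: (harmonic_lin _ _ oU kh (affine_harmonic _ _ oU)).
have bc y : U y -> {for y, continuous b}.
  move=> /Ux yx; apply: continuous_lin; last exact: quad_continuous.
  by apply: powR_quad_continuous; exact: quad_direct_gt0.
have near_out y : t <= enorm (y - x) -> \forall q \near y, t / 2 <= enorm (q - x).
  move=> ty; have ty2 : 0 < enorm (y - x) - t / 2 by lra.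
  have FF : Filter (nbhs y) by exact: nbhs_filter.
  apply: filterS (near_enorm y ty2) => q.
  by have := enorm_tri y q x; rewrite (enormBC y q); lra.
have near_in y : enorm (y - x) < t -> \forall q \near y, enorm (q - x) < t.
  move=> ty; have ty2 : 0 < t - enorm (y - x) by lra.
  have FF : Filter (nbhs y) by exact: nbhs_filter.
  apply: filterS (near_enorm y ty2) => q.
  by have := enorm_tri q y x; lra.
have Sv' : subharmonic_on Om v'.
  apply: (subharmonic_intro oO) => y Oy; have FF : Filter (nbhs y) by exact: nbhs_filter.
  - have [vy _ _] := Sv; rewrite /v'; case: ifP => _; first exact: vy.
    by rewrite gt_max ltry andbT; exact: vy.
  - have [yt|ty] := ltP (enorm (y - x)) t.
      apply: (usc_near (subharmonic_usc Sv Oy) Oy).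
      by apply: filterS (near_in y yt) => q qt _; rewrite v'_in.
    have Uy : U y by rewrite /U /=; lra.
    have Hu := usc_max (subharmonic_usc Sv Oy) (continuous_usc Om (bc y Uy)).
    apply: (usc_near Hu Oy).
    by apply: filterS (near_out y ty) => q qt _; rewrite v'_out.
  - have [yt|ty] := ltP (enorm (y - x)) t.
      apply: (submean_lift (subharmonic_submean oO Sv Oy)); first by rewrite v'_in.
      by apply: filterS (near_in y yt) => q qt; rewrite v'_in.
    have Uy : U y by rewrite /U /=; lra.
    have Hb := harmonic_submean d0 oU bh bc Uy.
    apply: (submean_lift (submean_max (subharmonic_submean oO Sv Oy) Hb)).
      by rewrite v'_out//; lra.
    by apply: filterS (near_out y ty) => q qt; rewrite v'_out.
(* Points outside the domain are farther than [r] from [x], where b <= 0; the boundary behaviour of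
   [v] is inherited. *)
have v'_bd y (a : R) : ~ Om y -> 0 < a -> (\forall q \near y, Om q -> (v q <= a%:E)%E) ->
    \forall q \near y, Om q -> (v' q <= a%:E)%E.
  move=> nOy a0 va; have FF : Filter (nbhs y) by exact: nbhs_filter.
  have ry : 0 < enorm (y - x) - r.
    rewrite subr_gt0 ltNge; apply/negP => yr; apply: nOy; apply: rO.
    by rewrite /closed_eball /= enormBC.
  apply: filterS2 va (near_enorm y ry) => q vq qy Oq.
  have rq : r <= enorm (q - x) by have := enorm_tri y q x; rewrite (enormBC y q); lra.
  rewrite v'_out; last by lra.
  by rewrite ge_max vq//= lee_fin; apply: le_trans (b_le0 q rq) _; exact: ltW.
have Lv' : lower_class Lam rad v'.
  apply: (lower_class_intro H Sv').
    move=> y a cy y1 a0; have nOy : ~ Om y by move=> /so_Om_norm; rewrite y1 ltxx.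
    by apply: v'_bd => //; [rewrite addr_gt0|exact: (lower_class_sphere H Lv)].
  move=> y a cy y1 oy a0; have nOy : ~ Om y by move=> [_].
  by apply: v'_bd => //; exact: (lower_class_obstacle H Lv).
have v'0 y : (0 <= v' y)%E by exact: le_trans (v0 y) (v'v y).
have FF : Filter (nbhs z) by exact: nbhs_filter.
exists v' => //; have [zt|tz] := ltP (enorm (z - x)) t.
  exists e => //; apply: filterS (near_in z zt) => q qt.
  by apply: le_trans (v'v q); apply: ve; exact: lt_trans tt0.
pose m := (enorm (z - x) + r) / 2.
have mr : m < r by rewrite /m; lra.
have m0 : 0 < m by rewrite /m; lra.
have zm : 0 < m - enorm (z - x) by rewrite /m; lra.
exists (c * (m^-1 ^+ n - r^-1 ^+ n)).
  rewrite pmulr_rgt0// subr_gt0 ltr_pXn2r ?nnegrE ?invr_ge0 ?(ltW m0) ?(ltW r0)//.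
    by rewrite ltf_pV2 ?posrE.
  by rewrite /n subn_gt0.
apply: filterS2 (near_out z tz) (near_enorm z zm) => q qt qz.
have qm : enorm (q - x) <= m by have := enorm_tri q z x; lra.
rewrite v'_out// le_max; apply/orP; right; rewrite lee_fin.
have q0 : 0 < enorm (q - x) by exact: lt_le_trans qt.
by rewrite bE; [rewrite ler_pM2l// lerD2r; exact: ler_invX|exact: Ux].
Qed.

(** If a point close to [x] is positive, the ball of radius r / 2 about it lies in the domain and
    contains [x], so positivity spreads back. *)
Lemma positive_near_locally_constant x : Om x ->
  \forall z \near x, positive_near z <-> positive_near x.
Proof.
move=> Ox; have FF : Filter (nbhs x) by exact: nbhs_filter.
have [Px|nPx] := pselect (positive_near x).
  by apply: filterS (positive_near_open Px) => z Pz; split.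
have [r r0 rO] := open_eball_sub (so_open H) Ox.
have r2 : 0 < r / 2 by rewrite divr_gt0.
apply: filterS (near_enorm x r2) => z zx; split => // Pz.
apply: (positive_near_spread Pz r2); last by rewrite enormBC.
move=> y zy; apply: rO; rewrite /closed_eball /=.
by move: zy zx; rewrite /closed_eball /= (enormBC z x); have := enorm_tri x z y; lra.
Qed.

(** The other obstacles together with the exterior of the unit ball form a closed set, by local
    finiteness, that is disjoint from this obstacle. Cutting it off at radius rad l + 1 makes it
    compact, so a nearest point exists. *)
Lemma obstacle_collar l : Lam l -> exists2 s, rad l < s & forall z, enorm (z - l) < s ->
  open_eball 0 1 z /\ forall l', Lam l' -> enorm (z - l') <= rad l' -> l' = l.
Proof.
move=> Ll; pose Lam' := Lam `\ l.
have oO : open (open_eball 0 1 `\` obstacles Lam' rad).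
  by apply: (so_open_sub H) => k [].
set O := _ `\` _ in oO.
have KO : closed_eball l (rad l) `<=` O.
  move=> y ly; split; first exact: (so_in H Ll ly).
  move=> [k [Lk nkl] ky]; apply: nkl; apply: (so_disj H) => //.
  by exists y.
pose K := closed_eball l (rad l + 1) `&` ~` O.
have cK : compact K.
  apply: (subclosed_compact _ (@closed_eball_compact _ _ l (rad l + 1))); last by move=> y [].
  by apply: closedI; [exact: closed_eball_closed|exact: open_closedC].
have sub s z : (forall y, K y -> s <= enorm (y - l)) -> s <= rad l + 1 -> enorm (z - l) < s ->
    open_eball 0 1 z /\ forall l', Lam l' -> enorm (z - l') <= rad l' -> l' = l.
  move=> Ks s1 zs; have [z1 nz] : O z.
    apply: contrapT => nO; have : K z.
      by split => //; rewrite /closed_eball /= enormBC; lra.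
    by move=> /Ks; rewrite leNgt zs.
  split => // k Lk zk; apply: contrapT => kl; apply: nz; exists k => //.
  by rewrite /closed_eball /= enormBC.
have [K0|/set0P K0] := eqVneq K set0.
  exists (rad l + 1); first by rewrite ltrDl.
  by move=> z; apply: sub => // y; rewrite K0.
have Kc : {within K, continuous (fun y => enorm (y - l))}.
  by apply: continuous_within => y _; exact: enorm_continuous.
have [y /set_mem Ky ymin] := compact_EVT_min K0 cK Kc.
exists (enorm (y - l)).
  rewrite ltNge; apply/negP => yl; have [_ nO] := Ky; apply: nO; apply: KO.
  by rewrite /closed_eball /= enormBC.
move=> z; apply: sub => [q Kq|]; first by apply: ymin; exact: mem_set.
by have [+ _] := Ky; rewrite /closed_eball /= enormBC.
Qed.

Lemma positive_near_origin x : Om x -> positive_near x -> positive_near 0.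
Proof.
move=> Ox Px; have hd := so_dim H; have FF z : Filter (nbhs z) by exact: nbhs_filter.
(* An obstacle is added to the set when the domain next to it is positive: the
   extended set is locally constant in the whole ball, whose segments suffice. *)
pose P' := [set z | (Om z /\ positive_near z) \/ exists l, [/\ Lam l, enorm (z - l) <= rad l &
  forall e, 0 < e -> exists2 y, rad l < enorm (y - l) < rad l + e & positive_near y]].
have P'Om z : Om z -> P' z <-> positive_near z.
  move=> Oz; split => [[[]//|[l [Ll zl _]]]|Pz]; last by left.
  by exfalso; have := so_Om_dist Oz Ll; rewrite ltNge zl.
have loc z : open_eball 0 1 z -> \forall y \near z, P' y <-> P' z.
  move=> z1; have [Oz|nOz] := pselect (Om z).
    apply: filterS2 (open_near (so_open H) Oz) (positive_near_locally_constant Oz) => y Oy Hy.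
    by rewrite P'Om// P'Om.
  have [l Ll zl] : obstacles Lam rad z by apply: contrapT => no; apply: nOz.
  rewrite /closed_eball /= enormBC in zl.
  have [s ls Hs] := obstacle_collar Ll.
  have r0 := so_rad_ge0 H Ll.
  have collarO y : rad l < enorm (y - l) < s -> Om y.
    move=> /andP[ly ys]; have [y1 yl'] := Hs y ys; split => // -[k Lk].
    rewrite /closed_eball /= enormBC => yk; have kl := yl' k Lk yk.
    by move: yk; rewrite kl leNgt ly.
  have conn y y' : rad l < enorm (y - l) < s -> rad l < enorm (y' - l) < s ->
      positive_near y -> positive_near y'.
    apply: (annulus_connected hd r0) => q qs; apply: positive_near_locally_constant.
    exact: collarO.
  pose S := exists2 y, rad l < enorm (y - l) < s & positive_near y.
  (* [S] does not mention [y], so the extended set is constant on the ball of radius [s] about [l].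
     Connectedness of the annulus reduces the collars of every width in its definition to this
     single one. *)
  have P'S y : enorm (y - l) < s -> P' y <-> S.
    move=> ys; have [yl|ly] := leP (enorm (y - l)) (rad l).
      split => [[[Oy _]|[k [Lk yk Hk]]]|[q qs Pq]].
      - by exfalso; have := so_Om_dist Oy Ll; rewrite ltNge yl.
      - have [_ /(_ k Lk yk) kl] := Hs y ys; subst k.
        have [|q qs Pq] := Hk (s - rad l); first by rewrite subr_gt0.
        by exists q => //; rewrite subrKC in qs.
      - right; exists l; split => // e e0.
        have sr : 0 < s - rad l by rewrite subr_gt0.
        have [m m0 [me ms]] := exists_lt_both e0 sr.
        have d0 : (0 < d)%N by exact: leq_trans hd.
        (* A point of the collar at distance less than [e] from the obstacle; the direction is
           arbitrary. *)
        pose o := l + (rad l + m) *: (delta_mx 0 (Ordinal d0) : 'rV[R]_d).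
        have no : enorm (o - l) = rad l + m.
          rewrite /o addrC addKr enormZ enormE dot_delta mxE !eqxx sqrtr1 mulr1.
          by rewrite ger0_norm// addr_ge0// ltW.
        exists o; first by rewrite no; lra.
        by apply: (conn q o qs) => //; rewrite no; lra.
    have yO : Om y by apply: collarO; rewrite ly.
    rewrite P'Om//; split => [Py|[q qs Pq]]; first by exists y; rewrite ?ly.
    by apply: (conn q y qs) => //; rewrite ly.
  have zs : 0 < s - enorm (z - l) by lra.
  apply: filterS (near_enorm z zs) => y yz.
  have ys : enorm (y - l) < s by have := enorm_tri y z l; lra.
  have zs' : enorm (z - l) < s by lra.
  by rewrite (P'S y ys) (P'S z zs').
have O0 := so_Om0 H.
apply/(P'Om 0 O0).
pose g (t : R) := (1 - t) *: x + t *: (0 : 'rV[R]_d).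
have g1 : g 1 = 0 by rewrite /g subrr scale0r scaler0 addr0.
have g0 : g 0 = x by rewrite /g subr0 scale1r scaler0 addr0.
rewrite -g1; apply: (@locally_constant_path P' g); last by rewrite g0; apply/P'Om.
  by move=> t _; exact: segment_continuous.
move=> t /andP[t0 t1]; apply: loc; apply/open_eball0.
rewrite /g scaler0 addr0 enormZ ger0_norm ?subr_ge0//.
apply: le_lt_trans (so_Om_norm Ox); apply: ler_piMl; first exact: enorm_ge0.
by rewrite gerDl oppr_le0.
Qed.

Lemma positive_near_avoidable : positive_near 0 -> avoidable (obstacles Lam rad).
Proof.
move=> [v [Lv _] [e e0 ve]]; rewrite /avoidable /harmonic_measure /perron.
apply: (@lt_le_trans _ _ e%:E); first by rewrite lte_fin.
apply: le_trans (nbhs_singleton ve) _; apply: ereal_sup_ubound.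
by exists v.
Qed.

End Positivity.
End Connectedness.

(** * The equivalence *)

Lemma spaced_obstacles_avoidable (R : realType) (d : nat) (Lam : set 'rV[R]_d)
    (rad : 'rV[R]_d -> R) (phi : R -> R) : spaced_obstacles Lam rad phi ->
  avoidable (obstacles Lam rad) <->
  (\int[lebesgue_measure]_(t in `[0%R, 1%R[) (profile_density phi (d - 2) t)%:E < +oo)%E.
Proof.
move=> H; split => [/(avoidable_sum_bounded H)[q [c [C [q01 c0 HC]]]]|].
  exact: (integral_lt_pinfty_of_sum (so_dec H) q01 c0 HC).
(* In the first direction the ratio of the shells is dictated by uniform density; here it is free,
   and 1 / 2 is the one used for counting centres. *)
have h01 : 0 < (2^-1 : R) < 1 by apply/andP; split; lra.
move=> /(sum_bounded_of_integral (so_dec H) h01)[C HC].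
have [B HB] := weight_sum_bounded H HC.
have [v Lv [x Ox ex]] := lower_class_positive H HB.
apply: positive_near_avoidable; apply: (positive_near_origin H Ox).
by exists v.
Qed.

Theorem theorem1p1 (R : realType) (d : nat) (hd : (3 <= d)%N)
    (Lam : set 'rV[R]_d) (rad : 'rV[R]_d -> R) (phi : R -> R)
    (hLam : Lam `<=` open_eball 0 1)
    (hreg : regularly_spaced Lam rad phi)
    (hdisj : trivIset Lam (fun l => closed_eball l (rad l)))
    (hin : forall l, Lam l -> closed_eball l (rad l) `<=` open_eball 0 1)
    (h0 : ~ obstacles Lam rad 0) :
  avoidable (obstacles Lam rad) <->
  (\int[lebesgue_measure]_(t in `[0%R, 1%R[)
     (phi t ^+ (d - 2) / (1 - t) ^+ (d - 1))%:E < +oo)%E.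
Proof.
have [hsep hdense hdec hrad] := hreg.
have H : spaced_obstacles Lam rad phi by [].
rewrite (spaced_obstacles_avoidable H).
by have -> : (d - 1)%N = (d - 2).+1 by lia.
Qed.
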